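(* Let $K=K_1\times\cdots\times K_n$, where each $K_j$ is a regular compact subset of $\mathbb C$. Let $V_{\alpha(i)}\in\mathcal P(\alpha(i))$ be the monic orthogonal polynomial for $\nu_K$ with leading term $z^{\alpha(i)}=z_1^{\alpha_1}\cdots z_n^{\alpha_n}$. Then $$\|V_{\alpha(i)}\|_{L^2(\nu_K)}\ge\prod_{j=1}^n\mathrm{Cap}(K_j)^{\alpha_j},$$ and hence $[W_{2,\alpha(i)}(K,1)]^2\ge1$. Equality holds in the displayed inequality for a given $\alpha(i)$ if and only if, for each $j\in\{1,\dots,n\}$, either $\alpha_j=0$, or $\partial\Omega_{K_j}=R_{\alpha_j}^{-1}(\partial\mathbb D)$ for some polynomial $R_{\alpha_j}$ of degree $\alpha_j$. In the case of equality, for every $c\in\mathbb N$ one also has $\|V_{c\alpha(i)}\|_{L^2(\nu_K)}=\prod_{j=1}^n\mathrm{Cap}(K_j)^{c\alpha_j}$, where $V_{c\alpha(i)}$ is the monic orthogonal polynomial for $\nu_K$ with leading term $z^{c\alpha(i)}$.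
   Context: Monomials $z^\alpha=z_1^{\alpha_1}\cdots z_n^{\alpha_n}$, $\alpha\in\mathbb N_0^n$, are enumerated as $e_0=1,e_1,e_2,\dots$ with $e_i=z^{\alpha(i)}$. The enumeration is such that $|\alpha(i)|=\alpha_1+\dots+\alpha_n$ is non-decreasing in $i$. Among multi-indices of equal length it is ordered lexicographically: for $|\alpha|=|\beta|$, $\beta\prec\alpha$ iff for some $l$ one has $\alpha_l<\beta_l$ and $\alpha_k=\beta_k$ for all $k<l$. $\mathcal P(\alpha(i))$ denotes the set of polynomials of the form $e_i+\sum_{j<i}c_je_j$ with $c_j\in\mathbb C$. For compact $K\subset\mathbb C^n$, $\|\cdot\|_K$ denotes the sup norm on $K$. Set $t_i(K)=\inf\{\|P\|_K:P\in\mathcal P(\alpha(i))\}$ and $\tau^-(K)=\liminf_{i\to\infty} t_i(K)^{1/|\alpha(i)|}$. $\nu_K$ is the normalized Monge–Ampère measure of $K$; for this product set it equals $\mu_{K_1}\otimes\cdots\otimes\mu_{K_n}$, with $\mu_{K_j}$ the equilibrium measure of $K_j$. The monic orthogonal polynomial for $\nu_K$ in $\mathcal P(\alpha(i))$ is the minimizer of the $L^2(\nu_K)$-norm there. $W_{2,\alpha(i)}(K,1)=\|V_{\alpha(i)}\|_{L^2(\nu_K)}/[\tau^-(K)]^{|\alpha(i)|}$. $\mathrm{Cap}$ is logarithmic capacity. A compact $E\subset\mathbb C$ is regular if its Green function with pole at infinity is continuous. $\Omega_{E}$ denotes the unbounded component of $\overline{\mathbb C}\setminus E$. *)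

(* Defs.v *)
(* Complex numbers are modelled by
   mathcomp-real-closed's [R[i]] (R : realType), equipped (through [^o]) with
   the topology of its norm, i.e. the Euclidean topology of the plane.
   Measures on the plane live on the Borel product space [R * R] and are
   transported to [C] by [p2c]. *)
From HB Require Import structures.
From mathcomp Require Import all_boot all_order all_algebra.
From mathcomp Require Import all_classical all_reals all_analysis.
From mathcomp Require Import complex.
Set Implicit Arguments.
Unset Strict Implicit.
Unset Printing Implicit Defensive.
Import Order.TTheory GRing.Theory Num.Theory.
Import numFieldNormedType.Exports.
Local Open Scope ring_scope.
Local Open Scope classical_set_scope.

Section Defs.
Variable R : realType.

Definition C := (R[i])^o.

Definition cabs (z : C) : R := ComplexField.Normc.normc z.

Definition p2c (p : R * R) : C := Complex p.1 p.2.

Definition expi (t : R) : C := Complex (cos t) (sin t).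

Definition cbounded (A : set C) : Prop :=
  exists M : R, forall z, A z -> cabs z <= M.

(** Omega_E: the unbounded connected component of C \ E, i.e. the union of all
    connected unbounded subsets of C \ E. *)
Definition Omega (E : set C) : set C :=
  [set z | exists A : set C,
     [/\ connected A, A `<=` ~` E, A z & ~ cbounded A]].

Definition cboundary (A : set C) : set C := closure A `\` interior A.

Definition harmonic_on (U : set C) (g : C -> R) : Prop :=
  [/\ open U,
      (forall z, U z -> {for z, continuous g}) &
      (forall z, U z -> exists2 rho : R, 0 < rho &
         forall r : R, 0 < r -> r < rho ->
           (\int[lebesgue_measure]_(t in `[0%R, (2 * pi)%R]) (g (z + Complex r 0 * expi t))%:E
              = (2 * pi * g z)%:E)%E)].

Definition continuous_green (E : set C) (g : C -> R) : Prop :=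
  [/\ continuous g,
      (forall z, ~ Omega E z -> g z = 0),
      harmonic_on (Omega E) g &
      (exists M r0 : R, forall z, r0 < cabs z -> `|g z - ln (cabs z)| <= M)].

Definition regular (E : set C) : Prop := exists g, continuous_green E g.

Definition supported_on (E : set C) (mu : probability (R * R)%type R) : Prop :=
  mu (p2c @^-1` (~` E)) = 0%E.

Definition log_kernel (p q : R * R) : \bar R :=
  if p == q then +oo%E else (- ln (cabs (p2c p - p2c q)))%:E.

Definition energy (mu : probability (R * R)%type R) : \bar R :=
  (\int[mu]_p (\int[mu]_q log_kernel p q))%E.

Definition min_energy (E : set C) : \bar R :=
  ereal_inf [set energy mu | mu in [set mu | supported_on E mu]].

(** Logarithmic capacity: Cap(E) = exp(-inf_mu I(mu)) (= 0 if E is polar). *)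
Definition cap (E : set C) : R :=
  match min_energy E with
  | EFin v => expR (- v)
  | _ => 0
  end.

Definition is_equilibrium (E : set C) (mu : probability (R * R)%type R) : Prop :=
  supported_on E mu /\ energy mu = min_energy E.

Variable n : nat.

Definition mdeg (a : 'I_n -> nat) : nat := (\sum_(k < n) a k)%N.

Definition lexprec (b a : 'I_n -> nat) : Prop :=
  exists l : 'I_n, (a l < b l)%N /\ forall k : 'I_n, (k < l)%N -> a k = b k.

Definition enum_before (b a : 'I_n -> nat) : Prop :=
  (mdeg b < mdeg a)%N \/ (mdeg b = mdeg a /\ lexprec b a).

Definition is_monomial_enum (alpha : nat -> 'I_n -> nat) : Prop :=
  (forall i j, (i < j)%N -> enum_before (alpha i) (alpha j)) /\
  (forall a : 'I_n -> nat, exists i, forall k, alpha i k = a k).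

Definition monom (a : 'I_n -> nat) (z : 'I_n -> C) : C :=
  \prod_(k < n) z k ^+ a k.

Definition inP (alpha : nat -> 'I_n -> nat) (i : nat) (P : ('I_n -> C) -> C) : Prop :=
  exists c : nat -> C, forall z,
    P z = monom (alpha i) z + \sum_(j < i) c j * monom (alpha j) z.

Definition prodset (K : 'I_n -> set C) : set ('I_n -> C) :=
  [set z | forall k, K k (z k)].

Definition supnorm (K : 'I_n -> set C) (P : ('I_n -> C) -> C) : R :=
  sup [set cabs (P z) | z in prodset K].

Definition tcheb (K : 'I_n -> set C) (alpha : nat -> 'I_n -> nat) (i : nat) : R :=
  inf [set supnorm K P | P in [set P | inP alpha i P]].

Definition tau_minus (K : 'I_n -> set C) (alpha : nat -> 'I_n -> nat) : R :=
  fine (limn_einf (fun i =>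
          ((tcheb K alpha i) `^ ((mdeg (alpha i))%:R)^-1)%:E)).

(** * Integration against nu_K = mu_1 (x) ... (x) mu_n (iterated integral) *)

Definition upd (z : 'I_n -> C) (j : 'I_n) (w : C) : 'I_n -> C :=
  fun k => if k == j then w else z k.

Fixpoint iter_int (mu : 'I_n -> probability (R * R)%type R) (l : seq 'I_n)
    (f : ('I_n -> C) -> \bar R) (z : 'I_n -> C) : \bar R :=
  match l with
  | [::] => f z
  | j :: l' => (\int[mu j]_p iter_int mu l' f (upd z j (p2c p)))%E
  end.

Definition nu_int (mu : 'I_n -> probability (R * R)%type R)
    (f : ('I_n -> C) -> \bar R) : \bar R :=
  iter_int mu (enum 'I_n) f (fun _ => 0).

Definition L2norm (mu : 'I_n -> probability (R * R)%type R)
    (P : ('I_n -> C) -> C) : R :=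
  Num.sqrt (fine (nu_int mu (fun z => ((cabs (P z)) ^+ 2)%:E))).

(** V is the monic orthogonal polynomial for nu_K in P(alpha(i)):
    the minimizer of the L^2(nu_K) norm in P(alpha(i)). *)
Definition is_MOP (mu : 'I_n -> probability (R * R)%type R)
    (alpha : nat -> 'I_n -> nat) (i : nat) (V : ('I_n -> C) -> C) : Prop :=
  inP alpha i V /\ forall Q, inP alpha i Q -> L2norm mu V <= L2norm mu Q.

Definition W2 (K : 'I_n -> set C) (mu : 'I_n -> probability (R * R)%type R)
    (alpha : nat -> 'I_n -> nat) (i : nat) (V : ('I_n -> C) -> C) : R :=
  L2norm mu V / (tau_minus K alpha) ^+ (mdeg (alpha i)).

End Defs.

(* Main.v *)
(* Write e = ln Cap(E) and g for the Green function of a regular compact E.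
   Fekete's inductive choice of points and weak compactness of probability
   measures on E give, for every c < -e, monic polynomials of arbitrarily large
   degree k with roots in E and sup norm at most exp(-ck); the Bernstein-Walsh
   inequality turns them into lower bounds for g.  Varying the equilibrium
   measure (Frostman) shows that its potential p is at least e everywhere, and
   comparing means over a large circle gives p = g + e on Omega; hence the
   boundary of Omega lies in the support of the measure.

   For a monic P of degree m, Jensen's inequality in the form ln y <= y - 1 yields
   \int |P| >= Cap(E)^m, and \int (|P| - Cap(E)^m)^2 >= 0 upgrades this to the L^2
   norm, with equality only if |P| = Cap(E)^m on the support.  Then P has no root
   in Omega, and the maximum principle identifies the boundary of Omega with
   {|P| = Cap(E)^m}.  Conversely, if the boundary of Omega is {|R| = 1} then
   |R| <= 1 on E, and m g <= ln |R| on Omega bounds the leading coefficient.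

   In several variables the product of the one-variable monic orthogonal
   polynomials is orthogonal to every monomial preceding z^alpha, because one of
   the exponents of such a monomial is smaller than that of z^alpha.  So the
   minimal norm is the product of the one-variable minima, each of which is at
   least Cap(K_j)^(alpha_j). *)

Require Import Defs.
From HB Require Import structures.
From mathcomp Require Import all_boot all_order all_algebra.
From mathcomp Require Import all_classical all_reals all_analysis.
From mathcomp Require Import measurable_realfun complex ring lra.
Set Implicit Arguments.
Unset Strict Implicit.
Unset Printing Implicit Defensive.
Import Order.TTheory GRing.Theory Num.Theory.
Import numFieldNormedType.Exports.
Local Open Scope ring_scope.
Local Open Scope classical_set_scope.
Local Notation Re := complex.Re.
Local Notation Im := complex.Im.

(** * Topology of the complex plane *)

Section PlaneTopology.
Variable R : realType.
Implicit Types (z w : C R) (r e : R) (A E : set (C R)) (u : C R -> R).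

(** Regularity gives the Green function only through its defining properties, so its link with the
    capacity has to be established. The bound g + e <= p follows from the maximum principle once p
    >= e holds everywhere. The reverse bound is not pointwise: each degree gives a different
    polynomial below g. What these share is the mean ln r over a large circle, which is also the
    mean of p. So g + e - p is nonpositive with nonnegative mean on that circle, hence zero there,
    and the strong maximum principle carries the equality through Omega. Harmonicity is used only as
    a local mean value property. The one mean to be computed, that of ln |x - w|, is a limit of sums
    over the 2^j-th roots of unity. The bound on [W2] also needs 0 < tau^- <= Cap(K_j) for every j.
    Positivity comes from t_i >= prod_j Cap(K_j)^(alpha_j), the upper bound from multi-indices
    supported on the single coordinate j, tested with the Fekete polynomials of K_j. Then
    (tau^-)^|alpha| <= prod_j Cap(K_j)^(alpha_j). For c alpha, equality is inherited because R^c and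
    R have the same level set of modulus 1. *)

Lemma cabs_norm z : `|z| = Complex (cabs z) 0 :> R[i].
Proof. by case: z => a b; rewrite normc_def. Qed.

Lemma cabs_ge0 z : 0 <= cabs z.
Proof. by case: z => a b; exact: sqrtr_ge0. Qed.

Lemma cabs0 : cabs (0 : C R) = 0.
Proof. exact: ComplexField.Normc.normc0. Qed.

Lemma cabs1 : cabs (1 : C R) = 1.
Proof. exact: ComplexField.Normc.normc1. Qed.

Lemma cabs_eq0 z : cabs z = 0 -> z = 0.
Proof. exact: ComplexField.Normc.eq0_normc. Qed.

Lemma cabs_gt0 z : z != 0 -> 0 < cabs z.
Proof.
move=> z0; rewrite lt_neqAle cabs_ge0 andbT eq_sym.
by apply: contra_neq z0 => /cabs_eq0.
Qed.

Lemma cabsM z w : cabs (z * w) = cabs z * cabs w.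
Proof. exact: ComplexField.Normc.normcM. Qed.

Lemma cabsV z : cabs z^-1 = (cabs z)^-1.
Proof. exact: ComplexField.Normc.normcV. Qed.

Lemma cabsX z n : cabs (z ^+ n) = cabs z ^+ n.
Proof. by elim: n => [|n IH]; rewrite ?expr0 ?cabs1// !exprS cabsM IH. Qed.

Lemma cabs_prod (I : Type) (s : seq I) (f : I -> C R) :
  cabs (\prod_(i <- s) f i) = \prod_(i <- s) cabs (f i).
Proof. by elim/big_ind2: _ => [|x ? y ? <- <-|//]; rewrite ?cabs1 ?cabsM. Qed.

Lemma cabsN z : cabs (- z) = cabs z.
Proof. by have := normrN (z : R[i]); rewrite !cabs_norm => -[]. Qed.

Lemma cabsD z w : cabs (z + w) <= cabs z + cabs w.
Proof.
by have := ler_normD (z : R[i]) w; rewrite !cabs_norm lecE/= addr0 eqxx.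
Qed.

Lemma cabsBC z w : cabs (z - w) = cabs (w - z).
Proof. by rewrite -cabsN opprB. Qed.

Lemma cabsB_ge z w : cabs z - cabs w <= cabs (z - w).
Proof. by rewrite lerBlDr (le_trans _ (cabsD _ _))// subrK. Qed.

Lemma cabs_tri z w v : cabs (z - w) <= cabs (z - v) + cabs (v - w).
Proof. by rewrite (le_trans _ (cabsD _ _))// addrA subrK. Qed.

Lemma cabs_dist z w : `|cabs z - cabs w| <= cabs (z - w).
Proof.
rewrite ler_norml cabsB_ge andbT lerNl opprB cabsBC; exact: cabsB_ge.
Qed.

Lemma cabs_real r : cabs (Complex r 0 : C R) = `|r|.
Proof. by rewrite /cabs /= expr0n/= addr0 sqrtr_sqr. Qed.

Lemma cabs_expi t : cabs (expi t : C R) = 1.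
Proof. by rewrite /cabs /= cos2Dsin2 sqrtr1. Qed.

Lemma cabs_le_ReIm (a b : R) : cabs (Complex a b : C R) <= `|a| + `|b|.
Proof.
have -> : (Complex a b : C R) = Complex a 0 + Complex 0 b.
  by rewrite /GRing.add /= addr0 add0r.
rewrite (le_trans (cabsD _ _))// cabs_real lerD2l.
by rewrite /cabs /= expr0n/= add0r sqrtr_sqr.
Qed.

Lemma normr_Re_le z : `|Re z| <= cabs z.
Proof.
case: z => a b; rewrite /cabs/= -sqrtr_sqr ler_wsqrtr// lerDl; exact: sqr_ge0.
Qed.

Lemma normr_Im_le z : `|Im z| <= cabs z.
Proof.
case: z => a b; rewrite /cabs/= -sqrtr_sqr ler_wsqrtr// lerDr; exact: sqr_ge0.
Qed.

(** The norm of [R[i]] takes its values in [R[i]], so the radius of a ball is itself a complex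
    number; being positive forces its imaginary part to vanish. *)
Lemma nbhsCP z A :
  nbhs z A <-> exists2 r : R, 0 < r & forall w, cabs (w - z) < r -> A w.
Proof.
split=> [/nbhs_ballP[[e e'] /=]|[r r0 H]].
  rewrite ltcE/= => /andP[/eqP ->] e0 H.
  exists e => // w wz; apply: H.
  by rewrite -ball_normE/= cabs_norm ltcE/= eqxx/= cabsBC.
apply/nbhs_ballP; exists (Complex r 0); first by rewrite /= ltcE/= eqxx.
move=> w; rewrite -ball_normE/= cabs_norm ltcE/= eqxx/= cabsBC => wz.
exact: H.
Qed.

Lemma continuousCP u z : {for z, continuous u} <->
  forall e, 0 < e -> exists2 d : R, 0 < d &
    forall w, cabs (w - z) < d -> `|u w - u z| < e.
Proof.
split=> [cu e e0|H B /nbhs_ballP[e /= e0 HB]].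
  have /nbhsCP[d d0 Hd] := cu _ (nbhsx_ballx (u z) e e0).
  by exists d => // w /Hd; rewrite /ball/= distrC.
have [d d0 Hd] := H e e0; apply/nbhsCP; exists d => // w /Hd uw.
by apply: HB; rewrite /ball/= distrC.
Qed.

Lemma lipschitz_continuousC u L :
  (forall z w, `|u z - u w| <= L * cabs (z - w)) -> continuous u.
Proof.
move=> uL z; apply/continuousCP => e e0.
have L1 : 0 < `|L| + 1 by rewrite ltr_wpDl.
exists (e / (`|L| + 1)); first by rewrite divr_gt0.
move=> w; rewrite ltr_pdivlMr// => H.
apply: le_lt_trans H; rewrite (le_trans (uL _ _))// mulrC ler_wpM2l ?cabs_ge0//.
by rewrite (le_trans (ler_norm _))// lerDl.
Qed.

Lemma continuous_cabs : continuous (@cabs R).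
Proof.
apply: (@lipschitz_continuousC _ 1) => z w; rewrite mul1r; exact: cabs_dist.
Qed.

Lemma continuous_Re : continuous (@Re R : C R -> R).
Proof.
apply: (@lipschitz_continuousC _ 1) => -[a b] [c d]; rewrite mul1r.
exact: (normr_Re_le (Complex a b - Complex c d)).
Qed.

Lemma continuous_Im : continuous (@Im R : C R -> R).
Proof.
apply: (@lipschitz_continuousC _ 1) => -[a b] [c d]; rewrite mul1r.
exact: (normr_Im_le (Complex a b - Complex c d)).
Qed.

Lemma p2cB (p q : R * R) : p2c p - p2c q = p2c (p.1 - q.1, p.2 - q.2).
Proof. by []. Qed.

Lemma p2c_ReIm z : p2c (Re z, Im z) = z.
Proof. by case: z. Qed.

Lemma continuous_p2c : continuous (@p2c R).
Proof.
move=> p A /nbhsCP[r r0 H]; apply/nbhs_ballP; exists (r / 2) => /=.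
  by rewrite divr_gt0.
move=> [a b] [/= h1 h2]; apply: H; rewrite p2cB/=.
rewrite (le_lt_trans (cabs_le_ReIm _ _))// (splitr r) ltrD//.
  by rewrite distrC.
by rewrite distrC.
Qed.

Lemma hausdorffC : hausdorff_space (C R).
Proof. exact: norm_hausdorff. Qed.

Lemma compactC_closed E : compact E -> closed E.
Proof. exact: (compact_closed hausdorffC). Qed.

Lemma compact_image_bounded (T : topologicalType) (f : T -> R) (K : set T) :
  compact K -> continuous f -> exists M, forall x, K x -> `|f x| <= M.
Proof.
move=> cK cf; have := @continuous_compact _ _ f K _ cK.
move=> /(_ _)/compact_bounded; case; first exact: continuous_subspaceT.
move=> M [_ /(_ (M + 1))]; rewrite ltrDl => /(_ ltr01) H.
by exists (M + 1) => x Kx; apply: H; exists x.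
Qed.

Lemma compactC_bounded E : compact E -> cbounded E.
Proof.
move=> /compact_image_bounded /(_ continuous_cabs)[M H]; exists M => z Ez.
by rewrite (le_trans (ler_norm _))// H.
Qed.

(** Heine-Borel, carried over from a square in R x R by the continuous map [p2c]. *)
Lemma bounded_closed_compactC E : cbounded E -> closed E -> compact E.
Proof.
move=> [M EM] cE.
have -> : E = (@p2c R) @` ((`[-M, M] `*` `[-M, M]) `&` (@p2c R @^-1` E)).
  apply/seteqP; split=> [z Ez|z [p [_ Ep] <-]//].
  exists (Re z, Im z); last exact: p2c_ReIm.
  split; last by rewrite /= p2c_ReIm.
  split; rewrite /= in_itv/= -ler_norml (le_trans _ (EM _ Ez))//.
    exact: normr_Re_le.
  exact: normr_Im_le.
apply: continuous_compact; first exact/continuous_subspaceT/continuous_p2c.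
apply: compact_closedI; first by apply: compact_setX; exact: segment_compact.
by move: cE; apply: preimage_closed => p _; exact: continuous_p2c.
Qed.

Lemma compactC_max u E : compact E -> E !=set0 ->
  (forall z, E z -> {for z, continuous u}) ->
  exists2 z, E z & forall w, E w -> u w <= u z.
Proof.
move=> cE E0 cu; have := @compact_EVT_max _ _ u E E0 cE.
case; first by apply: continuous_in_subspaceT => z /[!inE]; exact: cu.
move=> z /[!inE] Ez H; exists z => // w Ew; apply: H; exact: mem_set.
Qed.

Lemma closureCP A z :
  closure A z <-> forall r, 0 < r -> exists2 w, A w & cabs (w - z) < r.
Proof.
split=> [clA r r0|H B /nbhsCP[r /H[w Aw wz] HB]].
  have [|w [Aw wz]] := clA [set w | cabs (w - z) < r].
    by apply/nbhsCP; exists r.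
  by exists w.
by exists w; split => //; exact: HB.
Qed.

Lemma closedCP E :
  (forall z, (forall r, 0 < r -> exists2 w, E w & cabs (w - z) < r) -> E z) ->
  closed E.
Proof. by move=> H z /closureCP; exact: H. Qed.

Lemma notin_closedC E z : closed E -> ~ E z ->
  exists2 r : R, 0 < r & forall w, cabs (w - z) < r -> ~ E w.
Proof. by move=> cE Ez; apply/nbhsCP; apply: open_nbhs_nbhs; split; [exact: closed_openC|]. Qed.

Lemma openCP A : open A <-> forall z, A z ->
  exists2 r : R, 0 < r & forall w, cabs (w - z) < r -> A w.
Proof.
rewrite openE; split=> H z Az; first exact/nbhsCP/H.
exact/nbhsCP/H.
Qed.

End PlaneTopology.

(** * Borel measures on the plane *)

Section PlaneMeasure.
Variable R : realType.
Implicit Types (z w : C R) (r e : R) (A E : set (C R)) (u : C R -> R).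
Implicit Types (mu : probability (R * R)%type R).

Lemma measurable_sqrt : measurable_fun setT (@Num.sqrt R).
Proof. apply: continuous_measurable_fun; exact: sqrt_continuous. Qed.

Lemma measurable_cabs_fun d (T : measurableType d) (f : T -> C R) :
  measurable_fun setT (fun x => Re (f x)) ->
  measurable_fun setT (fun x => Im (f x)) ->
  measurable_fun setT (fun x => cabs (f x)).
Proof.
move=> m1 m2; have -> : (fun x => cabs (f x)) =
    (@Num.sqrt R) \o (fun x => Re (f x) ^+ 2 + Im (f x) ^+ 2).
  by apply/funext => x; rewrite /cabs/=; case: (f x).
apply: measurableT_comp; first exact: measurable_sqrt.
by apply: measurable_funD; exact: measurable_funX.
Qed.

Lemma measurable_cabsB z :
  measurable_fun setT (fun p : R * R => cabs (p2c p - z)).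
Proof.
case: z => a b; apply: measurable_cabs_fun => /=.
  by apply: measurable_funB => //; exact: measurable_fst.
by apply: measurable_funB => //; exact: measurable_snd.
Qed.

(** A countable base of the plane, with rational centres and radii 1/(m+1). Countability is what
    makes open sets measurable for the product sigma-algebra and locally null open sets null. *)
Definition rball (n : nat) : set (C R) :=
  match unpickle n : option (rat * rat * nat) with
  | Some (a, b, m) =>
    [set z | cabs (z - Complex (ratr a) (ratr b)) < m.+1%:R^-1]
  | None => set0
  end.

Lemma rball_ex z r : 0 < r ->
  exists n, rball n z /\ forall w, rball n w -> cabs (w - z) < r.
Proof.
move=> r0; have [m] := @ltr_add_invr R 0 (r / 2) (divr_gt0 r0 (ltr0Sn _ 1)).
rewrite add0r => mr; set d := m.+1%:R^-1 in mr.
have d0 : 0 < d by rewrite invr_gt0.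
case: z => x y.
have [a /itvP ax] := @rat_in_itvoo R (x - d / 2) x ltac:(lra).
have [b /itvP by_] := @rat_in_itvoo R (y - d / 2) y ltac:(lra).
have zc : cabs ((Complex x y : C R) - Complex (ratr a) (ratr b)) < d.
  apply: le_lt_trans (cabs_le_ReIm _ _) _.
  rewrite (splitr d) ltrD// ger0_norm ?subr_ge0 ?ax ?by_// ltrBlDr addrC -ltrBlDr.
    by rewrite ax.
  by rewrite by_.
exists (pickle (a, b, m)); rewrite /rball pickleK/=; split => // w wc.
rewrite (le_lt_trans (cabs_tri _ _ (Complex (ratr a) (ratr b))))//.
rewrite (splitr r) ltrD// ?(lt_trans wc)//.
by rewrite cabsBC (lt_trans zc).
Qed.

Lemma measurable_rball n : measurable (@p2c R @^-1` rball n).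
Proof.
rewrite /rball; case: unpickle => [[[a b] m]|]; last exact: measurable0.
have := measurable_cabsB (Complex (ratr a) (ratr b)).
move=> /(_ measurableT _ (measurable_itv (`]-oo, m.+1%:R^-1[%R : interval R))).
rewrite setTI; congr measurable; apply/seteqP; split=> p /=; rewrite in_itv//.
Qed.

Lemma open_rballE A : open A ->
  A = \bigcup_(n in [set n | rball n `<=` A]) rball n.
Proof.
move=> /openCP oA; apply/seteqP; split=> [z /[dup] Az /oA[r r0 rA]|z [n nA nz]].
  by have [n [nz nr]] := rball_ex z r0; exists n => // w /nr /rA.
exact: nA.
Qed.

Lemma measurable_open A : open A -> measurable (@p2c R @^-1` A).
Proof.
move=> /open_rballE ->; rewrite preimage_bigcup.
by apply: bigcup_measurable => n _; exact: measurable_rball.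
Qed.

Lemma measurable_continuous u : continuous u ->
  measurable_fun setT (fun p => u (p2c p)).
Proof.
move=> /continuousP cu.
apply: (measurability _ (RGenOpens.measurableE R)).
move=> _ [_ [a [b ->]] <-]; rewrite setTI.
have := @measurable_open (u @^-1` `]a, b[) (cu _ (interval_open _ _)).
by apply.
Qed.

(** Lindelof's argument: the set is covered by those countably many basic discs that are null. It
    shows that the complement of the support is null. *)
Lemma open_null mu A : open A ->
  (forall z, A z -> exists2 r : R, 0 < r &
     mu (@p2c R @^-1` [set w | cabs (w - z) < r]) = 0%E) ->
  mu (@p2c R @^-1` A) = 0%E.
Proof.
move=> oA H.
apply/measure_negligible; first exact: measurable_open.
have -> : A = \bigcup_(n in [set n | mu (@p2c R @^-1` (rball n)) = 0%E]) (A `&` rball n).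
  apply/seteqP; split=> [z Az|z [n _ [//]]].
  have [r r0 r1] := H _ Az; have [n [nz nr]] := rball_ex z r0; exists n => //=.
  apply/eqP; rewrite eq_le measure_ge0 andbT -r1 le_measure// ?inE.
    exact: measurable_rball.
  apply: measurable_open; apply/openCP => w wz.
  exists (r - cabs (w - z)); first by rewrite subr_gt0.
  by move=> v; rewrite ltrBrDr => vw; exact: le_lt_trans (cabs_tri _ _ w) vw.
  by move=> p; exact: nr.
rewrite preimage_bigcup bigcup_mkcond; apply: negligible_bigcup => n.
case: ifPn => [/[!inE] n0|_]; last exact: negligible_set0.
apply: (@negligibleS _ _ _ _ (@p2c R @^-1` (rball n))); first by move=> p [].
by apply/negligibleP => //; exact: measurable_rball.
Qed.

(** Boundedness is asked on [E] only: for a measure carried by [E] this already gives integrability,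
    and hence linearity of [pint]. *)
Definition tame E (f : C R -> R) :=
  measurable_fun setT (fun p => f (p2c p)) /\
  exists M, forall z, E z -> `|f z| <= M.

Definition pint mu (f : C R -> R) : R := \int[mu]_p f (p2c p).

Definition carried mu E := closed E /\ mu (@p2c R @^-1` (~` E)) = 0%E.

Lemma tame_cst E c : tame E (fun=> c).
Proof. by split; [exact: measurable_cst|exists `|c|]. Qed.

Lemma tameD E f g : tame E f -> tame E g -> tame E (fun z => f z + g z).
Proof.
move=> [mf [M fM]] [mg [N gN]]; split; first exact: measurable_funD.
by exists (M + N) => z Ez; rewrite (le_trans (ler_normD _ _))// lerD ?fM ?gN.
Qed.

Lemma tameM E f g : tame E f -> tame E g -> tame E (fun z => f z * g z).
Proof.
move=> [mf [M fM]] [mg [N gN]]; split; first exact: measurable_funM.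
by exists (M * N) => z Ez; rewrite normrM ler_pM ?fM ?gN.
Qed.

Lemma tameN E f : tame E f -> tame E (fun z => - f z).
Proof.
move=> fE; have := tameM (tame_cst E (-1)) fE.
by congr tame; apply/funext => z; rewrite mulN1r.
Qed.

Lemma tameB E f g : tame E f -> tame E g -> tame E (fun z => f z - g z).
Proof. by move=> fE /tameN; exact: tameD. Qed.

Lemma tame_sum E (I : Type) (s : seq I) (f : I -> C R -> R) :
  (forall i, tame E (f i)) -> tame E (fun z => \sum_(i <- s) f i z).
Proof.
move=> tf; elim: s => [|i s IH].
  by under eq_fun do rewrite big_nil; exact: tame_cst.
by under eq_fun do rewrite big_cons; exact: tameD.
Qed.

Lemma tame_continuous E f : compact E -> continuous f -> tame E f.
Proof.
move=> cE cf; split; first exact: measurable_continuous.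
exact: compact_image_bounded.
Qed.

Lemma tame_indic E (B : set (C R)) :
  measurable (@p2c R @^-1` B) -> tame E (fun z => \1_B z).
Proof.
move=> mB; split; last first.
  by exists 1 => z _; rewrite indicE ger0_norm// lern1; case: (_ \in _).
have -> : (fun p : R * R => \1_B (p2c p) : R) = \1_(@p2c R @^-1` B).
  apply/funext => p; rewrite !indicE.
  have -> // : (p2c p \in B) = (p \in @p2c R @^-1` B).
  by apply/idP/idP => /[!inE].
exact: measurable_indic.
Qed.

Section Integral.
Variables (mu : probability (R * R)%type R) (E : set (C R)).
Hypothesis muE : carried mu E.

Lemma carried_ae (P : R * R -> Prop) :
  (forall p, E (p2c p) -> P p) -> {ae mu, forall p, P p}.
Proof.
move=> H; exists (@p2c R @^-1` (~` E)); split.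
- by apply: measurable_open; apply: closed_openC; exact: muE.1.
- exact: muE.2.
- by move=> p /= nP Ep; apply: nP; exact: H.
Qed.

Lemma tame_integrable f : tame E f -> mu.-integrable setT (EFin \o (f \o @p2c R)).
Proof.
move=> [mf [M fM]]; apply/integrableP; split; first exact/measurable_EFinP.
(* Off [E] the function may be unbounded; truncating it at the bound changes it on a null set
   only. *)
rewrite (@ae_eq_integral _ _ _ mu setT (fun p => (Num.min `|f (p2c p)| `|M|)%:E))//.
- apply: (@le_lt_trans _ _ (\int[mu]_p (cst `|M|%:E p))%E).
    apply: ge0_le_integral => //.
    + apply/measurable_EFinP; apply: measurable_minr => //; exact: measurableT_comp.
    + by move=> p _; rewrite lee_fin ge_min lexx orbT.
  rewrite integral_cst// [X in (_ * X)%E](_ : _ = 1%E) ?mule1 ?ltry//.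
  exact: probability_setT.
- by apply: measurableT_comp => //; exact/measurable_EFinP.
- by apply/measurable_EFinP; apply: measurable_minr => //; exact: measurableT_comp.
- apply: carried_ae => p Ep _ /=; congr EFin; rewrite min_l//.
  by rewrite (le_trans (fM _ Ep))// ler_norm.
Qed.

Lemma EFin_pint f : tame E f -> (\int[mu]_p (f (p2c p))%:E = (pint mu f)%:E)%E.
Proof.
by move=> tf; rewrite /pint /Rintegral fineK//; apply: integrable_fin_num => //; exact: tame_integrable.
Qed.

Lemma pintD f g : tame E f -> tame E g ->
  pint mu (fun z => f z + g z) = pint mu f + pint mu g.
Proof. by move=> *; rewrite [LHS]RintegralD//; exact: tame_integrable. Qed.

Lemma pintB f g : tame E f -> tame E g ->
  pint mu (fun z => f z - g z) = pint mu f - pint mu g.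
Proof. by move=> *; rewrite [LHS]RintegralB//; exact: tame_integrable. Qed.

Lemma pintZ c f : tame E f -> pint mu (fun z => c * f z) = c * pint mu f.
Proof. by move=> *; rewrite [LHS]RintegralZl//; exact: tame_integrable. Qed.

Lemma pint_cst c : pint mu (fun=> c) = c.
Proof.
by rewrite [LHS]Rintegral_cst//= [mu _]probability_setT mulr1.
Qed.

Lemma pint_sum (I : Type) (s : seq I) (f : I -> C R -> R) :
  (forall i, tame E (f i)) ->
  pint mu (fun z => \sum_(i <- s) f i z) = \sum_(i <- s) pint mu (f i).
Proof.
move=> tf; elim: s => [|i s IH].
  by under eq_fun do rewrite big_nil; rewrite big_nil pint_cst.
under eq_fun do rewrite big_cons.
by rewrite big_cons pintD ?IH//; exact: tame_sum.
Qed.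

Lemma eq_pint f g : tame E f -> tame E g -> (forall z, E z -> f z = g z) ->
  pint mu f = pint mu g.
Proof.
move=> [mf _] [mg _] fg; congr fine; apply: ae_eq_integral => //.
- exact/measurable_EFinP.
- exact/measurable_EFinP.
- by apply: carried_ae => p Ep _; rewrite fg.
Qed.

Lemma le_pint f g : tame E f -> tame E g -> (forall z, E z -> f z <= g z) ->
  pint mu f <= pint mu g.
Proof.
move=> tf tg fg; rewrite -subr_ge0 -pintB//.
rewrite (@eq_pint _ (fun z => `|g z - f z|)).
- by apply: Rintegral_ge0.
- exact: tameB.
- have [m [M H]] := tameB tg tf; split; last first.
    by exists M => z Ez; rewrite normr_id; exact: H.
  exact: measurableT_comp.
- by move=> z Ez; rewrite ger0_norm// subr_ge0 fg.
Qed.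

Lemma norm_pint f c : tame E f -> (forall z, E z -> `|f z| <= c) ->
  `|pint mu f| <= c.
Proof.
move=> tf fc; rewrite ler_norml; apply/andP; split.
  rewrite -[leLHS]pint_cst; apply: le_pint => //; first exact: tame_cst.
  by move=> z Ez; have := fc _ Ez; rewrite ler_norml => /andP[].
rewrite -[leRHS]pint_cst; apply: le_pint => //; first exact: tame_cst.
by move=> z Ez; have := fc _ Ez; rewrite ler_norml => /andP[].
Qed.

Lemma carried_neq0 : E !=set0.
Proof.
apply/set0P/eqP => E0; have := muE.2.
by rewrite E0 setC0 preimage_setT probability_setT => -[] /eqP; rewrite oner_eq0.
Qed.

Lemma pint_indic (B : set (C R)) : measurable (@p2c R @^-1` B) ->
  pint mu (fun z => \1_B z) = fine (mu (@p2c R @^-1` B)).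
Proof.
move=> mB; rewrite /pint /Rintegral -[in RHS](setIT (@p2c R @^-1` B)).
by rewrite -integral_indic.
Qed.

End Integral.

End PlaneMeasure.

(** * Circle means of logarithms *)

Section Logarithm.
Variable R : realType.
Implicit Types (x y d : R).

Lemma ler_ln_pos x y : 0 < x -> x <= y -> ln x <= ln y.
Proof. by move=> x0 xy; rewrite ler_ln// posrE// (lt_le_trans x0). Qed.

Lemma ltr_ln_pos x y : 0 < x -> x < y -> ln x < ln y.
Proof. by move=> x0 xy; rewrite ltr_ln// posrE// (lt_trans x0). Qed.

Lemma lnM_pos x y : 0 < x -> 0 < y -> ln (x * y) = ln x + ln y.
Proof. by move=> *; rewrite lnM. Qed.

Lemma lnV_pos x : 0 < x -> ln x^-1 = - ln x.
Proof. by move=> *; rewrite lnV. Qed.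

Lemma ln_div_pos x y : 0 < x -> 0 < y -> ln (x / y) = ln x - ln y.
Proof. by move=> *; rewrite ln_div. Qed.

Lemma ln_leB1 x : 0 < x -> ln x <= x - 1.
Proof. by move=> x0; have := @le_ln1Dx R (x - 1) ltac:(lra); rewrite subrKC. Qed.

Lemma ln_inj_pos x y : 0 < x -> 0 < y -> ln x = ln y -> x = y.
Proof. by move=> x0 y0 xy; rewrite -[x]lnK ?posrE// xy lnK. Qed.

Lemma ln_prod (I : Type) (s : seq I) (f : I -> R) : (forall i, 0 < f i) ->
  ln (\prod_(i <- s) f i) = \sum_(i <- s) ln (f i).
Proof.
move=> f0; elim: s => [|i s IH]; first by rewrite !big_nil ln1.
by rewrite !big_cons lnM_pos ?IH// prodr_gt0.
Qed.

(* Logarithms truncated at distance [d] keep all potentials and energies finite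
   and Lipschitz; the singular kernel is only reached in the limit d -> 0. *)
Definition lnt d x := ln (Num.max x d).

Lemma lnt_max_gt0 d x : 0 < d -> 0 < Num.max x d.
Proof. by move=> d0; rewrite lt_max d0 orbT. Qed.

Lemma lntE d x : d <= x -> lnt d x = ln x.
Proof. by move=> dx; rewrite /lnt max_l. Qed.

Lemma le_lnt d x y : 0 < d -> x <= y -> lnt d x <= lnt d y.
Proof.
move=> d0 xy; apply: ler_ln_pos; first exact: lnt_max_gt0.
by rewrite ge_max !le_max xy lexx orbT.
Qed.

Lemma le_lntd d d' x : 0 < d -> d <= d' -> lnt d x <= lnt d' x.
Proof.
move=> d0 dd; apply: ler_ln_pos; first exact: lnt_max_gt0.
by rewrite ge_max !le_max lexx dd orbT.
Qed.

Lemma lnt_lipschitz d x y : 0 < d -> `|lnt d x - lnt d y| <= d^-1 * `|x - y|.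
Proof.
move=> d0; wlog yx : x y / y <= x.
  move=> H; have [/H//|/ltW/H] := leP y x.
  by rewrite distrC [X in _ <= _ * X]distrC.
rewrite [`|x - y|]ger0_norm ?subr_ge0// ger0_norm ?subr_ge0 ?le_lnt//.
have x0 := lnt_max_gt0 x d0; have y0 := lnt_max_gt0 y d0.
rewrite /lnt -ln_div_pos// (le_trans (ln_leB1 _)) ?divr_gt0//.
rewrite -[X in _ - X](divff (lt0r_neq0 y0)) -mulrBl mulrC.
have H : Num.max x d - Num.max y d <= x - y.
  have [yd|dy] := leP y d; last by rewrite max_l// ?lerB// ltW// (lt_le_trans dy).
  by have [xd|dx] := leP x d; lra.
apply: (@le_trans _ _ ((Num.max y d)^-1 * (x - y))).
  by rewrite ler_wpM2l// invr_ge0 ltW.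
by rewrite ler_wpM2r ?subr_ge0// lef_pV2// le_max lexx orbT.
Qed.

Lemma normr_ln_half x : 2^-1 <= x -> x <= 2 -> `|ln x| <= ln 2.
Proof.
move=> x1 x2; have x0 : 0 < x by rewrite (lt_le_trans _ x1).
rewrite ler_norml ler_ln_pos// andbT -lnV_pos// ler_ln_pos//.
Qed.

Lemma sin_lipschitz x y : `|sin x - sin y| <= `|x - y| :> R.
Proof.
wlog xy : x y / x <= y.
  move=> H; have [/H//|/ltW/H] := leP x y.
  by rewrite distrC [X in _ <= X]distrC.
have [z _] := @MVT_segment R sin cos x y xy (fun z _ => is_derive_sin z)
  (continuous_subspaceT (@continuous_sin R)).
by move=> E; rewrite distrC E normrM [in leRHS]distrC ler_piMl// ler_norml cos_geN1 cos_le1.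
Qed.

Lemma cos_lipschitz x y : `|cos x - cos y| <= `|x - y| :> R.
Proof.
wlog xy : x y / x <= y.
  move=> H; have [/H//|/ltW/H] := leP x y.
  by rewrite distrC [X in _ <= X]distrC.
have [z _] := @MVT_segment R cos (fun z => - sin z) x y xy (fun z _ => is_derive_cos z)
  (continuous_subspaceT (@continuous_cos R)).
move=> E; rewrite distrC E normrM [in leRHS]distrC ler_piMl//.
by rewrite normrN ler_norml sin_geN1 sin_le1.
Qed.

End Logarithm.

Section Circle.
Variable R : realType.
Implicit Types (z w a : C R) (r t L : R) (u v : C R -> R).
Local Notation leb := (@lebesgue_measure R).

Definition cpt z r t : C R := z + Complex r 0 * expi t.

Definition circ u z r : R := \int[leb]_(t in `[0, 2 * pi]) u (cpt z r t).

Lemma cabs_cpt z r t : 0 <= r -> cabs (cpt z r t - z) = r.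
Proof.
by move=> r0; rewrite /cpt addrAC subrr add0r cabsM cabs_expi mulr1 cabs_real ger0_norm.
Qed.

Lemma expiD s t : expi (s + t) = expi s * expi t :> C R.
Proof. by rewrite /expi cosD sinD; congr Complex; rewrite addrC. Qed.

Lemma expi0 : expi 0 = 1 :> C R.
Proof. by rewrite /expi cos0 sin0. Qed.

Lemma expiDpi t : expi (pi + t) = - expi t :> C R.
Proof. by rewrite addrC /expi cosDpi sinDpi. Qed.

Lemma cpt_lipschitz z r s t : 0 <= r ->
  cabs (cpt z r s - cpt z r t) <= r * 2 * `|s - t|.
Proof.
move=> r0; rewrite /cpt opprD addrACA subrr add0r -mulrBr cabsM cabs_real.
rewrite ger0_norm// -mulrA ler_wpM2l//.
have -> : (expi s - expi t : C R) = Complex (cos s - cos t) (sin s - sin t) by [].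
rewrite (le_trans (cabs_le_ReIm _ _))// mulr_natl mulr2n lerD//.
  exact: cos_lipschitz.
exact: sin_lipschitz.
Qed.

Lemma continuous_cpt z r : 0 <= r -> continuous (cpt z r).
Proof.
move=> r0 t A /nbhsCP[e e0 H]; apply/nbhs_ballP.
have r1 : 0 < r * 2 + 1 by rewrite ltr_wpDl// mulr_ge0.
exists (e / (r * 2 + 1)) => /=; first by rewrite divr_gt0.
move=> s; rewrite /ball/= distrC ltr_pdivlMr// => st; apply: H.
apply: le_lt_trans st; rewrite (le_trans (cpt_lipschitz _ _ _ _))// mulrC.
by rewrite ler_wpM2l// lerDl.
Qed.

Lemma continuous_integrable_itv (f : R -> R) (a b : R) : continuous f ->
  leb.-integrable `[a, b] (EFin \o f).
Proof.
move=> cf; apply: continuous_compact_integrable; first exact: segment_compact.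
exact: continuous_subspaceT.
Qed.

Lemma Rintegral_itv_cst (a b c : R) : a <= b ->
  \int[leb]_(t in `[a, b]) c = c * (b - a).
Proof.
move=> ab; rewrite Rintegral_cst//= lebesgue_measure_itv/= lte_fin.
case: ltP => [_|ba]; first by [].
have -> : a = b by apply/eqP; rewrite eq_le ab ba.
by rewrite subrr.
Qed.

Lemma Rintegral_split (f : R -> R) (a b c : R) : continuous f -> a <= b -> b <= c ->
  \int[leb]_(t in `[a, c]) f t =
  \int[leb]_(t in `[a, b]) f t + \int[leb]_(t in `[b, c]) f t.
Proof.
move=> cf ab bc.
have := @Rintegral_itvB R f (BLeft a) (BRight c) b (continuous_integrable_itv a c cf).
move=> /(_ ab bc) E.
rewrite -(@Rintegral_itv_obnd_cbnd _ b (BRight c)) -?E ?subrKC//.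
apply: integrableS (continuous_integrable_itv b c cf) => //.
exact: subset_itv_oc_cc.
Qed.

Lemma lipschitz_continuousR (f : R -> R) L :
  (forall s t, `|f s - f t| <= L * `|s - t|) -> continuous f.
Proof.
move=> fL t B /nbhs_ballP[e /= e0 H]; apply/nbhs_ballP.
have L1 : 0 < `|L| + 1 by rewrite ltr_wpDl.
exists (e / (`|L| + 1)) => /=; first by rewrite divr_gt0.
move=> s; rewrite /ball/= ltr_pdivlMr// => ts; apply: H; rewrite /ball/=.
apply: le_lt_trans ts; rewrite (le_trans (fL _ _))// mulrC ler_wpM2l//.
by rewrite (le_trans (ler_norm _))// lerDl.
Qed.

(** Left endpoints are sampled, so 2^j nodes on [0, 2 pi] give exactly the 2^j-th roots of unity. *)
Lemma riemann_sum (f : R -> R) L (N : nat) (T : R) : 0 <= T ->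
  (forall s t, `|f s - f t| <= L * `|s - t|) ->
  `|\int[leb]_(t in `[0, T]) f t
    - T / N.+1%:R * \sum_(k < N.+1) f (T * k%:R / N.+1%:R)| <= L * T ^+ 2 / N.+1%:R.
Proof.
move=> T0 fL; set h := T / N.+1%:R.
have h0 : 0 <= h by rewrite divr_ge0.
have L0 : 0 <= L by have := fL 0 1; rewrite sub0r normrN normr1 mulr1; exact: le_trans.
have cf := lipschitz_continuousR fL.
have step (a : R) : `|\int[leb]_(t in `[a, a + h]) f t - h * f a| <= L * h ^+ 2.
  have -> : h * f a = \int[leb]_(t in `[a, a + h]) (f a).
    by rewrite Rintegral_itv_cst ?lerDl// addrAC subrr add0r mulrC.
  rewrite -RintegralB//; last 2 first.
  - exact: continuous_integrable_itv.
  - by apply: continuous_integrable_itv => x; exact: cst_continuous.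
  have cfB : continuous (fun t => f t - f a).
    by move=> t; apply: continuousB; [exact: cf|exact: cst_continuous].
  apply: le_trans (le_normr_Rintegral _ _) _ => //.
    exact: continuous_integrable_itv.
  rewrite expr2 mulrA [X in _ <= X](_ : _ = L * h * (a + h - a)); last by ring.
  rewrite -Rintegral_itv_cst ?lerDl//; apply: le_Rintegral => //.
  - apply/continuous_integrable_itv/(@lipschitz_continuousR _ L) => s t.
    by rewrite (le_trans (ler_dist_dist _ _))// opprB addrA subrK.
  - by apply: continuous_integrable_itv => x; exact: cst_continuous.
  - move=> t /=; rewrite in_itv/= => /andP[at_ ta].
    rewrite (le_trans (fL _ _))// ler_wpM2l// ger0_norm ?subr_ge0//.
    by rewrite lerBlDr addrC.
have ind (n : nat) : `|\int[leb]_(t in `[0, h * n%:R]) f t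
    - h * \sum_(k < n) f (h * k%:R)| <= L * h ^+ 2 * n%:R.
  elim: n => [|n IH].
    by rewrite big_ord0 !mulr0 subr0 set_itv1 Rintegral_set1 normr0.
  rewrite big_ord_recr/= mulrDr.
  have E : h * n.+1%:R = h * n%:R + h by rewrite -natr1 mulrDr mulr1.
  rewrite E (@Rintegral_split _ _ (h * n%:R))// ?lerDl ?mulr_ge0//.
  rewrite opprD addrACA (le_trans (ler_normD _ _))// -natr1 mulrDr mulr1.
  by rewrite lerD.
have := ind N.+1; rewrite {1 3}/h divfK ?pnatr_eq0//.
have -> : L * (T / N.+1%:R) ^+ 2 * N.+1%:R = L * T ^+ 2 / N.+1%:R.
  have N0 : N.+1%:R != 0 :> R by rewrite pnatr_eq0.
  by apply: (mulIf N0); rewrite divfK// -(mulrA _ N.+1%:R) -expr2 -mulrA -exprMn divfK.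
by under eq_bigr do rewrite /h mulrAC.
Qed.

Definition root_sum (f : C R -> R) (N : nat) :=
  \sum_(k < N) f (expi (2 * pi * k%:R / N%:R)).

Lemma cabs_1DM a e : cabs a <= 2^-1 -> cabs e = 1 ->
  2^-1 <= cabs (1 + a * e) <= 2.
Proof.
move=> a1 e1; have H : cabs (a * e) <= 2^-1 by rewrite cabsM e1 mulr1.
apply/andP; split.
  by have := cabsB_ge 1 (- (a * e)); rewrite opprK cabsN cabs1; lra.
by have := cabsD 1 (a * e); rewrite cabs1; lra.
Qed.

(* Pairing the opposite points e and -e: |1+ae||1-ae| = |1-a^2 e^2|, so passing
   from 2N to N squares a without changing the size of the sum. *)
Lemma root_sum_ln j a : cabs a <= 2^-1 ->
  `|root_sum (fun e => ln (cabs (1 + a * e))) (2 ^ j)| <= ln 2.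
Proof.
have P := cabs_1DM.
elim: j a => [|j IH] a a1.
  rewrite expn0 /root_sum big_ord1 mulr0 mul0r expi0 mulr1.
  have := P a 1 a1 (cabs1 R); rewrite mulr1 => /andP[h1 h2]; exact: normr_ln_half.
rewrite /root_sum expnS mul2n -addnn big_split_ord/= -big_split/=.
rewrite (eq_bigr (fun k : 'I_(2 ^ j) => ln (cabs (1 + (- a ^+ 2) *
    expi (2 * pi * k%:R / (2 ^ j)%:R))))); last first.
  move=> k _.
  have n0 : (2 ^ j)%:R != 0 :> R by rewrite pnatr_eq0 -lt0n expn_gt0.
  have n2 : (2 ^ j + 2 ^ j)%:R != 0 :> R.
    by rewrite natrD -mulr2n mulrn_eq0.
  set t := 2 * pi * k%:R / (2 ^ j + 2 ^ j)%:R.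
  have -> : 2 * pi * (2 ^ j + k)%:R / (2 ^ j + 2 ^ j)%:R = pi + t :> R.
    rewrite natrD mulrDr mulrDl; congr (_ + _); apply: (mulIf n2).
    by rewrite divfK// natrD; generalize (pi : R) => x; ring.
  have -> : 2 * pi * k%:R / (2 ^ j)%:R = t + t :> R.
    rewrite /t; generalize (2 * pi * k%:R : R) => x; apply: (mulIf n2).
    by rewrite mulrDl !divfK// natrD mulrDr !divfK.
  rewrite expiDpi expiD mulrN -lnM_pos; last 2 first.
  - by have /andP[h _] := P a (expi t) a1 (cabs_expi t); exact: lt_le_trans h.
  - have := P (- a) (expi t); rewrite cabsN mulNr => /(_ a1 (cabs_expi t)) /andP[h _].
    exact: lt_le_trans h.
  by rewrite -cabsM; congr (ln (cabs _)); ring.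
apply: IH; rewrite cabsN cabsX expr2.
by have := cabs_ge0 a; nra.
Qed.

Definition circ_sum (f : C R -> R) z r N :=
  \sum_(k < N) f (cpt z r (2 * pi * k%:R / N%:R)).

(** Factoring out z - w leaves 1 + a e with |a| <= 1/2 and e a root of unity. The bound does not
    depend on j, so it disappears after division by 2^j. *)
Lemma circ_sum_ln_near j z w r : 0 <= r -> z != w -> 2 * r <= cabs (z - w) ->
  `|circ_sum (fun x => ln (cabs (x - w))) z r (2 ^ j)
    - (2 ^ j)%:R * ln (cabs (z - w))| <= ln 2.
Proof.
move=> r0 zw rzw; have zw0 : z - w != 0 by rewrite subr_eq0.
have H : cabs (Complex r 0 / (z - w)) <= 2^-1.
  rewrite cabsM cabsV cabs_real ger0_norm// ler_pdivrMr ?cabs_gt0//; lra.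
have := root_sum_ln j H; congr (`|_| <= _).
have -> : (2 ^ j)%:R * ln (cabs (z - w)) = \sum_(k < 2 ^ j) ln (cabs (z - w)).
  by rewrite sumr_const card_ord mulr_natl.
rewrite /root_sum /circ_sum -sumrB; apply: eq_bigr => k _; set e := expi _.
have -> : cpt z r (2 * pi * k%:R / (2 ^ j)%:R) - w =
    (z - w) * (1 + Complex r 0 / (z - w) * e).
  by rewrite /cpt -/e; field.
have /andP[h _] := cabs_1DM H (cabs_expi (2 * pi * k%:R / (2 ^ j)%:R)).
rewrite cabsM (@lnM_pos _ (cabs (z - w))); last 2 first.
- exact: cabs_gt0.
- exact: lt_le_trans h.
by rewrite addrAC subrr add0r.
Qed.

Lemma circ_sum_ln_far j z w r : 0 < r -> 2 * cabs (z - w) <= r ->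
  `|circ_sum (fun x => ln (cabs (x - w))) z r (2 ^ j) - (2 ^ j)%:R * ln r| <= ln 2.
Proof.
move=> r0; case Ezw: (z - w) => [x y] rzw.
have rr0 : (Complex r 0 : C R) != 0.
  by apply: contra_neq (lt0r_neq0 r0) => -[].
(* Now r is factored out. For |e| = 1 one has |r e + (z - w)| = |r + conj(z - w) e|, whence the
   conjugate. *)
have H : cabs ((Complex x (- y) : C R) / Complex r 0) <= 2^-1.
  rewrite cabsM cabsV cabs_real gtr0_norm// ler_pdivrMr//.
  have -> : cabs (Complex x (- y) : C R) = cabs (Complex x y : C R).
    by rewrite /cabs/= sqrrN.
  lra.
have := root_sum_ln j H; congr (`|_| <= _).
have -> : (2 ^ j)%:R * ln r = \sum_(k < 2 ^ j) ln r.
  by rewrite sumr_const card_ord mulr_natl.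
rewrite /root_sum /circ_sum -sumrB; apply: eq_bigr => k _.
have /andP[h _] := cabs_1DM H (cabs_expi (2 * pi * k%:R / (2 ^ j)%:R)).
move: h; set t := 2 * pi * k%:R / (2 ^ j)%:R => h.
have -> : cabs (cpt z r t - w) =
    cabs (Complex r 0 * (1 + Complex x (- y) / Complex r 0 * expi t)).
  rewrite mulrDr mulr1 mulrA [_ * (_ / _)]mulrC divfK//.
  rewrite /cpt addrAC Ezw /cabs/=; congr Num.sqrt.
  have := cos2Dsin2 t; move: (cos t) (sin t) => c s cs.
  by rewrite !mul0r !subr0 !addr0; nra.
rewrite cabsM lnM_pos ?cabs_real ?gtr0_norm//; last exact: lt_le_trans h.
by rewrite addrAC subrr add0r.
Qed.

End Circle.

(** * Harmonic functions and the maximum principle *)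

Section MeanValue.
Variable R : realType.
Implicit Types (z w : C R) (r rho t L c M : R) (u v : C R -> R) (A : set (C R)).
Local Notation leb := (@lebesgue_measure R).

Lemma small_eq0 (x D : R) : (forall j : nat, `|x| <= D / (2 ^ j)%:R) -> x = 0.
Proof.
move=> H; apply/eqP; rewrite -normr_le0 leNgt; apply/negP => x0.
have := archi_boundP (divr_ge0 (normr_ge0 D) (ltW x0)).
set n := Num.bound _ => nD; have := H n; apply/negP; rewrite -ltNge.
rewrite ltr_pdivrMr ?ltr0n ?expn_gt0//.
rewrite ltr_pdivrMr// mulrC in nD.
rewrite (le_lt_trans (ler_norm D))// (lt_le_trans nD)//.
by rewrite ler_wpM2l ?(ltW x0)// ler_nat ltnW// ltn_expl.
Qed.

(** A bound [B] on the sums that is uniform in j becomes B / 2^j for the averages; the Lipschitz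
    constant controls the Riemann sum error at the same rate. *)
Lemma circ_limit u z r L c B :
  (forall s t, `|u (cpt z r s) - u (cpt z r t)| <= L * `|s - t|) ->
  (forall j, `|circ_sum u z r (2 ^ j) - (2 ^ j)%:R * c| <= B) ->
  circ u z r = 2 * pi * c.
Proof.
move=> uL uB; apply/eqP; rewrite -subr_eq0; apply/eqP.
apply: (@small_eq0 _ (L * (2 * pi) ^+ 2 + 2 * pi * B)) => j.
have N0 : (2 ^ j)%:R != 0 :> R by rewrite pnatr_eq0 -lt0n expn_gt0.
have := @riemann_sum R (fun t => u (cpt z r t)) L (2 ^ j).-1 (2 * pi).
rewrite prednK ?expn_gt0// => /(_ _ uL).
have p0 : 0 <= 2 * pi :> R by rewrite mulr_ge0// pi_ge0.
move=> /(_ p0) H; rewrite (mulrDl (L * _)).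
rewrite (le_trans (ler_distD (2 * pi / (2 ^ j)%:R * circ_sum u z r (2 ^ j)) _ _))//.
rewrite lerD//.
have -> : 2 * pi * c = 2 * pi / (2 ^ j)%:R * ((2 ^ j)%:R * c) by rewrite mulrA divfK.
rewrite -mulrBr normrM ger0_norm ?divr_ge0// mulrAC ler_wpM2r ?invr_ge0//.
by rewrite ler_wpM2l.
Qed.

(** The mean inequality is required at z alone, continuity on a whole disc so that the integrals
    over circles about z make sense. *)
Definition shm u z := exists2 rho, 0 < rho &
  (forall w, cabs (w - z) < rho -> {for w, continuous u}) /\
  (forall r, 0 < r -> r < rho -> 2 * pi * u z <= circ u z r).

Definition hm u z := exists2 rho, 0 < rho &
  (forall w, cabs (w - z) < rho -> {for w, continuous u}) /\
  (forall r, 0 < r -> r < rho -> circ u z r = 2 * pi * u z).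

Lemma hm_shm u z : hm u z -> shm u z.
Proof. by move=> [rho rho0 [cu Hu]]; exists rho => //; split => // r r0 /Hu ->. Qed.

Lemma shm_cont u z : shm u z -> {for z, continuous u}.
Proof. by move=> [rho rho0 [cu _]]; apply: cu; rewrite subrr cabs0. Qed.

Lemma hm_cont u z : hm u z -> {for z, continuous u}.
Proof. by move/hm_shm/shm_cont. Qed.

Lemma eq_circ u v z r : 0 <= r -> (forall w, cabs (w - z) = r -> u w = v w) ->
  circ u z r = circ v z r.
Proof. by move=> r0 uv; apply: eq_Rintegral => t _; rewrite uv ?cabs_cpt. Qed.

Lemma for_continuous_local u v z rho : 0 < rho ->
  (forall w, cabs (w - z) < rho -> u w = v w) ->
  {for z, continuous u} -> {for z, continuous v}.
Proof.
move=> rho0 uv /continuousCP cu; apply/continuousCP => e /cu[d d0 H].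
exists (Num.min d rho); first by rewrite lt_min d0.
by move=> w; rewrite lt_min => /andP[/H + wz]; rewrite !uv// subrr cabs0.
Qed.

Lemma ball_shift (z w v : C R) rho : cabs (v - w) < rho - cabs (w - z) -> cabs (v - z) < rho.
Proof. by move=> H; apply: le_lt_trans (cabs_tri _ _ w) _; rewrite -ltrBrDr. Qed.

Lemma shm_local u v z rho : 0 < rho ->
  (forall w, cabs (w - z) < rho -> u w = v w) -> shm u z -> shm v z.
Proof.
move=> rho0 uv [r1 r10 [cu Hu]]; exists (Num.min r1 rho); first by rewrite lt_min r10.
split=> [w|r r0]; rewrite lt_min => /andP[wz wz2].
  apply: (@for_continuous_local u _ _ (rho - cabs (w - z))); rewrite ?subr_gt0//.
    by move=> x /ball_shift; exact: uv.
  exact: cu.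
rewrite -(@eq_circ u) ?(ltW r0)//; last by move=> w wr; rewrite uv// wr.
by rewrite -uv ?subrr ?cabs0//; exact: Hu.
Qed.

Lemma circ_cst c z r : circ (fun=> c) z r = 2 * pi * c.
Proof. by rewrite /circ Rintegral_itv_cst ?mulr_ge0 ?pi_ge0// subr0 mulrC. Qed.

Definition circle_cont u z r := forall w, cabs (w - z) = r -> {for w, continuous u}.

Lemma circle_continuous u z r : 0 <= r -> circle_cont u z r ->
  continuous (fun t => u (cpt z r t)).
Proof.
move=> r0 cu t; apply: continuous_comp; first exact: continuous_cpt.
by apply: cu; rewrite cabs_cpt.
Qed.

Lemma circle_integrable u z r : 0 <= r -> circle_cont u z r ->
  leb.-integrable `[0, 2 * pi] (EFin \o (fun t => u (cpt z r t))).
Proof. by move=> r0 cu; apply: continuous_integrable_itv; exact: circle_continuous. Qed.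

Lemma circle_contD u v z r : circle_cont u z r -> circle_cont v z r ->
  circle_cont (fun w => u w + v w) z r.
Proof. by move=> cu cv w wr; apply: continuousD; [exact: cu|exact: cv]. Qed.

Lemma circle_contZ u z r c : circle_cont u z r -> circle_cont (fun w => c * u w) z r.
Proof. by move=> cu w wr; apply: continuousM; [exact: cst_continuous|exact: cu]. Qed.

Lemma circle_cont_sum (I : Type) (s : seq I) (f : I -> C R -> R) z r :
  (forall i, circle_cont (f i) z r) -> circle_cont (fun w => \sum_(i <- s) f i w) z r.
Proof.
move=> cf; elim: s => [|i s IH].
  by under eq_fun do rewrite big_nil; move=> w _; exact: cst_continuous.
by under eq_fun do rewrite big_cons; exact: circle_contD.
Qed.

Lemma circle_meanD u v z r : 0 <= r -> circle_cont u z r -> circle_cont v z r ->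
  circ (fun w => u w + v w) z r = circ u z r + circ v z r.
Proof. by move=> r0 cu cv; rewrite /circ RintegralD//; exact: circle_integrable. Qed.

Lemma circle_meanZ u z r c : 0 <= r -> circle_cont u z r ->
  circ (fun w => c * u w) z r = c * circ u z r.
Proof. by move=> r0 cu; rewrite /circ RintegralZl//; exact: circle_integrable. Qed.

Lemma circle_mean_sum (I : Type) (s : seq I) (f : I -> C R -> R) z r : 0 <= r ->
  (forall i, circle_cont (f i) z r) ->
  circ (fun w => \sum_(i <- s) f i w) z r = \sum_(i <- s) circ (f i) z r.
Proof.
move=> r0 cf; elim: s => [|i s IH].
  by under eq_fun do rewrite big_nil; rewrite circ_cst mulr0 big_nil.
under eq_fun do rewrite big_cons; rewrite circle_meanD// ?IH ?big_cons//.
exact: circle_cont_sum.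
Qed.

Lemma circle_mean_le u v z r : 0 <= r -> circle_cont u z r -> circle_cont v z r ->
  (forall w, cabs (w - z) = r -> u w <= v w) -> circ u z r <= circ v z r.
Proof.
move=> r0 cu cv uv; apply: le_Rintegral => //.
- exact: circle_integrable.
- exact: circle_integrable.
- by move=> t _; apply: uv; rewrite cabs_cpt.
Qed.

Lemma shmD u v z : shm u z -> shm v z -> shm (fun w => u w + v w) z.
Proof.
move=> [r1 r10 [cu Hu]] [r2 r20 [cv Hv]]; exists (Num.min r1 r2).
  by rewrite lt_min r10.
split=> [w|r r0]; rewrite lt_min => /andP[h1 h2].
  by apply: continuousD; [exact: cu|exact: cv].
rewrite circle_meanD ?(ltW r0)//.
- by rewrite mulrDr lerD ?Hu ?Hv.
- by move=> w wr; apply: cu; rewrite wr.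
- by move=> w wr; apply: cv; rewrite wr.
Qed.

Lemma hmD u v z : hm u z -> hm v z -> hm (fun w => u w + v w) z.
Proof.
move=> [r1 r10 [cu Hu]] [r2 r20 [cv Hv]]; exists (Num.min r1 r2).
  by rewrite lt_min r10.
split=> [w|r r0]; rewrite lt_min => /andP[h1 h2].
  by apply: continuousD; [exact: cu|exact: cv].
rewrite circle_meanD ?(ltW r0)//.
- by rewrite mulrDr Hu ?Hv.
- by move=> w wr; apply: cu; rewrite wr.
- by move=> w wr; apply: cv; rewrite wr.
Qed.

Lemma hm_cst c z : hm (fun=> c) z.
Proof.
exists 1 => //; split=> [w _|r _ _]; first exact: cst_continuous.
exact: circ_cst.
Qed.

Lemma hmZ u z c : hm u z -> hm (fun w => c * u w) z.
Proof.
move=> [rho rho0 [cu Hu]]; exists rho => //; split=> [w wz|r r0 rr].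
  by apply: continuousM; [exact: cst_continuous|exact: cu].
rewrite circle_meanZ ?(ltW r0)// ?Hu// 1?mulrCA//.
by move=> w wr; apply: cu; rewrite wr.
Qed.

Lemma hmN u z : hm u z -> hm (fun w => - u w) z.
Proof.
by move=> /(hmZ (-1)); congr hm; apply/funext => w; rewrite mulN1r.
Qed.

Lemma hm_sum (I : Type) (s : seq I) (f : I -> C R -> R) z :
  (forall i, hm (f i) z) -> hm (fun w => \sum_(i <- s) f i w) z.
Proof.
move=> fz; elim: s => [|i s IH].
  by under eq_fun do rewrite big_nil; exact: hm_cst.
by under eq_fun do rewrite big_cons; exact: hmD.
Qed.

Lemma harmonic_on_hm (U : set (C R)) g z : harmonic_on U g -> U z -> hm g z.
Proof.
move=> [/openCP oU cg Hg] Uz; have [r1 r10 H1] := Hg _ Uz.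
have [r2 r20 H2] := oU _ Uz.
exists (Num.min r1 r2); first by rewrite lt_min r10.
split=> [w|r r0]; rewrite lt_min => /andP[h1 h2].
  exact/cg/H2.
by rewrite /circ /Rintegral H1.
Qed.

(** A value below M would persist on an interval around t0 and make the integral smaller than 2 pi
    M. *)
Lemma ltr_itv_mean (f : R -> R) M t0 : continuous f -> (forall t, f t <= M) ->
  0 <= t0 <= 2 * pi -> 2 * pi * M <= \int[leb]_(t in `[0, 2 * pi]) f t ->
  f t0 = M.
Proof.
move=> cf fM /andP[t00 t02] H.
apply/eqP; rewrite eq_le fM/= leNgt; apply/negP => ft0.
pose e := (M - f t0) / 2.
have e0 : 0 < e by rewrite divr_gt0// subr_gt0.
have [d /= d0 Hd] : exists2 d : R, 0 < d & forall t, `|t0 - t| < d -> f t < M - e.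
  have /nbhs_ballP[d /= d0 Hd] := cf t0 _ (nbhsx_ballx (f t0) e e0).
  exists d => // t /Hd; rewrite /ball/= /e ltr_norml => /andP[h1 h2]; lra.
(* The interval is clipped to [0, 2 pi], since t0 may be an end point. *)
pose a := Num.max 0 (t0 - d / 2); pose b := Num.min (2 * pi) (t0 + d / 2).
have pi0 : 0 < pi :> R by exact: pi_gt0.
have a0 : 0 <= a by rewrite le_max lexx.
have b2 : b <= 2 * pi by rewrite ge_min lexx.
have ab : a < b.
  by rewrite /a /b lt_min !gt_max; apply/andP; split; apply/andP; split; lra.
have le_itv (x y N : R) : x <= y -> (forall t, x <= t <= y -> f t <= N) ->
    \int[leb]_(t in `[x, y]) f t <= N * (y - x).
  move=> xy fN; rewrite -Rintegral_itv_cst//; apply: le_Rintegral => //.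
  - exact: continuous_integrable_itv.
  - by apply: continuous_integrable_itv => ?; exact: cst_continuous.
move: H; rewrite (@Rintegral_split _ _ _ a)//; last by rewrite (le_trans (ltW ab)).
rewrite (@Rintegral_split _ _ a b) ?(ltW ab)//.
have h1 := le_itv 0 a M a0 (fun t _ => fM t).
have h2 : \int[leb]_(t in `[a, b]) f t <= (M - e) * (b - a).
  apply: le_itv; first exact: ltW.
  move=> t; rewrite /a /b ge_max le_min => /andP[/andP[_ h3] /andP[_ h4]].
  by apply/ltW/Hd; rewrite ltr_norml; apply/andP; split; lra.
have h3 := le_itv b (2 * pi) M b2 (fun t _ => fM t).
have : 0 < e * (b - a) by rewrite mulr_gt0 ?subr_gt0.
move: h1 h2 h3; generalize (pi : R) => p *; lra.
Qed.

Lemma polar_cpt z w : exists2 t : R, 0 <= t <= 2 * pi & w = cpt z (cabs (w - z)) t.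
Proof.
have pi0 : 0 < pi :> R by exact: pi_gt0.
set v := w - z; have wE : w = z + v by rewrite /v addrC subrK.
have [v0|v0] := eqVneq v 0.
  exists 0; first by rewrite lexx mulr_ge0// ltW.
  by rewrite v0 cabs0 /cpt wE v0 (_ : Complex 0 0 = 0 :> C R)// mul0r.
have := cabs_gt0 v0; set r := cabs v => r0.
case Ev: v => [x y]; have r2 : r ^+ 2 = x ^+ 2 + y ^+ 2.
  by rewrite /r Ev /cabs/= sqr_sqrtr// addr_ge0// sqr_ge0.
have rn0 : r != 0 by rewrite gt_eqF.
have xr : -1 <= x / r <= 1.
  rewrite -ler_norml normrM normfV (gtr0_norm r0) ler_pdivrMr// mul1r.
  by rewrite /r Ev; exact: (normr_Re_le (Complex x y)).
have [/andP[a0 api] ca] := acos_def xr.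
have sa : sin (acos (x / r)) = `|y| / r.
  have s0 : 0 <= sin (acos (x / r)) by apply: sin_ge0_pi; rewrite ?in_itv/= a0 api.
  have := cos2Dsin2 (acos (x / r)); rewrite ca => H.
  apply/eqP; rewrite -(@eqrXn2 _ 2)// ?divr_ge0 ?normr_ge0 ?(ltW r0)//.
  rewrite expr_div_n real_normK ?num_real//; apply/eqP.
  have -> : y ^+ 2 = r ^+ 2 - x ^+ 2 by rewrite r2; ring.
  rewrite mulrBl -!expr_div_n divff// expr1n; lra.
have [y0|y0] := leP 0 y.
  exists (acos (x / r)).
    by rewrite a0/= (le_trans api)// ler_peMl ?ler1n// ltW.
  rewrite /cpt wE Ev /expi ca sa ger0_norm//; congr (_ + _).
  by rewrite /GRing.mul/= !mul0r subr0 addr0 ![r * _]mulrC !divfK.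
(* [acos] covers only the upper half-plane; the lower one is reached by reflection. *)
exists (2 * pi - acos (x / r)).
  by apply/andP; split; lra.
rewrite /cpt wE Ev /expi; congr (_ + _).
rewrite mulr_natl cosB sinB cos2pi sin2pi ca sa ltr0_norm//.
rewrite !mul1r !mul0r sub0r addr0 mulNr opprK.
rewrite /GRing.mul/= !mul0r subr0 addr0 ![r * _]mulrC.
by rewrite !divfK.
Qed.

(** Each w near z lies on a circle about z where u is at most u z while its mean is at least u z. *)
Lemma shm_max_const u z rho : 0 < rho -> shm u z ->
  (forall w, cabs (w - z) < rho -> u w <= u z) ->
  exists2 d : R, 0 < d & forall w, cabs (w - z) < d -> u w = u z.
Proof.
move=> rho0 [r1 r10 [cu Hu]] uz; exists (Num.min r1 rho); first by rewrite lt_min r10.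
move=> w; rewrite lt_min => /andP[h1 h2].
have [->//|wz] := eqVneq w z.
have r0 : 0 < cabs (w - z) by rewrite cabs_gt0// subr_eq0.
have [t tpi wE] := polar_cpt z w; rewrite {1}wE.
apply: (@ltr_itv_mean (fun s => u (cpt z (cabs (w - z)) s))) tpi _; last exact: Hu.
  by apply: circle_continuous (ltW r0) _ => x xr; apply: cu; rewrite xr.
by move=> s; apply: uz; rewrite cabs_cpt ?ltW.
Qed.

(* At the point of the argmax set with largest real part, the mean inequality
   forces the maximum to be attained further to the right as well. *)
Lemma max_principle u c : compact [set z | c <= u z] ->
  (forall z, c <= u z -> shm u z) -> forall z, u z < c.
Proof.
move=> cL uL z; rewrite ltNge; apply/negP => cz.
have clL := compactC_closed cL.
have [z0 Lz0 z0max] := @compactC_max _ u _ cL (ex_intro _ z cz)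
  (fun z Lz => shm_cont (uL z Lz)).
have umax w : u w <= u z0.
  have [/z0max//|wc] := leP c (u w).
  by rewrite (le_trans (ltW wc)).
have cK : compact [set w | u z0 <= u w].
  have KL : [set w | u z0 <= u w] `<=` [set w | c <= u w].
    by move=> w /=; exact: le_trans.
  apply: (subclosed_compact _ cL (KL)); apply: closedCP => w Hw /=.
  have Lw : c <= u w.
    by apply: clL; apply/closureCP => r /Hw[v /KL Lv vw]; exists v.
  rewrite leNgt; apply/negP => uw.
  have /continuousCP := shm_cont (uL _ Lw).
  move=> /(_ (u z0 - u w)); rewrite subr_gt0 => /(_ uw)[d /Hw[v /= v0 vw] /(_ _ vw)].
  by move=> /ltr_normlW; rewrite ltrD2r ltNge v0.
have [z1 /= z1K z1max] := @compactC_max _ (@complex.Re R) _ cK (ex_intro _ z0 (lexx _))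
  (fun w _ => @continuous_Re R w).
have uz1 : u z1 = u z0 by apply/eqP; rewrite eq_le umax.
have [d d0 Hd] : exists2 d : R, 0 < d & forall w, cabs (w - z1) < d -> u w = u z1.
  apply: (@shm_max_const _ _ 1) => //.
    by apply: uL; rewrite uz1; exact: Lz0.
  by move=> w _; rewrite uz1.
have := z1max (z1 + Complex (d / 2) 0); rewrite [u (_ + _)]Hd ?uz1; last first.
  by rewrite addrAC subrr add0r cabs_real gtr0_norm; lra.
by move=> /(_ (lexx _)); case: (z1) => a b /=; lra.
Qed.

(** Connectedness: the set where u = M is open in A by [shm_max_const], and closed in A by
    continuity. *)
Lemma strong_max_principle (U A : set (C R)) u M z0 : open U -> A `<=` U ->
  connected A -> (forall z, U z -> shm u z) -> (forall z, U z -> u z <= M) ->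
  A z0 -> u z0 = M -> forall z, A z -> u z = M.
Proof.
move=> /openCP oU AU cA uU uM Az0 uz0 z Az.
have E : A `&` [set w | u w = M] = A; last by move: Az; rewrite -{1}E => -[].
apply: cA; first by exists z0.
  exists [set w : C R | exists2 d : R, 0 < d & forall x, cabs (x - w) < d -> u x = M].
    apply/openCP => w [d d0 H]; exists d => // v vw.
    exists (d - cabs (v - w)); first by rewrite subr_gt0.
    by move=> x /ball_shift; exact: H.
  apply/seteqP; split=> w /= [Aw]; last first.
    by move=> [d d0 H]; split=> //; apply: H; rewrite subrr cabs0.
  move=> uw; split => //; rewrite -uw.
  have [d d0 Hd] := oU _ (AU _ Aw).
  apply: (shm_max_const d0); first exact/uU/AU.
  by move=> v /Hd /uM; rewrite uw.
exists (closure (A `&` [set w | u w = M])); first exact: closed_closure.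
apply/seteqP; split=> w /= [Aw]; first by move=> uw; split => //; exact: subset_closure.
move=> /closureCP H; split => //; apply: contrapT => /eqP uw.
have /continuousCP := shm_cont (uU _ (AU _ Aw)).
move=> /(_ `|M - u w|); rewrite normr_gt0 subr_eq0 eq_sym => /(_ uw).
by move=> [d /H[v [_ /= uv] vw] /(_ _ vw)]; rewrite uv ltxx.
Qed.

End MeanValue.

(** * Potentials and Green functions *)

Section Potential.
Variable R : realType.
Implicit Types (z w : C R) (r d : R).
Variables (mu : probability (R * R)%type R) (S : set (C R)).
Hypotheses (cS : compact S) (muS : carried mu S).

(** Potentials carry the sign +ln, opposite to [log_kernel]; they behave like g + e at infinity, and
    [potd] decreases as d does. *)
Definition potd d z := pint mu (fun w => lnt d (cabs (z - w))).
Definition pot z := pint mu (fun w => ln (cabs (z - w))).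

Lemma lntB_lipschitz d (x y v w : C R) : 0 < d ->
  `|lnt d (cabs (x - v)) - lnt d (cabs (y - w))| <=
    d^-1 * (cabs (x - y) + cabs (v - w)).
Proof.
move=> d0; rewrite (le_trans (lnt_lipschitz _ _ d0))// ler_wpM2l ?invr_ge0 ?(ltW d0)//.
rewrite (le_trans (cabs_dist _ _))// -(cabsN (v - w)) (le_trans _ (cabsD _ _))//.
by rewrite (_ : x - v - (y - w) = x - y + - (v - w))//; ring.
Qed.

Lemma continuous_lnt d z : 0 < d -> continuous (fun w => lnt d (cabs (z - w))).
Proof.
move=> d0; apply: (@lipschitz_continuousC _ _ d^-1) => v w.
by rewrite (le_trans (lntB_lipschitz _ _ _ _ d0))// subrr cabs0 add0r.
Qed.

Lemma tame_lnt d z : 0 < d -> tame S (fun w => lnt d (cabs (z - w))).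
Proof. by move=> d0; apply: tame_continuous => //; exact: continuous_lnt. Qed.

Lemma potd_lipschitz d z w : 0 < d -> `|potd d z - potd d w| <= d^-1 * cabs (z - w).
Proof.
move=> d0; rewrite /potd -(pintB muS); [|exact: tame_lnt|exact: tame_lnt].
apply: (norm_pint muS); first by apply: tameB; exact: tame_lnt.
move=> v _; rewrite (le_trans (lntB_lipschitz _ _ _ _ d0))//.
by rewrite subrr cabs0 addr0.
Qed.

Lemma continuous_potd d : 0 < d -> continuous (potd d).
Proof. by move=> d0; apply: lipschitz_continuousC => z w; exact: potd_lipschitz. Qed.

Lemma le_potd d d' z : 0 < d -> d <= d' -> potd d z <= potd d' z.
Proof.
move=> d0 dd; have d'0 := lt_le_trans d0 dd; apply: (le_pint muS) => //.
- exact: tame_lnt.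
- exact: tame_lnt.
- by move=> w _; exact: le_lntd.
Qed.

Lemma tame_ln d z : 0 < d -> (forall w, S w -> d <= cabs (z - w)) ->
  tame S (fun w => ln (cabs (z - w))).
Proof.
move=> d0 Hd; have [_ [M HM]] := tame_lnt z d0; split; last first.
  by exists M => w Sw; have := HM _ Sw; rewrite lntE// Hd.
apply: measurableT_comp; first exact: measurable_ln.
have := measurable_cabsB z; congr measurable_fun.
by apply/funext => p; rewrite cabsBC.
Qed.

Lemma pot_potd d z : 0 < d -> (forall w, S w -> d <= cabs (z - w)) ->
  pot z = potd d z.
Proof.
move=> d0 Hd; apply: (eq_pint muS).
- exact: tame_ln Hd.
- exact: tame_lnt.
- by move=> w Sw; rewrite lntE// Hd.
Qed.

Lemma circ_sum_potd d z r N : 0 < d ->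
  circ_sum (potd d) z r N =
  pint mu (fun w => circ_sum (fun x => lnt d (cabs (x - w))) z r N).
Proof. by move=> d0; rewrite [RHS](pint_sum muS)// => k; exact: tame_lnt. Qed.

Lemma tame_circ_sum d z r N : 0 < d ->
  tame S (fun w => circ_sum (fun x => lnt d (cabs (x - w))) z r N).
Proof. by move=> d0; apply: tame_sum => k; exact: tame_lnt. Qed.

Lemma potd_cpt_lipschitz d z r s t : 0 < d -> 0 <= r ->
  `|potd d (cpt z r s) - potd d (cpt z r t)| <= d^-1 * (r * 2) * `|s - t|.
Proof.
move=> d0 r0; rewrite (le_trans (potd_lipschitz _ _ d0))// -mulrA.
by rewrite ler_wpM2l ?invr_ge0 ?(ltW d0)// cpt_lipschitz.
Qed.

(** Near z the truncation is inactive, so p agrees with the Lipschitz function [potd]. Its circle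
    sums are integrals over w of the sums for ln |x - w|, whose error bound ln 2 is uniform in w. *)
Lemma hm_pot z : ~ S z -> hm pot z.
Proof.
move=> Sz; have [d2 d20 Hd2] := notin_closedC muS.1 Sz.
pose d := d2 / 2; have d0 : 0 < d by rewrite divr_gt0.
have dd : d2 = d + d by rewrite /d; lra.
have zS w : S w -> 2 * d <= cabs (z - w).
  move=> Sw; rewrite leNgt cabsBC; apply/negP => /= H; apply: Hd2 Sw.
  by rewrite dd -mulr2n -mulr_natl.
have far x : cabs (x - z) < d -> forall w, S w -> d <= cabs (x - w).
  move=> xz w Sw; have := zS _ Sw; have := cabs_tri z w x.
  rewrite (cabsBC z x); lra.
exists d => //; split=> [x xz|r r0 rd].
  apply: (@for_continuous_local _ (potd d) _ _ (d - cabs (x - z))).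
  - by rewrite subr_gt0.
  - by move=> y /ball_shift yz; rewrite (@pot_potd d)//; exact: far.
  - exact: continuous_potd.
rewrite (@eq_circ _ _ (potd d)) ?(ltW r0)//; last first.
  by move=> w wz; rewrite (@pot_potd d)//; apply: far; rewrite wz.
apply: (@circ_limit _ _ _ _ (d^-1 * (r * 2)) _ (ln 2)) => [s t|j].
  by apply: potd_cpt_lipschitz => //; exact: ltW.
have tz := tame_ln d0 (far z ltac:(by rewrite subrr cabs0)).
rewrite circ_sum_potd// /pot -(pintZ muS)// -(pintB muS); last 2 first.
- exact: tame_circ_sum.
- by apply: tameM => //; exact: tame_cst.
apply: (norm_pint muS).
  apply: tameB; first exact: tame_circ_sum.
  by apply: tameM => //; exact: tame_cst.
move=> w Sw; have zw := zS _ Sw.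
have -> : circ_sum (fun x => lnt d (cabs (x - w))) z r (2 ^ j) =
    circ_sum (fun x => ln (cabs (x - w))) z r (2 ^ j).
  by apply: eq_bigr => k _; rewrite lntE// far// cabs_cpt ?ltW.
apply: circ_sum_ln_near; first exact: ltW.
  by apply: contraPneq Sw => <-.
by rewrite (le_trans _ zw)// ler_wpM2l// ltW.
Qed.

(** The mean does not depend on the measure: every point w within r/2 of the centre contributes ln
    r. *)
Lemma circ_pot_far M r : 0 < r -> (forall w, S w -> cabs w <= M) -> 2 * M <= r ->
  circ pot 0 r = 2 * pi * ln r.
Proof.
move=> r0 SM Mr; pose d := r / 2; have d0 : 0 < d by rewrite divr_gt0.
have far x : cabs (x - 0) = r -> forall w, S w -> d <= cabs (x - w).
  by rewrite subr0 => xr w /SM wM; have := cabsB_ge x w; rewrite /d; lra.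
rewrite (@eq_circ _ _ (potd d)) ?(ltW r0)//; last first.
  by move=> w wz; rewrite (@pot_potd d)//; apply: far.
apply: (@circ_limit _ _ _ _ (d^-1 * (r * 2)) _ (ln 2)) => [s t|j].
  by apply: potd_cpt_lipschitz => //; exact: ltW.
rewrite circ_sum_potd// -[X in _ - X](pint_cst mu) -(pintB muS); last 2 first.
- exact: tame_circ_sum.
- exact: tame_cst.
apply: (norm_pint muS).
  by apply: tameB; [exact: tame_circ_sum|exact: tame_cst].
move=> w Sw; have wM := SM _ Sw.
have -> : circ_sum (fun x => lnt d (cabs (x - w))) 0 r (2 ^ j) =
    circ_sum (fun x => ln (cabs (x - w))) 0 r (2 ^ j).
  by apply: eq_bigr => k _; rewrite lntE// far// cabs_cpt ?ltW.
by apply: circ_sum_ln_far => //; rewrite sub0r cabsN; lra.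
Qed.

End Potential.

Section Point.
Variable R : realType.
Implicit Types (z w : C R).

Lemma carried_dirac w :
  carried (@dirac _ (R * R)%type (Re w, Im w) R) [set w].
Proof.
split; first exact: accessible_closed_set1 (hausdorff_accessible (@hausdorffC R)) _.
change ((\1_(@p2c R @^-1` [set~ w]) (Re w, Im w) : R)%:E = 0%E).
by rewrite indicE memNset// => /=; apply; exact: p2c_ReIm.
Qed.

Lemma pint_dirac w (f : C R -> R) : measurable_fun setT (fun p => f (p2c p)) ->
  pint (@dirac _ (R * R)%type (Re w, Im w) R) f = f w.
Proof.
move=> mf; rewrite /pint /Rintegral integral_dirac//; last exact/measurable_EFinP.
by rewrite p2c_ReIm /dirac indicT mul1e.
Qed.

Lemma measurable_ln_cabs z : measurable_fun setT (fun p : R * R => ln (cabs (z - p2c p))).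
Proof.
apply: measurableT_comp; first exact: measurable_ln.
have := measurable_cabsB z; congr measurable_fun.
by apply/funext => p; rewrite cabsBC.
Qed.

(** With a point mass, the facts on ln |x - w| become instances of those on potentials. *)
Lemma pot_dirac w :
  pot (@dirac _ (R * R)%type (Re w, Im w) R) = (fun z => ln (cabs (z - w))).
Proof. by apply/funext => z; rewrite /pot pint_dirac//; exact: measurable_ln_cabs. Qed.

Lemma hm_ln z w : z != w -> hm (fun x => ln (cabs (x - w))) z.
Proof.
move=> zw; rewrite -pot_dirac; apply: (@hm_pot _ _ _ (@compact_set1 _ w) (carried_dirac w)).
by move=> /= zw'; rewrite zw' eqxx in zw.
Qed.

Lemma circ_ln_far r w : 0 < r -> 2 * cabs w <= r ->
  circ (fun x => ln (cabs (x - w))) 0 r = 2 * pi * ln r.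
Proof.
move=> r0 wr; rewrite -pot_dirac.
apply: (@circ_pot_far _ _ _ (@compact_set1 _ w) (carried_dirac w) (cabs w)) => //.
by move=> x /= ->.
Qed.

End Point.

(** * The unbounded component of the complement *)

Section Unbounded.
Variable R : realType.
Implicit Types (z w : C R) (r d M : R) (E A : set (C R)).

Lemma Omega_notin E z : Omega E z -> ~ E z.
Proof. by move=> [A [_ AE Az _]]; exact: AE. Qed.

Lemma Omega_comp E z : Omega E z ->
  exists A, [/\ connected A, A `<=` Omega E, A z & ~ cbounded A].
Proof. by move=> [A [cA AE Az bA]]; exists A; split => // w Aw; exists A. Qed.

Lemma connected_path (f : R -> C R) (i : interval R) (L : R) :
  (forall s t, cabs (f s - f t) <= L * `|s - t|) -> connected (f @` [set` i]).
Proof.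
move=> fL; apply: connected_continuous_connected.
  by apply/connected_intervalP; exact: interval_is_interval.
apply: continuous_subspaceT => t B /nbhsCP[e e0 H]; apply/nbhs_ballP.
have L1 : 0 < `|L| + 1 by rewrite ltr_wpDl.
exists (e / (`|L| + 1)) => /=; first by rewrite divr_gt0.
move=> s; rewrite /ball/= ltr_pdivlMr// => ts; apply: H.
apply: le_lt_trans ts; rewrite (le_trans (fL _ _))// mulrC distrC ler_wpM2l//.
by rewrite (le_trans (ler_norm _))// lerDl.
Qed.

Lemma cabs_realM r z : cabs (Complex r 0 * z) = `|r| * cabs z.
Proof. by rewrite cabsM cabs_real. Qed.

Lemma Omega_far E M z : (forall w, E w -> cabs w <= M) -> M < cabs z -> Omega E z.
Proof.
move=> EM Mz.
have [z0|z0] := eqVneq (cabs z) 0.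
  (* Here M < 0, so [E] is empty and the whole plane, a union of segments through 0, can be
     taken. *)
  exists setT; split => //.
  - have -> : [set: C R] = \bigcup_w ((fun s : R => Complex s 0 * w) @` [set` `[0, 1]%R]).
      apply/seteqP; split=> // w _; exists w => //; exists 1; first by rewrite /= in_itv/= ler01 lexx.
      by rewrite (_ : Complex 1 0 = 1 :> C R)// mul1r.
    apply: bigcup_connected.
      exists 0 => w _; exists 0; first by rewrite /= in_itv/= ler01 lexx.
      by rewrite (_ : Complex 0 0 = 0 :> C R)// mul0r.
    move=> w _; apply: (@connected_path _ _ (cabs w)) => s t.
    rewrite -mulrBl (_ : Complex s 0 - Complex t 0 = Complex (s - t) 0).
      by rewrite cabs_realM mulrC.
    by rewrite /GRing.add/= subr0.
  - move=> w _ /EM wM; have := cabs_ge0 w; lra.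
  - move=> [N HN]; have := HN (Complex (`|N| + 1) 0) I.
    rewrite cabs_real ger0_norm; last by rewrite addr_ge0.
    by have := ler_norm N; lra.
have zp : 0 < cabs z by rewrite lt_neqAle eq_sym z0 cabs_ge0.
exists ((fun s : R => Complex s 0 * z) @` [set` `[1, +oo[%R]); split.
- apply: (@connected_path _ _ (cabs z)) => s t.
  rewrite -mulrBl (_ : Complex s 0 - Complex t 0 = Complex (s - t) 0).
    by rewrite cabs_realM mulrC.
  by rewrite /GRing.add/= subr0.
- move=> w [s]; rewrite /= in_itv/= andbT => s1 <- /EM.
  rewrite cabs_realM ger0_norm ?(le_trans _ s1)// leNgt => /negP; apply.
  by rewrite (lt_le_trans Mz)// ler_peMl// ltW.
- exists 1; first by rewrite /= in_itv/= lexx.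
  by rewrite (_ : Complex 1 0 = 1 :> C R)// mul1r.
- move=> [N HN]; have s1 : 1 <= 1 + `|N| / cabs z.
    by rewrite lerDl divr_ge0// ltW.
  have := HN (Complex (1 + `|N| / cabs z) 0 * z).
  have -> : cabs (Complex (1 + `|N| / cabs z) 0 * z) = cabs z + `|N|.
    by rewrite cabs_realM (ger0_norm (le_trans ler01 s1)) mulrDl divfK// mul1r.
  move=> H; have := H (ex_intro2 _ _ (1 + `|N| / cabs z) _ erefl).
  rewrite /= in_itv/= s1 => /(_ isT); have := ler_norm N; lra.
Qed.

(** If z were off [E], a disc about z would miss [E], and a segment inside it would attach z to a
    connected unbounded set through a nearby point of Omega. *)
Lemma Omega_boundary E z : closed E -> closure (Omega E) z -> ~ Omega E z -> E z.
Proof.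
move=> cE /closureCP clz Oz; apply: contrapT => Ez; apply: Oz.
have [r r0 Hr] := notin_closedC cE Ez.
have [w [A [cA AE Aw bA]] wz] := clz _ r0.
pose B := (fun s : R => w + Complex s 0 * (z - w)) @` [set` `[0, 1]%R].
have Bw : B w.
  exists 0; first by rewrite /= in_itv/= ler01 lexx.
  by rewrite (_ : Complex 0 0 = 0 :> C R)// mul0r addr0.
exists (A `|` B); split.
- apply: connectedU => //; first by exists w.
  apply: (@connected_path _ _ (cabs (z - w))) => s t.
  rewrite opprD addrACA subrr add0r.
  rewrite -mulrBl (_ : Complex s 0 - Complex t 0 = Complex (s - t) 0).
    by rewrite cabs_realM mulrC.
  by rewrite /GRing.add/= subr0.
- move=> x [/AE//|[s]]; rewrite /= in_itv/= => /andP[s0 s1] <-; apply: Hr.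
  have -> : w + Complex s 0 * (z - w) - z = Complex (1 - s) 0 * (w - z).
    have -> : Complex (1 - s) 0 = 1 - Complex s 0 :> C R.
      by rewrite /GRing.add/= oppr0 addr0.
    by ring.
  rewrite cabs_realM ger0_norm ?subr_ge0//; apply: le_lt_trans wz.
  by rewrite ler_piMl ?cabs_ge0// lerBlDr lerDl.
- right; exists 1; first by rewrite /= in_itv/= lexx ler01.
  by rewrite (_ : Complex 1 0 = 1 :> C R)// mul1r addrC subrK.
- by move=> [M HM]; apply: bA; exists M => x Ax; apply: HM; left.
Qed.

End Unbounded.

(** * Green functions and the maximum principle on Omega *)

Section Green.
Variable R : realType.
Implicit Types (z w : C R) (r d M : R).
Variables (E : set (C R)) (g : C R -> R).
Hypotheses (cE : compact E) (gE : continuous_green E g).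
Let Om := Omega E.

Lemma green_cont : continuous g. Proof. by case: gE. Qed.

Lemma green_off z : ~ Om z -> g z = 0. Proof. by case: gE => _ + _ _; apply. Qed.

Lemma green_hm z : Om z -> hm g z.
Proof. by case: gE => _ _ h _; exact: harmonic_on_hm h. Qed.

Lemma open_Omega : open Om. Proof. by case: gE => _ _ []. Qed.

Lemma green_growth : exists M r0, forall z, r0 < cabs z -> `|g z - ln (cabs z)| <= M.
Proof. by case: gE. Qed.

(* The Green function tends to infinity, so subtracting a small multiple of it
   makes a function bounded above near infinity tend to -oo there. *)
Lemma Omega_max_principle (h : C R -> R) :
  (forall z, Om z -> shm h z) ->
  (forall z, closure Om z -> ~ Om z -> forall e, 0 < e ->
     exists2 d : R, 0 < d & forall w, Om w -> cabs (w - z) < d -> h w < e) ->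
  (exists B r0, forall z, Om z -> r0 < cabs z -> h z <= B) ->
  forall z, Om z -> h z <= 0.
Proof.
move=> hO hb [B [r0 hB]] z0 Oz0; rewrite leNgt; apply/negP => hz0.
pose c := h z0 / 2; have c0 : 0 < c by rewrite divr_gt0.
pose e := c / (`|g z0| + 1).
have G1 : 0 < `|g z0| + 1 by rewrite ltr_wpDl.
have e0 : 0 < e by rewrite divr_gt0.
(* The default 0 lies below c > 0, so the superlevel set at height c stays inside Omega. *)
pose u z := if `[< Om z >] then h z - e * g z else 0.
have uE z : Om z -> u z = h z - e * g z by move=> Oz; rewrite /u asboolT.
have LO z : c <= u z -> Om z.
  by rewrite /u; case: asboolP => // _ /(lt_le_trans c0); rewrite ltxx.
have uz0 : c <= u z0.
  rewrite uE//; have : e * g z0 <= c.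
    rewrite (le_trans (ler_norm _))// normrM gtr0_norm// /e mulrAC ler_pdivrMr//.
    by rewrite ler_wpM2l ?(ltW c0)// lerDl.
  by rewrite /c; lra.
have shu z : Om z -> shm u z.
  move=> Oz; have /openCP/(_ _ Oz)[d d0 Hd] := open_Omega.
  apply: (@shm_local _ (fun w => h w + - (e * g w)) _ _ d) => //.
    by move=> w /Hd Ow; rewrite uE.
  by apply: shmD; [exact: hO|apply: hm_shm; apply/hmN/hmZ; exact: green_hm].
have := @max_principle _ u c; apply/not_implyP; split; last first.
  move=> /(_ (fun z Lz => shu _ (LO _ Lz)) z0); by rewrite ltNge uz0.
apply: bounded_closed_compactC.
  have [M [r1 gM]] := green_growth.
  exists (Num.max (Num.max r0 r1) (Num.max 1 (expR ((B - c) / e + M)))) => z /= Lz.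
  rewrite leNgt; apply/negP; rewrite !gt_max => /andP[/andP[zr0 zr1] /andP[z1 zB]].
  have Oz := LO _ Lz; move: Lz; rewrite leNgt => /negP; apply; rewrite uE//.
  have := gM _ zr1; rewrite ler_norml => /andP[g1 _].
  have : (B - c) / e + M < ln (cabs z).
    by rewrite -ltr_expR lnK// posrE (lt_trans _ z1).
  rewrite -ltrBrDr ltr_pdivrMr// => h1.
  have : (ln (cabs z) - M) * e <= g z * e by rewrite ler_wpM2r ?(ltW e0)//; lra.
  by have := hB _ Oz zr0; lra.
apply: closedCP => z Hz /=.
have clz : closure Om z.
  by apply/closureCP => r /Hz[w /LO Ow wz]; exists w.
have [Oz|Oz] := pselect (Om z).
  rewrite leNgt; apply/negP => uc.
  have /continuousCP := shm_cont (shu _ Oz).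
  move=> /(_ (c - u z)); rewrite subr_gt0 => /(_ uc)[d /Hz[w /= cw wz] /(_ _ wz)].
  by move=> /ltr_normlW; rewrite ltrD2r ltNge cw.
have c4 : 0 < c / 2 by rewrite divr_gt0.
have [d1 d10 Hd1] := hb _ clz Oz _ c4.
have /continuousCP := @green_cont z; move=> /(_ (c / 2 / e) ltac:(by rewrite divr_gt0)).
move=> [d2 d20 Hd2].
have [w /= cw wz] := Hz (Num.min d1 d2) ltac:(by rewrite lt_min d10).
move: wz; rewrite lt_min => /andP[w1 w2].
have Ow := LO _ cw; move: cw; rewrite uE//.
have := Hd1 _ Ow w1; have := Hd2 _ w2; rewrite (green_off Oz) subr0.
rewrite ltr_norml => /andP[+ _]; rewrite -mulNr ltr_pdivrMr// [_ * e]mulrC; lra.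
Qed.

Lemma green_ge0 z : Om z -> 0 <= g z.
Proof.
move=> Oz; rewrite -oppr_le0; apply: (@Omega_max_principle (fun z => - g z)) => //.
- by move=> w Ow; apply/hm_shm/hmN/green_hm.
- move=> w _ Ow e e0; have /continuousCP/(_ _ e0)[d d0 Hd] := @green_cont w.
  exists d => // x _ /Hd; rewrite (green_off Ow) subr0 ltr_norml => /andP[+ _]; lra.
- have [M [r0 gM]] := green_growth; exists M; exists (Num.max r0 1) => w _.
  rewrite gt_max => /andP[/gM + /ltW/ln_ge0]; rewrite ler_norml => /andP[+ _]; lra.
Qed.

(** A zero would be a minimum, so g would vanish on an unbounded connected set, against its
    logarithmic growth. *)
Lemma green_gt0 z : Om z -> 0 < g z.
Proof.
move=> Oz; rewrite lt_neqAle green_ge0// andbT; apply/eqP => gz.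
have [A [cA AO Az bA]] := Omega_comp Oz.
have := @strong_max_principle _ Om A (fun w => - g w) 0 z open_Omega AO cA.
move=> /(_ (fun w Ow => hm_shm (hmN (green_hm Ow)))).
move=> /(_ ltac:(by move=> w Ow; rewrite oppr_le0 green_ge0)) /(_ Az).
rewrite -gz oppr0 => /(_ erefl) H; apply: bA.
have [M [r0 gM]] := green_growth.
exists (Num.max (Num.max r0 1) (expR M)) => w Aw; rewrite leNgt; apply/negP.
rewrite !gt_max => /andP[/andP[wr w1] wM].
have := gM _ wr; have /eqP := H _ Aw; rewrite oppr_eq0 => /eqP ->.
rewrite sub0r normrN => h; have := ler_norm (ln (cabs w)).
have : M < ln (cabs w) by rewrite -ltr_expR lnK// posrE (lt_trans _ w1).
lra.
Qed.

End Green.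

(** * Energy as a limit of truncated energies *)

Section Energy.
Variable R : realType.
Implicit Types (z w : C R) (r d c : R).

Lemma max0_lipschitz (a b : R) : `|Num.max 0 a - Num.max 0 b| <= `|a - b|.
Proof.
move: (ler_norm (a - b)) (ler_norm (b - a)); rewrite (distrC b a).
move: `|a - b| => t h1 h2; rewrite ler_norml.
by case: (leP 0 a) => ?; case: (leP 0 b) => ?; apply/andP; split; lra.
Qed.

(** Stated without measurability, because it is applied to the singular kernel and to its inner
    integrals. *)
Lemma le_integral_pointwise dd (T : measurableType dd) (m : {measure set T -> \bar R})
    (f g : T -> \bar R) : (forall x, (f x <= g x)%E) ->
  (\int[m]_x f x <= \int[m]_x g x)%E.
Proof.
move=> fg; rewrite /integral; apply: leeB; apply: le_ereal_sup => _ [h hf <-];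
  exists h => // x; rewrite (le_trans (hf x))//.
  by apply: (@funepos_le _ _ setT) => [y _|]; rewrite ?inE// !patch_setT.
by apply: (@funeneg_le _ _ setT) => [y _|]; rewrite ?inE// !patch_setT.
Qed.

Variables (nu : probability (R * R)%type R) (E : set (C R)).
Hypotheses (cE : compact E) (nuE : carried nu E).

(** The truncated energy with the sign reversed: equilibrium means maximal in the limit d -> 0. *)
Definition edl d := pint nu (potd nu d).

Lemma tame_potd d : 0 < d -> tame E (potd nu d).
Proof.
by move=> d0; apply: tame_continuous => //; apply: continuous_potd d0; [exact: cE|exact: nuE].
Qed.

Lemma lnt_ge_ln d x : 0 < x -> ln x <= lnt d x.
Proof. by move=> x0; apply: ler_ln_pos; rewrite ?le_max ?lexx. Qed.

Lemma p2c_inj : injective (@p2c R).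
Proof. by move=> [a b] [c d] [-> ->]. Qed.

Lemma log_kernel_ge d (p q : R * R) : 0 < d ->
  ((- lnt d (cabs (p2c p - p2c q)))%:E <= log_kernel p q)%E.
Proof.
move=> d0; rewrite /log_kernel; case: ifPn => [_|pq]; first exact: leey.
rewrite lee_fin lerN2 lnt_ge_ln// cabs_gt0// subr_eq0.
by apply: contra_neq pq => /p2c_inj.
Qed.

(** The kernel is the supremum of its truncations: on the diagonal they are -ln d, which is
    unbounded, and off it d = |p - q| already gives the exact value. *)
Lemma log_kernel_le (p q : R * R) (x : \bar R) :
  (forall d, 0 < d -> ((- lnt d (cabs (p2c p - p2c q)))%:E <= x)%E) ->
  (log_kernel p q <= x)%E.
Proof.
move=> H; rewrite /log_kernel; case: ifPn => [/eqP pq|pq].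
  rewrite leye_eq; apply/eqP/eqyP => A A0.
  have := H (expR (- A)) (expR_gt0 _); rewrite pq subrr cabs0 /lnt max_r ?expR_ge0//.
  by rewrite expRK opprK.
have pq0 : 0 < cabs (p2c p - p2c q).
  by rewrite cabs_gt0// subr_eq0; apply: contra_neq pq => /p2c_inj.
by have := H _ pq0; rewrite /lnt max_l.
Qed.

Lemma energy_ge d : 0 < d -> ((- edl d)%:E <= energy nu)%E.
Proof.
move=> d0.
have -> : - edl d = pint nu (fun z => - potd nu d z).
  under [in RHS]eq_fun do rewrite -mulN1r.
  by rewrite (pintZ nuE) ?mulN1r//; exact: tame_potd.
rewrite -(EFin_pint nuE); last by apply: tameN; exact: tame_potd.
apply: le_integral_pointwise => p.
have -> : - potd nu d (p2c p) = pint nu (fun w => - lnt d (cabs (p2c p - w))).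
  under [in RHS]eq_fun do rewrite -mulN1r.
  by rewrite (pintZ nuE) ?mulN1r//; exact: tame_lnt.
rewrite -(EFin_pint nuE); last by apply: tameN; exact: tame_lnt.
by apply: le_integral_pointwise => q; exact: log_kernel_ge.
Qed.

(** Monotone convergence in each variable, for truncated kernels shifted by a constant so as to be
    nonnegative. *)
Lemma energy_le c : (forall d, 0 < d -> - edl d <= c) -> (energy nu <= c%:E)%E.
Proof.
move=> Hc; have [M EM] := compactC_bounded cE.
(* [D] dominates both the distances in [E] and all truncation levels, which are at most 1. *)
pose D := Num.max 1 (2 * M); have D1 : 1 <= D by rewrite le_max lexx.
have D0 : 0 < D := lt_le_trans ltr01 D1.
have ED z w : E z -> E w -> cabs (z - w) <= D.
  move=> /EM zM /EM wM; rewrite le_max; apply/orP; right.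
  by rewrite (le_trans (cabsD _ _))// cabsN; lra.
pose L := ln D; pose dk (k : nat) : R := k.+1%:R^-1.
have dk0 k : 0 < dk k by rewrite invr_gt0.
have dkD k : dk k <= D by rewrite (le_trans _ D1)// invf_le1// ler1n.
(* On [E] the maximum with 0 changes nothing; it provides positivity at the points off [E]. *)
pose kk k z w := Num.max 0 (L - lnt (dk k) (cabs (z - w))).
have kk0 k z w : 0 <= kk k z w by rewrite le_max lexx.
have kk_incr z w : {homo (fun k => kk k z w) : i j / (i <= j)%N >-> i <= j}.
  move=> i j ij; rewrite /kk ge_max !le_max lexx/= lerD2l lerN2 le_lntd ?orbT//.
  by rewrite lef_pV2// ?posrE// ler_nat.
have kk_lip k x y v w : `|kk k x v - kk k y w| <= (dk k)^-1 * (cabs (x - y) + cabs (v - w)).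
  apply: le_trans (lntB_lipschitz _ _ _ _ (dk0 k)).
  rewrite /kk; set a := lnt _ _; set b := lnt _ _.
  by rewrite (le_trans (max0_lipschitz _ _))// opprB addrC -addrA [- _ + (_ - _)]addrA
    addNr add0r distrC addrC.
have ckk k z : continuous (kk k z).
  apply: (@lipschitz_continuousC _ _ (dk k)^-1) => v w.
  by rewrite (le_trans (kk_lip _ _ _ _ _))// subrr cabs0 add0r.
have tkk k z : tame E (kk k z) by exact: tame_continuous.
pose G k z := pint nu (kk k z).
have tG k : tame E (G k).
  apply: tame_continuous => //; apply: (@lipschitz_continuousC _ _ (dk k)^-1) => v w.
  rewrite /G -(pintB nuE)//; apply: (norm_pint nuE); first exact: tameB.
  by move=> x _; rewrite (le_trans (kk_lip _ _ _ _ _))// subrr cabs0 addr0.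
have G0 k z : 0 <= G k z by apply: Rintegral_ge0 => p _.
have G_incr z : {homo (fun k => G k z) : i j / (i <= j)%N >-> i <= j}.
  by move=> i j ij; apply: (le_pint nuE) => // w _; exact: kk_incr.
have intG k : pint nu (G k) <= c + L.
  have tl z := tame_lnt cE z (dk0 k).
  have -> : pint nu (G k) = pint nu (fun z => L - potd nu (dk k) z).
    apply: (eq_pint nuE) => //.
      by apply: tameB; [exact: tame_cst|exact: tame_potd].
    move=> z Ez; rewrite -[X in X - _](pint_cst nu) /potd -(pintB nuE)//; last exact: tame_cst.
    apply: (eq_pint nuE) => //; first by apply: tameB => //; exact: tame_cst.
    move=> w Ew; rewrite /kk max_r// subr_ge0 /L ler_ln_pos// ?lnt_max_gt0//.
    by rewrite ge_max ED// dkD.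
  rewrite (pintB nuE); [|exact: tame_cst|exact: tame_potd].
  by rewrite (pint_cst nu) addrC lerD2r; exact: Hc.
have cvkk p q : cvgn (fun k => (kk k (p2c p) (p2c q))%:E).
  by apply: ereal_nondecreasing_is_cvgn => i j ij; rewrite lee_fin kk_incr.
have cvG p : cvgn (fun k => (G k (p2c p))%:E).
  by apply: ereal_nondecreasing_is_cvgn => i j ij; rewrite lee_fin G_incr.
have lim_ge (u : nat -> R) k : {homo u : i j / (i <= j)%N >-> i <= j} ->
    ((u k)%:E <= limn (fun k => (u k)%:E))%E.
  move=> uh; have uh' : nondecreasing_seq (fun k => (u k)%:E).
    by move=> i j ij; rewrite lee_fin uh.
  by rewrite (cvg_lim _ (ereal_nondecreasing_cvgn uh'))//; apply: ereal_sup_ubound; exists k.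
pose kap p q := limn (fun k => (kk k (p2c p) (p2c q))%:E).
pose Gl p := limn (fun k => (G k (p2c p))%:E).
have mG k : measurable_fun setT (fun p => (G k (p2c p))%:E).
  by apply/measurable_EFinP; exact: (tG k).1.
have mkk k z : measurable_fun setT (fun p => (kk k z (p2c p))%:E).
  by apply/measurable_EFinP; exact: (tkk k z).1.
have mlim (u : nat -> R * R -> \bar R) : (forall k, measurable_fun setT (u k)) ->
    (forall p, cvgn (u ^~ p)) -> measurable_fun setT (fun p => limn (u ^~ p)).
  by move=> mu cu; apply: (emeasurable_fun_cvg u) => // p _; exact: cu.
have mGl : measurable_fun setT Gl by exact: (mlim (fun k p => (G k (p2c p))%:E)).
have intkap p : (\int[nu]_q kap p q = Gl p)%E.
  rewrite /kap (monotone_convergence nu) //; last 2 first.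
  - by move=> k q _; rewrite lee_fin.
  - by move=> q _ i j ij; rewrite lee_fin kk_incr.
  by congr (limn _); apply/funext => k; rewrite -(EFin_pint nuE).
have intGl : (\int[nu]_p Gl p <= (c + L)%:E)%E.
  rewrite /Gl (monotone_convergence nu) //; last 2 first.
  - by move=> k q _; rewrite lee_fin.
  - by move=> q _ i j ij; rewrite lee_fin G_incr.
  apply: lime_le.
    apply: ereal_nondecreasing_is_cvgn => i j ij.
    by apply: le_integral_pointwise => p; rewrite lee_fin G_incr.
  by apply: nearW => k; rewrite (EFin_pint nuE)// lee_fin.
(* Only this inequality is needed, and it is trivial when the integral of [f] is infinite. *)
have sub (f : R * R -> \bar R) : measurable_fun setT f -> (forall p, 0 <= f p)%E ->
    (\int[nu]_p (f p - L%:E) <= \int[nu]_p f p - L%:E)%E.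
  move=> mf f0; have [->|foo] := eqVneq (\int[nu]_p f p)%E +oo%E; first exact: leey.
  have intf : nu.-integrable setT f.
    apply/integrableP; split => //.
    rewrite (eq_integral f); first by rewrite ltey.
    by move=> p _; rewrite gee0_abs.
  have intL : nu.-integrable setT (cst L%:E).
    by apply: finite_measure_integrable_cst.
  rewrite [leLHS](integralB measurableT intf intL) integral_cst//.
  by rewrite [X in (L%:E * X)%E](_ : _ = 1%E) ?mule1//; exact: probability_setT.
have kap0 p q : (0 <= kap p q)%E.
  by rewrite (le_trans _ (lim_ge _ 0%N (kk_incr _ _)))// lee_fin.
have Gl0 p : (0 <= Gl p)%E.
  by rewrite (le_trans _ (lim_ge _ 0%N (G_incr _)))// lee_fin.
have Kkap p q : (log_kernel p q <= kap p q - L%:E)%E.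
  apply: log_kernel_le => d d0.
  have [k kd] : exists k, dk k <= d.
    by have [k] := @ltr_add_invr R 0 d d0; rewrite add0r => /ltW; exists k.
  rewrite leeBrDr// -EFinD (le_trans _ (lim_ge _ k (kk_incr _ _)))// lee_fin.
  by rewrite /kk le_max addrC lerD2l lerN2 le_lntd// orbT.
apply: (@le_trans _ _ (\int[nu]_p (Gl p - L%:E))%E).
  apply: le_integral_pointwise => p.
  apply: (@le_trans _ _ (\int[nu]_q (kap p q - L%:E))%E).
    exact: le_integral_pointwise.
  rewrite -intkap; apply: sub => //.
  exact: (mlim (fun k q => (kk k (p2c p) (p2c q))%:E)).
rewrite (le_trans (sub _ mGl Gl0))// leeBlDr// -EFinD; exact: intGl.
Qed.

End Energy.

(** * Weak compactness and Fekete points *)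

Section Curve.
Variable R : realType.
Implicit Types (s t x y e M : R) (k : nat).

Let clamp x : R := Num.max 0 (Num.min 1 x).

Lemma clamp_ge0 x : 0 <= clamp x. Proof. by rewrite le_max lexx. Qed.

Lemma clamp_le1 x : clamp x <= 1.
Proof. by rewrite ge_max ler01/= ge_min lexx. Qed.

Lemma clampE x : 0 <= x <= 1 -> clamp x = x.
Proof. by case/andP=> x0 x1; rewrite /clamp min_r// max_r. Qed.

Lemma clamp_lipschitz x y : `|clamp x - clamp y| <= `|x - y|.
Proof.
apply: le_trans (max0_lipschitz _ _) _.
move: (ler_norm (x - y)) (ler_norm (y - x)); rewrite (distrC y x).
move: `|x - y| => t h1 h2; rewrite ler_norml.
by case: (leP 1 x) => ?; case: (leP 1 y) => ?; apply/andP; split; lra.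
Qed.

(* [digit] and [tent] read off and shift the ternary (Cantor-set) expansion;
   in this Gray-code form both maps are continuous. *)
Definition digit t : R := clamp (3 * t - 1).
Definition tent t : R := clamp (3 * Num.min t (1 - t)).

Lemma digit_lipschitz s t : `|digit s - digit t| <= 3 * `|s - t|.
Proof.
apply: le_trans (clamp_lipschitz _ _) _.
by rewrite opprB addrA subrK -mulrBr normrM ger0_norm.
Qed.

Lemma tent_lipschitz s t : `|tent s - tent t| <= 3 * `|s - t|.
Proof.
apply: le_trans (clamp_lipschitz _ _) _.
rewrite -mulrBr normrM ger0_norm// ler_wpM2l//.
move: (ler_norm (s - t)) (ler_norm (t - s)); rewrite (distrC t s).
move: `|s - t| => u h1 h2; rewrite ler_norml.
by case: (leP s (1 - s)) => ?; case: (leP t (1 - t)) => ?; apply/andP; split; lra.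
Qed.

(** A coordinate takes its binary digits from every second place of the ternary expansion;
    evaluating at [tent t] reads the remaining places. The two together form a Schoenberg-type curve
    onto the square. *)
Fixpoint coordn k t : R :=
  if k is k'.+1 then (digit t + coordn k' (tent (tent t))) / 2 else 0.

Lemma coordn_bounds k t : 0 <= coordn k t <= 1.
Proof.
elim: k t => [|k IH] t /=; first by rewrite lexx ler01.
have /andP[h1 h2] := IH (tent (tent t)).
have h3 := clamp_ge0 (3 * t - 1); have h4 := clamp_le1 (3 * t - 1).
by rewrite /digit; apply/andP; split; lra.
Qed.

Lemma coordn_incr k t : coordn k t <= coordn k.+1 t.
Proof.
elim: k t => [|k IH] t; first by have /andP[] := coordn_bounds 1 t.
have := IH (tent (tent t)).
rewrite [X in _ -> X <= _](_ : _ = (digit t + coordn k (tent (tent t))) / 2)//.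
rewrite [X in _ -> _ <= X](_ : _ = (digit t + coordn k.+1 (tent (tent t))) / 2)//.
lra.
Qed.

Lemma coordn_homo t : {homo (fun k => coordn k t) : i j / (i <= j)%N >-> i <= j}.
Proof. by apply: homo_leq => //; [exact: le_trans|move=> k; exact: coordn_incr]. Qed.

Lemma coordn_le k j t : coordn (k + j) t <= coordn k t + (2 ^ k)%:R^-1.
Proof.
elim: k t => [|k IH] t.
  by rewrite add0n expn0 invr1 add0r; case/andP: (coordn_bounds j t).
have := IH (tent (tent t)); rewrite addSn /= expnS natrM invfM.
by move: (_ ^-1) => u; lra.
Qed.

Definition coord t : R := sup [set coordn k t | k in [set: nat]].

Lemma coord_has_sup t : has_sup [set coordn k t | k in [set: nat]].
Proof.
split; first by exists 0, 0%N.
by exists 1 => _ [k _ <-]; case/andP: (coordn_bounds k t).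
Qed.

Lemma coordn_le_coord k t : coordn k t <= coord t.
Proof. by apply: ub_le_sup; [exact: (coord_has_sup t).2|exists k]. Qed.

Lemma coord_le k t : coord t <= coordn k t + (2 ^ k)%:R^-1.
Proof.
apply: ge_sup; first exact: (coord_has_sup t).1.
move=> _ [j _ <-]; have [jk|/ltnW kj] := leqP j k.
  by rewrite (le_trans (coordn_homo _ jk))// lerDl invr_ge0.
by rewrite -(subnKC kj); exact: coordn_le.
Qed.

Lemma coord_bounds t : 0 <= coord t <= 1.
Proof.
rewrite (coordn_le_coord 0 t)/=; have := coord_le 0 t.
by rewrite expn0 invr1 add0r.
Qed.

Lemma pow2_small e : 0 < e -> exists k, (2 ^ k)%:R^-1 < e.
Proof.
move=> e0; have [k] := @ltr_add_invr R 0 e e0; rewrite add0r => ke; exists k.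
rewrite (le_lt_trans _ ke)// lef_pV2 ?posrE ?ltr0n ?expn_gt0// ler_nat.
exact: ltn_expl.
Qed.

Lemma coordn_lipschitz k : exists2 L, 0 < L &
  forall s t, `|coordn k s - coordn k t| <= L * `|s - t|.
Proof.
elim: k => [|k [L L0 HL]].
  by exists 1 => // s t; rewrite subrr normr0 mul1r.
exists (3 / 2 + L * 9 / 2); first by rewrite addr_gt0// !divr_gt0// mulr_gt0.
move=> s t /=; rewrite -mulrBl opprD addrACA normrM (ger0_norm (_ : 0 <= 2^-1))//.
have h1 := digit_lipschitz s t; have h2 := HL (tent (tent s)) (tent (tent t)).
have h3 := tent_lipschitz (tent s) (tent t); have h4 := tent_lipschitz s t.
have h5 : L * `|tent (tent s) - tent (tent t)| <= L * (9 * `|s - t|).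
  by rewrite ler_wpM2l ?(ltW L0)//; lra.
have := ler_normD (digit s - digit t) (coordn k (tent (tent s)) - coordn k (tent (tent t))).
lra.
Qed.

Lemma coord_ucont e : 0 < e -> exists2 d, 0 < d &
  forall s t, `|s - t| <= d -> `|coord s - coord t| <= e.
Proof.
move=> e0; have e2 : 0 < e / 2 by rewrite divr_gt0.
have [k ke] := pow2_small e2.
have [L L0 HL] := coordn_lipschitz k.
exists (e / 2 / L); first by rewrite !divr_gt0.
move=> s t; rewrite ler_pdivlMr// mulrC => st.
have := le_trans (HL s t) st.
have := coord_le k s; have := coord_le k t.
have := coordn_le_coord k s; have := coordn_le_coord k t.
by rewrite !ler_norml => h1 h2 h3 h4 /andP[h5 h6]; apply/andP; split; lra.
Qed.

Lemma branch x : 0 <= x <= 1 ->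
  exists2 a, (a = 0 \/ a = 1) & 0 <= 2 * x - a <= 1.
Proof.
move=> /andP[x0 x1]; have [xh|xh] := leP x (1 / 2).
  by exists 0; [left|apply/andP; split; lra].
by exists 1; [right|apply/andP; split; lra].
Qed.

(** The inverse branches of [tent] on the outer thirds of [0, 1], where [digit] is constant. *)
Lemma unshift a s : a = 0 \/ a = 1 -> 0 <= s <= 1 ->
  exists2 t, 0 <= t <= 1 & digit t = a /\ tent t = s.
Proof.
move=> [->|->] /andP[s0 s1].
  exists (s / 3); first by apply/andP; split; lra.
  split; first by rewrite /digit /clamp min_r ?max_l//; lra.
  by rewrite /tent min_l; [rewrite clampE; [|apply/andP; split]|]; lra.
exists (1 - s / 3); first by apply/andP; split; lra.
split; first by rewrite /digit /clamp min_l ?max_r//; lra.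
by rewrite /tent min_r; [rewrite clampE; [|apply/andP; split]|]; lra.
Qed.

(** Each step prepends two ternary places: one holds the leading binary digit of x, the next that of
    y. *)
Lemma coordn_onto k x y : 0 <= x <= 1 -> 0 <= y <= 1 ->
  exists2 t, 0 <= t <= 1 & `|coordn k t - x| <= (2 ^ k)%:R^-1 /\
    `|coordn k (tent t) - y| <= (2 ^ k)%:R^-1.
Proof.
elim: k x y => [|k IH] x y x01 y01.
  exists 0; first by rewrite lexx ler01.
  by rewrite /= expn0 invr1 !sub0r !normrN !ger0_norm//; lra.
have [a a01 xa] := branch x01; have [b b01 yb] := branch y01.
have [s s01 [h1 h2]] := IH _ _ xa yb.
have [t1 t101 [d1 e1]] := unshift b01 s01.
have [t t01 [d2 e2]] := unshift a01 t101.
exists t => //; rewrite /= e2 e1 d1 d2 expnS natrM invfM.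
move: h1 h2; move: (_ ^-1) => u; rewrite !ler_norml => /andP[h1 h2] /andP[h3 h4].
by split; apply/andP; split; lra.
Qed.

Lemma coord_onto x y : 0 <= x <= 1 -> 0 <= y <= 1 ->
  exists2 t, 0 <= t <= 1 & coord t = x /\ coord (tent t) = y.
Proof.
move=> x01 y01.
pose f (t : R) : R := `|coord t - x| + `|coord (tent t) - y|.
have cont_coord : continuous coord.
  move=> t B /nbhs_ballP[e /= e0 H]; have [|d d0 Hd] := @coord_ucont (e / 2).
    by rewrite divr_gt0.
  apply/nbhs_ballP; exists d => //= s; rewrite /ball/= distrC => /ltW/Hd st.
  by apply: H; rewrite /ball/= distrC; lra.
have cont_f : continuous f.
  have cn (k : R -> R) (y0 : R) : continuous k -> continuous (fun t => `|k t - y0|).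
    by move=> ck t; exact: (cvg_norm (cvgB (ck t) (cvg_cst y0))).
  have ct : continuous (fun t => coord (tent t)).
    move=> t; apply: (@continuous_comp _ _ _ tent coord); last exact: cont_coord.
    exact: (lipschitz_continuousR tent_lipschitz).
  by move=> t; exact: (cvgD (cn _ x cont_coord t) (cn _ y ct t)).
have [c /andP[c0 c1] cmin] := @EVT_min R f 0 1 ler01 (continuous_subspaceT cont_f).
have fc : f c = 0.
  apply/eqP; rewrite eq_le addr_ge0// andbT leNgt; apply/negP => fc.
  (* Passing from [coordn] to [coord] doubles each error, so f is at most 4 / 2^k < f c at the
     approximating point. *)
  have fc4 : 0 < f c / 5 by rewrite divr_gt0.
  have [k kf] := pow2_small fc4.
  have [t t01 [h1 h2]] := coordn_onto k x01 y01.
  have := cmin t t01; rewrite leNgt => /negP; apply.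
  have h3 := coord_le k t; have h4 := coordn_le_coord k t.
  have h5 := coord_le k (tent t); have h6 := coordn_le_coord k (tent t).
  have g1 : `|coord t - x| <= 2 * (2 ^ k)%:R^-1.
    by move: h1; rewrite !ler_norml => /andP[? ?]; apply/andP; split; lra.
  have g2 : `|coord (tent t) - y| <= 2 * (2 ^ k)%:R^-1.
    by move: h2; rewrite !ler_norml => /andP[? ?]; apply/andP; split; lra.
  rewrite /f in kf fc *; lra.
exists c; first exact/andP.
move/eqP: fc; rewrite /f paddr_eq0 ?normr_ge0// !normr_eq0 !subr_eq0.
by case/andP=> /eqP -> /eqP ->.
Qed.

(** A whole square is covered, hence the bound 2 M. Uniform continuity is what turns nearby codes
    into nearby points. *)
Lemma space_filling_curve M : 0 < M -> exists H : R -> C R,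
  [/\ forall e, 0 < e -> exists2 d, 0 < d &
        forall s t, `|s - t| <= d -> cabs (H s - H t) <= e,
      forall t, cabs (H t) <= 2 * M &
      forall z, cabs z <= M -> exists2 t, 0 <= t <= 1 & H t = z].
Proof.
move=> M0; exists (fun t => Complex (2 * M * coord t - M) (2 * M * coord (tent t) - M)).
split=> [e e0|t|[x y] zM].
- have e1 : 0 < e / (4 * M) by rewrite divr_gt0// mulr_gt0.
  have [d d0 Hd] := coord_ucont e1.
  exists (d / 3); first by rewrite divr_gt0.
  move=> s t st.
  have -> : (Complex (2 * M * coord s - M) (2 * M * coord (tent s) - M) : C R) -
     Complex (2 * M * coord t - M) (2 * M * coord (tent t) - M) =
     Complex (2 * M * (coord s - coord t)) (2 * M * (coord (tent s) - coord (tent t))).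
    transitivity (Complex ((2 * M * coord s - M) - (2 * M * coord t - M))
      ((2 * M * coord (tent s) - M) - (2 * M * coord (tent t) - M)) : C R); first by [].
    by congr Complex; ring.
  rewrite (le_trans (cabs_le_ReIm _ _))// !normrM !(ger0_norm (ltW M0)).
  rewrite (ger0_norm (_ : 0 <= 2))// -mulrDr.
  have h1 : `|coord s - coord t| <= e / (4 * M) by apply: Hd; lra.
  have h2 : `|coord (tent s) - coord (tent t)| <= e / (4 * M).
    by apply: Hd; rewrite (le_trans (tent_lipschitz _ _))//; lra.
  have -> : e = 2 * M * (e / (4 * M) + e / (4 * M)) by field; rewrite gt_eqF.
  by rewrite ler_wpM2l ?lerD// mulr_ge0// ltW.
- rewrite (le_trans (cabs_le_ReIm _ _))//.
  have /andP[h1 h2] := coord_bounds t; have /andP[h3 h4] := coord_bounds (tent t).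
  have g1 : `|2 * M * coord t - M| <= M by rewrite ler_norml; apply/andP; split; nra.
  have g2 : `|2 * M * coord (tent t) - M| <= M by rewrite ler_norml; apply/andP; split; nra.
  lra.
- have := le_trans (normr_Re_le _) zM; have := le_trans (normr_Im_le _) zM => /=.
  rewrite !ler_norml => /andP[y1 y2] /andP[x1 x2].
  have M2 : 0 < 2 * M by rewrite mulr_gt0.
  have [||t t01 [tx ty]] := @coord_onto ((x + M) / (2 * M)) ((y + M) / (2 * M)).
  + by rewrite ler_pdivlMr// ler_pdivrMr//; apply/andP; split; lra.
  + by rewrite ler_pdivlMr// ler_pdivrMr//; apply/andP; split; lra.
  exists t => //; rewrite tx ty ![2 * M * _]mulrC !divfK ?gt_eqF//.
  by rewrite !addrK.
Qed.

End Curve.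

(** * Riemann-Stieltjes sums and cluster points *)

Section Discretisation.
Variable R : realType.
Implicit Types (x u d e L B : R) (c h : nat -> R).
Local Notation leb := (@lebesgue_measure R).

Lemma bounded_integrable_itv (f : R -> R) B (i : interval R) (a b : R) :
  measurable_fun setT f -> (forall x, `|f x| <= B) ->
  [set` i] `<=` `[a, b] -> leb.-integrable [set` i] (EFin \o f).
Proof.
move=> mf fB iab; apply: measurable_bounded_integrable => //.
- apply: (@le_lt_trans _ _ (leb `[a, b])); first by apply: le_measure; rewrite ?inE.
  by rewrite lebesgue_measure_itv/=; case: ifPn => // _; rewrite -EFinD ltry.
- exact: measurable_funTS.
- exists B; split; first exact: num_real.
  by move=> M BM x _ /=; rewrite (le_trans (fB x))// ltW.
Qed.

(** For [c] the values of a distribution function on a grid and [f] a composite with its quantile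
    function, the sum is a Riemann-Stieltjes sum. *)
Lemma step_integral (f : R -> R) B e c h K : measurable_fun setT f ->
  (forall x, `|f x| <= B) -> c 0%N = 0 -> (forall a, c a <= c a.+1) ->
  (forall a u, (a < K)%N -> c a < u -> u <= c a.+1 -> `|f u - h a| <= e) ->
  `|\int[leb]_(u in `]0, c K]) f u - \sum_(a < K) h a * (c a.+1 - c a)| <= e * c K.
Proof.
move=> mf fB c0 cS; have cm : {homo c : i j / (i <= j)%N >-> i <= j}.
  by apply: homo_leq => //; exact: le_trans.
have c_ge0 a : 0 <= c a by rewrite -c0 cm.
have intf x y : leb.-integrable `]x, y] (EFin \o f).
  by apply: (@bounded_integrable_itv _ B _ x y) => //; exact: subset_itv_oc_cc.
elim: K => [|K IH] H; first by rewrite c0 big_ord0 set_itvoc0 Rintegral_set0 subr0 normr0 mulr0.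
rewrite big_ord_recr/=.
have -> : \int[leb]_(u in `]0, c K.+1]) f u =
    \int[leb]_(u in `]0, c K]) f u + \int[leb]_(u in `]c K, c K.+1]) f u.
  have := @Rintegral_itvB R f (BRight 0) (BRight (c K.+1)) (c K) (intf _ _).
  by move=> /(_ (c_ge0 K) (cS K)) <-; rewrite subrKC.
rewrite opprD addrACA (le_trans (ler_normD _ _))//.
have -> : e * c K.+1 = e * c K + e * (c K.+1 - c K) by ring.
apply: lerD; first by apply: IH => a u aK; apply: H; exact: ltnW.
have -> : h K * (c K.+1 - c K) = \int[leb]_(u in `]c K, c K.+1]) (h K).
  rewrite Rintegral_cst//= lebesgue_measure_itv/= lte_fin.
  case: ltP => [_|ba]; first by [].
  have -> : c K.+1 = c K by apply/eqP; rewrite eq_le ba cS.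
  by rewrite subrr.
have intc r : leb.-integrable `]c K, c K.+1] (EFin \o cst r).
  by apply: (@bounded_integrable_itv _ `|r| _ (c K) (c K.+1)) => //; exact: subset_itv_oc_cc.
rewrite -RintegralB//; last exact: intc.
apply: le_trans (le_normr_Rintegral _ _) _ => //.
  apply: (@bounded_integrable_itv _ (B + `|h K|) _ (c K) (c K.+1)) => //.
  - by apply: measurable_funB.
  - by move=> x; rewrite (le_trans (ler_normB _ _))// lerD2r.
  - exact: subset_itv_oc_cc.
have -> : e * (c K.+1 - c K) = \int[leb]_(u in `]c K, c K.+1]) e.
  rewrite Rintegral_cst//= lebesgue_measure_itv/= lte_fin.
  case: ltP => [_|ba]; first by [].
  have -> : c K.+1 = c K by apply/eqP; rewrite eq_le ba cS.
  by rewrite subrr.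
apply: le_Rintegral => //.
- apply: (@bounded_integrable_itv _ (B + `|h K|) _ (c K) (c K.+1)) => //.
  + by apply: measurableT_comp => //; apply: measurable_funB.
  + by move=> x; rewrite normr_id (le_trans (ler_normB _ _))// lerD2r.
  + exact: subset_itv_oc_cc.
- exact: intc.
- by move=> u /=; rewrite in_itv/= => /andP[h1 h2]; apply: H.
Qed.

(** The same comparison for a point mass at x: the differences of indicators select the one cell
    that contains x. *)
Lemma step_sum (f : R -> R) e (s : nat -> R) K x :
  (forall a, s a <= s a.+1) -> s 0%N <= x -> x < s K -> 
  (forall a, (a < K)%N -> s a <= x -> x < s a.+1 -> `|f x - f (s a)| <= e) ->
  `|f x - \sum_(a < K) f (s a) * ((x < s a.+1)%R%:R - (x < s a)%R%:R)| <= e.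
Proof.
move=> sS s0x; have sm : {homo s : i j / (i <= j)%N >-> i <= j}.
  by apply: homo_leq => //; exact: le_trans.
elim: K => [|K IH]; first by move=> /(le_lt_trans s0x); rewrite ltxx.
move=> xK H; rewrite big_ord_recr/= xK; have [xs|sx] := ltP x (s K).
  by rewrite subrr mulr0 addr0; apply: IH => // a aK; apply: H; exact: ltnW.
rewrite big1 ?add0r ?subr0 ?mulr1; first exact: H.
move=> a _; have sa : s a.+1 <= x by rewrite (le_trans _ sx)// sm// ltn_ord.
by rewrite !ltNge sa (le_trans _ sa)// subrr mulr0.
Qed.

(** Compactness of [0, 1]^R gives a cluster point, which replaces Helly's diagonal subsequence: only
    finitely many arguments have to be controlled at a time. *)
Lemma cluster_seq (F : nat -> R -> R) : (forall n x, 0 <= F n x <= 1) ->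
  exists G : R -> R, forall (s : seq R) e N, 0 < e ->
    exists2 n, (N <= n)%N & forall x, x \in s -> `|F n x - G x| < e.
Proof.
move=> F01.
have cA := @tychonoff R (fun=> R) (fun=> `[0, 1]) (fun=> @segment_compact R 0 1).
have [] := cA (F @ \oo) _ _.
  by exists 0%N => // n _ x /=; rewrite in_itv/=; exact: F01.
move=> G [_ clG]; exists G => s e N e0.
have nbG : nbhs (G : prod_topology (fun _ : R => R)) [set f | forall x, x \in s -> `|f x - G x| < e].
  elim: s => [|x s IH].
    have -> : [set f : R -> R | forall x, x \in [::] -> `|f x - G x| < e] = setT.
      by apply/seteqP; split.
    exact: (@filterT _ _ (nbhs_filter _)).
  have nx : nbhs (G : prod_topology (fun _ : R => R)) [set f | `|f x - G x| < e].
    have := @proj_continuous R (fun=> R) x G [set y | `|y - G x| < e].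
    apply; apply/nbhs_ballP; exists e => // y; by rewrite /ball/= distrC.
  apply: (@filterS2 _ _ (nbhs_filter _) _ _ _ _ nx IH) => f fx fs y.
  rewrite inE => /predU1P[->//|]; exact: fs.
have FN : (F @ \oo) [set f | exists2 n, (N <= n)%N & f = F n].
  by exists N => // n Nn; exists n.
by have [f [[n Nn ->] Hn]] := clG _ _ FN nbG; exists n.
Qed.

End Discretisation.

Lemma mfun_exists d d' (T : measurableType d) (T' : measurableType d') (f : T -> T') :
  measurable_fun setT f -> exists G : {mfun T >-> T'}, forall x, G x = f x.
Proof.
move=> mf; pose mix := isMeasurableFun.Build _ _ _ _ f mf.
by exists (HB.pack f mix : {mfun T >-> T'}).
Qed.

Lemma normr_ReB (R : realType) (z w : C R) : `|Re z - Re w| <= cabs (z - w).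
Proof. by case: z w => a b [c d]; exact: (normr_Re_le (Complex a b - Complex c d)). Qed.

Lemma normr_ImB (R : realType) (z w : C R) : `|Im z - Im w| <= cabs (z - w).
Proof. by case: z w => a b [c d]; exact: (normr_Im_le (Complex a b - Complex c d)). Qed.

(** * Weak limits of empirical measures *)

Section WeakLimit.
Variable R : realType.
Implicit Types (z w : C R) (u x y e L B : R).
Local Notation leb := (@lebesgue_measure R).
Variables (E : set (C R)) (z_ : nat -> C R).
Hypotheses (cE : compact E) (zE : forall i, E (z_ i)).

(** For u <= 0 the quantile function below is the supremum of the empty set, a default value whose
    image under the curve need not lie in [E]. *)
Lemma uniform_le0 : uniform_prob (@ltr01 R) `]-oo, 0] = 0%E.
Proof.
rewrite /uniform_prob integral_uniform_pdf.
have -> : `]-oo, (0 : R)] `&` `[0, 1] = [set 0].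
  apply/seteqP; split=> [x [/=]|x /= ->]; rewrite !in_itv/=.
    by move=> x0 /andP[x1 _]; apply/eqP; rewrite eq_le x0.
  by rewrite lexx ler01.
by rewrite integral_set1.
Qed.

Lemma pint_push (G : {mfun (measurableTypeR R) >-> (R * R)%type}) (f : C R -> R) B :
  measurable_fun setT (fun p => f (p2c p)) -> (forall u, `|f (p2c (G u))| <= B) ->
  pint (distribution (uniform_prob (@ltr01 R)) G) f =
  \int[leb]_(u in `]0, 1]) f (p2c (G u)).
Proof.
move=> mf fB; set P := uniform_prob (@ltr01 R).
have mfG : measurable_fun setT (fun u => f (p2c (G u))).
  have mG : measurable_fun [set: measurableTypeR R] G by exact: measurable_funPT.
  exact: (measurableT_comp mf mG).
have intP (h : R -> R) B' : measurable_fun setT h -> (forall u, `|h u| <= B') ->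
    P.-integrable setT (EFin \o h).
  move=> mh hB; apply: measurable_bounded_integrable => //.
    by rewrite (le_lt_trans (probability_le1 _ _))// ltry.
  exists B'; split; first exact: num_real.
  by move=> M BM x _ /=; rewrite (le_trans (hB x))// ltW.
have intL (h : R -> R) B' : measurable_fun setT h -> (forall u, `|h u| <= B') ->
    leb.-integrable `]0, 1] (EFin \o h).
  by move=> mh hB; apply: (@bounded_integrable_itv _ _ B' _ 0 1) => //; exact: subset_itv_oc_cc.
rewrite /pint /Rintegral integral_distribution; last 2 first.
- exact/measurable_EFinP.
- exact: (intP _ B).
rewrite -[LHS]/(\int[P]_u f (p2c (G u))).
have B0 : 0 <= B by exact: le_trans (normr_ge0 _) (fB 0).
(* The integral formula for the uniform law is for nonnegative functions; adding [B] makes the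
   integrand one. *)
have shift : \int[P]_u (f (p2c (G u)) + B) = \int[leb]_(u in `]0, 1]) (f (p2c (G u)) + B).
  rewrite Rintegral_itv_obnd_cbnd; last first.
    apply: (intL _ (B + B)); first exact: measurable_funD.
    by move=> u; rewrite (le_trans (ler_normD _ _))// lerD// ger0_norm.
  rewrite /Rintegral integral_uniform ?subr0 ?invr1 ?mul1e//.
    by apply/measurable_EFinP; exact: measurable_funD.
  move=> u; rewrite lee_fin; have := fB u; rewrite ler_norml => /andP[+ _]; lra.
move: shift; rewrite RintegralD//; last 2 first.
- exact: (intP _ B).
- by apply: (intP _ B) => // u; rewrite ger0_norm.
rewrite RintegralD//; last 2 first.
- exact: (intL _ B).
- by apply: (intL _ B) => // u; rewrite ger0_norm.
rewrite !Rintegral_cst//= lebesgue_measure_itv/= lte_fin ltr01 sube0 mulr1.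
rewrite [X in fine X](_ : _ = 1%E) ?mulr1; last exact: probability_setT.
by move/addIr.
Qed.

(* Helly's selection for the distribution functions of the codes of the points
   on a space-filling curve; the limit measure is the law of the curve evaluated
   at the quantile function of the limit. *)
Lemma weak_limit : exists nu : probability (R * R)%type R, carried nu E /\
  forall L B e N0, 0 <= L -> 0 <= B -> 0 < e -> exists N, (N0 <= N)%N /\
    forall f : C R -> R, (forall z w, `|f z - f w| <= L * cabs (z - w)) ->
      `|f (z_ 0%N)| <= B ->
      `|(\sum_(i < N.+1) f (z_ i)) / N.+1%:R - pint nu f| <= e.
Proof.
have [M [M0 EM]] : exists M, 0 < M /\ forall z, E z -> cabs z <= M.
  have [M EM] := compactC_bounded cE; exists (`|M| + 1); split; first by rewrite ltr_wpDl.
  by move=> z /EM zM; rewrite (le_trans zM)// (le_trans (ler_norm M))// lerDl.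
have [H [Huc H2M Honto]] := space_filling_curve M0.
have [x Hx] : exists x : nat -> R, forall i, 0 <= x i <= 1 /\ H (x i) = z_ i.
  have ex i : exists t, 0 <= t <= 1 /\ H t = z_ i.
    by have [t] := Honto _ (EM _ (zE i)); exists t.
  by exists (fun i => sval (cid (ex i))) => i; exact: (svalP (cid (ex i))).
pose FN n y := (\sum_(i < n.+1) (x i < y)%R%:R) / n.+1%:R : R.
have FN01 n y : 0 <= FN n y <= 1.
  rewrite divr_ge0 ?sumr_ge0//= ler_pdivrMr// mul1r -[X in _ <= X%:R]card_ord -sumr_const.
  by rewrite ler_sum// => i _; rewrite lern1; case: (_ < _).
have [F HF] := cluster_seq FN01.
have FE y v : (forall n, FN n y = v) -> F y = v.
  move=> Fv; apply/eqP; rewrite -subr_eq0 -normr_le0 leNgt; apply/negP => h0.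
  have [n _ /(_ y)] := HF [:: y] _ 0%N h0; rewrite inE eqxx => /(_ isT).
  by rewrite Fv distrC ltxx.
have F0 y : y <= 0 -> F y = 0.
  move=> y0; apply: FE => n; rewrite /FN big1 ?mul0r// => i _.
  by have [/andP[xi _] _] := Hx i; rewrite ltNge (le_trans y0).
have F1 y : 1 < y -> F y = 1.
  move=> y1; apply: FE => n; rewrite /FN (eq_bigr (fun=> 1)).
    by rewrite sumr_const card_ord divff.
  by move=> i _; have [/andP[_ xi] _] := Hx i; rewrite (le_lt_trans xi).
have Fm y y' : y <= y' -> F y <= F y'.
  move=> yy; rewrite leNgt; apply/negP; rewrite -subr_gt0 => h0.
  have h1 : 0 < (F y - F y') / 2 by rewrite divr_gt0.
  have [n _ Hn] := HF [:: y; y'] _ 0%N h1.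
  have : FN n y <= FN n y'.
    rewrite ler_pM2r ?invr_gt0// ler_sum// => i _; rewrite ler_nat.
    by case: (ltP (x i) y) => // /lt_le_trans ->.
  have := Hn y; have := Hn y'; rewrite !inE !eqxx orbT => /(_ isT) + /(_ isT).
  rewrite !ltr_norml => /andP[_ h2] /andP[h3 _]; lra.
have F_ge0 y : 0 <= F y.
  by have [/F0->//|/ltW/Fm] := leP y 0; rewrite F0.
have F_le1 y : F y <= 1.
  by have [/F1->//|y1] := ltP 1 y; rewrite -(F1 2) ?ltr1n// Fm// (le_trans y1)// ler1n.
(* [q] is the quantile function of [F]. The cap at 1 keeps [A u] bounded when u > 1. *)
pose A u := [set y | F y < Num.min u 1].
pose q u := sup (A u).
have Aub u y : A u y -> y <= 1.
  rewrite /A/= lt_min => /andP[_]; rewrite leNgt => Fy; apply/negP => /F1 E1.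
  by rewrite E1 ltxx in Fy.
have A0 u : 0 < u -> A u 0 by rewrite /A/= F0// lt_min ltr01 andbT.
have Asup u : 0 < u -> has_sup (A u).
  by move=> u0; split; [exists 0; exact: A0|exists 1 => y; exact: Aub].
have Ale0 u : u <= 0 -> A u = set0.
  by move=> u0; apply/seteqP; split=> y //; rewrite /A/= lt_min ltNge (le_trans u0)// F_ge0.
have q_ge u y : 0 < u -> A u y -> y <= q u by move=> u0 Ay; apply: ub_le_sup => //; case: (Asup _ u0).
have q_le u b : 0 < u -> (forall y, A u y -> y <= b) -> q u <= b.
  by move=> u0 ub; apply: ge_sup => //; exists 0; exact: A0.
have q_nd : nondecreasing_fun q.
  move=> u v uv; have [u0|u0] := leP u 0.
    rewrite {1}/q Ale0// sup0; have [v0|v0] := leP v 0; first by rewrite /q Ale0// sup0.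
    by apply: q_ge => //; exact: A0.
  have v0 := lt_le_trans u0 uv.
  apply: q_le => // y; rewrite /A/= lt_min => /andP[yu y1]; apply: q_ge => //=.
  by rewrite /A/= lt_min y1 (lt_le_trans yu).
have mq : measurable_fun setT q by exact: nondecreasing_measurable.
have mH (h : C R -> R) : (forall z w, `|h z - h w| <= cabs (z - w)) ->
    measurable_fun setT (fun u => h (H (q u))).
  move=> hl; apply: (measurableT_comp (f := fun t => h (H t))) mq.
  apply: continuous_measurable_fun => t V /nbhs_ballP[e /= e0 HV].
  have e2 : 0 < e / 2 by rewrite divr_gt0.
  have [d d0 Hd] := Huc _ e2; apply/nbhs_ballP; exists d => //= s.
  rewrite /ball/= => /ltW/Hd st; apply: HV; rewrite /ball/=.
  by rewrite (le_lt_trans (hl _ _))// (le_lt_trans st)//; lra.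
have mG : measurable_fun setT (fun u => (Re (H (q u)), Im (H (q u))) : R * R).
  apply: measurable_fun_pair.
    by apply: (mH (@complex.Re R)) => z w; exact: normr_ReB.
  by apply: (mH (@complex.Im R)) => z w; exact: normr_ImB.
have [G GE'] := @mfun_exists _ _ (measurableTypeR R) _ _ mG.
have GE u : p2c (G u) = H (q u) by rewrite GE'; exact: p2c_ReIm.
pose nu := distribution (uniform_prob (@ltr01 R)) G.
have clE := compactC_closed cE.
have muE : carried nu E.
  pose P : probability (measurableTypeR R) R := uniform_prob (@ltr01 R).
  have mGE : measurable (G @^-1` (@p2c R @^-1` (~` E))).
    rewrite -[X in measurable X]setTI; apply: (@measurable_funPT _ _ _ _ G) => //.
    exact: (measurable_open (closed_openC clE)).
  split => //; apply/eqP; rewrite eq_le measure_ge0 andbT -uniform_le0.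
  rewrite -[leLHS]/(P (G @^-1` (@p2c R @^-1` (~` E)))).
  apply: (@le_measure _ _ _ P); rewrite ?inE//.
  move=> u /=; rewrite GE in_itv/= leNgt => nE; apply/negP => u0; apply: nE.
  apply: clE; apply/closureCP => r r0.
  have r2 : 0 < r / 2 by rewrite divr_gt0.
  have [d d0 Hd] := Huc _ r2.
  (* [F] increases strictly between y and q u + d, hence so does some empirical distribution
     function, and a code [x i] lies within [d] of q u. *)
  have [y Ay yq] : exists2 y, A u y & q u - d < y by exact: sup_adherent (Asup _ u0).
  have nAq : ~ A u (q u + d).
    by move=> /(q_ge _ _ u0); rewrite gerDl leNgt d0.
  have lt1 : F y < F (q u + d).
    by rewrite (lt_le_trans Ay)// leNgt; apply/negP.
  have h1 : 0 < (F (q u + d) - F y) / 2 by rewrite divr_gt0// subr_gt0.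
  have [n _ Hn] := HF [:: y; q u + d] _ 0%N h1.
  have : FN n y < FN n (q u + d).
    have := Hn y; have := Hn (q u + d); rewrite !inE !eqxx orbT => /(_ isT) + /(_ isT).
    rewrite !ltr_norml => /andP[h2 _] /andP[_ h3]; lra.
  rewrite ltr_pM2r ?invr_gt0// ltNge => /negP nle.
  have [i [xi1 xi2]] : exists i, y <= x i /\ x i < q u + d.
    apply: contrapT => nex; apply: nle; apply: ler_sum => i _; rewrite ler_nat.
    case: (ltP (x i) (q u + d)) => // xi; case: (ltP (x i) y) => // yi.
    by exfalso; apply: nex; exists i.
  exists (z_ i) => //; have [_ <-] := Hx i; apply: (@le_lt_trans _ _ (r / 2)); last by lra.
  have := q_ge _ _ u0 Ay.
  by move=> yq'; apply: Hd; rewrite ler_norml; apply/andP; split; lra.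
exists nu; split => // L B e N0 L0 B0 e0.
pose B' := B + L * (3 * M).
have B'0 : 0 <= B' by rewrite addr_ge0// mulr_ge0// mulr_ge0// ltW.
have e1 : 0 < e / 4 / (L + 1) by rewrite !divr_gt0// ltr_wpDl.
have [d d0 Hd] := Huc _ e1.
have [k kd] := @ltr_add_invr R 0 d d0; rewrite add0r in kd.
(* With k + 2 cells the grid passes strictly beyond 1, where [F] equals 1. *)
pose s a : R := a%:R / k.+1%:R; pose K := k.+2.
have sS a : s a.+1 = s a + k.+1%:R^-1 by rewrite /s -natr1 mulrDl mul1r.
have k0 : 0 <= k.+1%:R^-1 :> R by rewrite invr_ge0.
have s_incr a : s a <= s a.+1 by rewrite sS lerDl invr_ge0.
have sK : 1 < s K by rewrite /s ltr_pdivlMr// mul1r ltr_nat.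
(* [K] cells, each with error at most 2 e2 (B' + 1), add up to e / 4. *)
pose e2 := e / (8 * K%:R * (B' + 1)).
have K0 : 0 < K%:R :> R by rewrite ltr0n.
have e20 : 0 < e2 by rewrite divr_gt0// mulr_gt0 ?ltr_wpDl// mulr_gt0.
(* N is fixed before f: the estimate is uniform over a family of functions with common Lipschitz
   constant and bound. *)
have [N NN HN] := HF [seq s a | a <- iota 0 K.+1] e2 N0 e20.
exists N; split => // f fL fB.
have fH t : `|f (H t)| <= B'.
  have := fL (H t) (z_ 0%N); have := cabs_tri (H t) (z_ 0%N) 0.
  rewrite subr0 sub0r cabsN; have := H2M t; have := EM _ (zE 0%N).
  move=> h1 h2 h3; have : L * cabs (H t - z_ 0%N) <= L * (3 * M).
    by rewrite ler_wpM2l//; lra.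
  move: fB; rewrite /B' !ler_norml => /andP[? ?] ? /andP[? ?]; apply/andP; split; lra.
have fHH t t' : `|t - t'| <= k.+1%:R^-1 -> `|f (H t) - f (H t')| <= e / 4.
  move=> tt; have : cabs (H t - H t') <= e / 4 / (L + 1).
    by apply: Hd; rewrite (le_trans tt)// ltW.
  move=> /(ler_wpM2l L0)/(le_trans (fL _ _))/le_trans; apply.
  rewrite mulrCA ler_piMr ?divr_ge0 ?(ltW e0)// ler_pdivrMr ?ltr_wpDl// mul1r.
  by rewrite lerDl.
have mf : measurable_fun setT (fun p => f (p2c p)).
  by apply: measurable_continuous; exact: lipschitz_continuousC fL.
rewrite (@pint_push _ _ B')//; last by move=> u; rewrite GE.
under eq_Rintegral do rewrite GE.
set I := \int[leb]_(u in _) _.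
pose S1 := \sum_(a < K) f (H (s a)) * (F (s a.+1) - F (s a)).
pose S2 := \sum_(a < K) f (H (s a)) * (FN N (s a.+1) - FN N (s a)).
have h1 : `|I - S1| <= e / 4.
  have := @step_integral R (fun u => f (H (q u))) B' (e / 4) (fun a => F (s a))
    (fun a => f (H (s a))) K.
  rewrite (F1 _ sK) mulr1; apply.
  - have := (measurableT_comp mf mG); congr measurable_fun; apply/funext => u /=.
    by rewrite p2c_ReIm.
  - by move=> u; exact: fH.
  - by rewrite F0// /s mul0r.
  - by move=> a; apply: Fm.
  - move=> a u aK au ua; apply: fHH.
    have u0 : 0 < u by exact: le_lt_trans au.
    have u1 : u <= 1 by rewrite (le_trans ua).
    have g1 : s a <= q u by apply: q_ge => //; rewrite /A/= lt_min au (lt_le_trans au).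
    have g2 : q u <= s a.+1.
      apply: q_le => // y; rewrite /A/= lt_min => /andP[yu _].
      by rewrite leNgt; apply/negP => /ltW/Fm; rewrite leNgt (lt_le_trans yu).
    by rewrite ger0_norm ?subr_ge0// lerBlDl -sS.
have h2 : `|(\sum_(i < N.+1) f (z_ i)) / N.+1%:R - S2| <= e / 4.
  have -> : S2 = (\sum_(i < N.+1) \sum_(a < K)
      f (H (s a)) * ((x i < s a.+1)%R%:R - (x i < s a)%R%:R)) / N.+1%:R.
    rewrite exchange_big/= mulr_suml; apply: eq_bigr => a _.
    by rewrite -mulr_sumr -mulrA -mulrBl sumrB.
  rewrite -mulrBl -sumrB normrM normfV (ger0_norm (ler0n R N.+1)) ler_pdivrMr ?ltr0n//.
  rewrite (le_trans (ler_norm_sum _ _ _))//.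
  rewrite -[X in _ <= _ * X%:R]card_ord mulr_natr -sumr_const ler_sum// => i _.
  have [/andP[xi0 xi1] <-] := Hx i.
  apply: (@step_sum R (fun t => f (H t))) => //.
  - by rewrite /s mul0r.
  - exact: le_lt_trans sK.
  - move=> a aK sx xs; apply: fHH.
    by rewrite ger0_norm ?subr_ge0// lerBlDl -sS ltW.
have h3 : `|S1 - S2| <= e / 4.
  rewrite -sumrB (le_trans (ler_norm_sum _ _ _))//.
  have -> : e / 4 = \sum_(a < K) (B' + 1) * (2 * e2).
    rewrite sumr_const card_ord -mulr_natr /e2.
    by field; rewrite !gt_eqF ?ltr_wpDl.
  apply: ler_sum => a _; rewrite -mulrBr normrM ler_pM//.
    by rewrite (le_trans (fH _))// lerDl.
  have Ha b : (b < K.+1)%N -> `|FN N (s b) - F (s b)| < e2.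
    by move=> bK; apply: HN; apply/mapP; exists b => //; rewrite mem_iota.
  have := Ha a.+1 (ltn_ord a); have := Ha a (ltnW (ltn_ord a)).
  by rewrite !ltr_norml ler_norml => /andP[? ?] /andP[? ?]; apply/andP; split; lra.
move: h2; set V := _ / _; clearbody V I S1 S2 => h2.
move: h1 h2 h3; clear -e0; rewrite !ler_norml => /andP[? ?] /andP[? ?] /andP[? ?].
by apply/andP; split; lra.
Qed.

End WeakLimit.

(** * Polynomials of small sup norm *)

Section FeketeSzego.
Variable R : realType.
Implicit Types (z w : C R) (c d e : R).
Variable E : set (C R).
Hypotheses (cE : compact E) (E0 : E !=set0).

(** The double average is compared with [edl nu d] by using the weak limit twice with the same N: on
    all the functions lnt d |z_i - v| of v at once, by uniformity, and then on [potd nu d]. *)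
Lemma edl_le_weak (z_ : nat -> C R) c : (forall i, E (z_ i)) ->
  (forall d e N0, 0 < d -> 0 < e -> exists2 N1, (N0 <= N1)%N & forall N, (N1 <= N)%N ->
     - c - e <= (\sum_(i < N.+1) \sum_(j < N.+1) lnt d (cabs (z_ i - z_ j)))
                / N.+1%:R / N.+1%:R) ->
  (min_energy E <= c%:E)%E.
Proof.
move=> zE Hc; have [nu [nuE Hnu]] := weak_limit cE zE.
have [M EM] := compactC_bounded cE.
apply: (@le_trans _ _ (energy nu)).
  by apply: ereal_inf_lbound; exists nu => //; exact: nuE.2.
apply: (energy_le cE nuE) => d d0; rewrite lerNl leNgt; apply/negP; rewrite -subr_gt0 => h.
(* A quarter of the gap: two passages to the limit and the slack in the hypothesis cost one [e]
   each. *)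
pose e := (- c - edl nu d) / 4; have e0 : 0 < e by rewrite divr_gt0.
have [N1 _ HN1] := Hc d e 0%N d0 e0.
pose B := `|ln d| + d^-1 * (2 * M).
have M0 : 0 <= M by case: E0 => z /EM; exact/le_trans/cabs_ge0.
have B0 : 0 <= B by rewrite addr_ge0// mulr_ge0 ?invr_ge0 ?mulr_ge0// ltW.
have TB z w : E z -> E w -> `|lnt d (cabs (z - w))| <= B.
  move=> /EM zM /EM wM; have := lnt_lipschitz (cabs (z - w)) 0 d0.
  rewrite subr0 (ger0_norm (cabs_ge0 _)) {2}/lnt max_r ?(ltW d0)// => h1.
  have := cabsD z (- w); rewrite cabsN => h2.
  have : d^-1 * cabs (z - w) <= d^-1 * (2 * M) by rewrite ler_wpM2l ?invr_ge0 ?(ltW d0)//; lra.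
  move: h1; rewrite /B => h1 h3; have := ler_norm (ln d); have := ler_norm (- ln d).
  by rewrite normrN; move: h1; rewrite !ler_norml => /andP[? ?] ? ?; apply/andP; split; lra.
have d1 : 0 <= d^-1 by rewrite invr_ge0 ltW.
have [N [NN1 HN]] := Hnu d^-1 B e N1 d1 B0 e0.
have := HN1 _ NN1; rewrite leNgt => /negP; apply.
have hp : `|(\sum_(i < N.+1) potd nu d (z_ i)) / N.+1%:R - edl nu d| <= e.
  apply: HN; first by move=> z w; exact: (potd_lipschitz cE nuE).
  apply: (norm_pint nuE); first exact: tame_lnt.
  by move=> w Ew; exact: TB.
have hi (i : 'I_N.+1) : (\sum_(j < N.+1) lnt d (cabs (z_ i - z_ j))) / N.+1%:R <=
    potd nu d (z_ i) + e.
  have lip v w : `|lnt d (cabs (z_ i - v)) - lnt d (cabs (z_ i - w))| <= d^-1 * cabs (v - w).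
    by rewrite (le_trans (lntB_lipschitz _ _ _ _ d0))// subrr cabs0 add0r.
  have := HN _ lip (TB _ _ (zE _) (zE _)).
  by rewrite ler_norml => /andP[_]; rewrite /potd lerBlDl.
have N0 : 0 < N.+1%:R :> R by rewrite ltr0n.
have : (\sum_(i < N.+1) \sum_(j < N.+1) lnt d (cabs (z_ i - z_ j))) / N.+1%:R <=
    \sum_(i < N.+1) (potd nu d (z_ i) + e).
  by rewrite mulr_suml; apply: ler_sum => i _; exact: hi.
rewrite big_split/= sumr_const card_ord -(mulr_natr e) => h1.
have : (\sum_(i < N.+1) \sum_(j < N.+1) lnt d (cabs (z_ i - z_ j))) / N.+1%:R / N.+1%:R <=
   (\sum_(i < N.+1) potd nu d (z_ i)) / N.+1%:R + e.
  rewrite ler_pdivrMr// mulrDl divfK ?gt_eqF//.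
have e4 : edl nu d = - c - 4 * e by rewrite /e; lra.
have fin (A P D : R) : `|P - D| <= e -> D = - c - 4 * e -> A <= P + e -> A < - c - e.
  by clearbody e; move: e0; clear; rewrite ler_norml => ? /andP[? ?] ? ?; lra.
exact: (fin _ _ _ hp e4).
Qed.

Lemma sum_sym_ordS (f : nat -> nat -> R) N : (forall i j, f i j = f j i) ->
  \sum_(i < N.+1) \sum_(j < N.+1) f i j =
  \sum_(i < N) \sum_(j < N) f i j + 2 * (\sum_(i < N) f N i) + f N N.
Proof.
move=> fs; rewrite big_ord_recr/= [in X in _ + X]big_ord_recr/=.
under eq_bigr do rewrite big_ord_recr/=.
rewrite big_split/=.
have -> : \sum_(i < N) f i N = \sum_(i < N) f N i by apply: eq_bigr => i _; rewrite fs.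
ring.
Qed.

Theorem fekete_szego c : (c%:E < min_energy E)%E -> forall k0, exists2 k, (k0 <= k)%N &
  exists s : seq (C R), [/\ size s = k, (forall w, w \in s -> E w) &
    forall z, E z -> \prod_(w <- s) cabs (z - w) <= expR (- c * k%:R)].
Proof.
move=> cmin k0; apply: contrapT => nex; move: cmin; rewrite ltNge => /negP; apply.
(* When the conclusion fails, the product over at least k0 points of [E] exceeds the bound somewhere
   on [E], and such a place becomes the next point. For shorter lists any point of [E] will do. *)
have ex (s : seq (C R)) : exists z, E z /\ ((k0 <= size s)%N ->
    (forall w, w \in s -> E w) -> expR (- c * (size s)%:R) < \prod_(w <- s) cabs (z - w)).
  have [[ks sE]|nks] := pselect ((k0 <= size s)%N /\ forall w, w \in s -> E w); last first.
    by case: E0 => z Ez; exists z; split=> // h1 h2; exfalso; apply: nks.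
  apply: contrapT => nz; apply: nex; exists (size s) => //; exists s; split => // z Ez.
  by rewrite leNgt; apply/negP => h; apply: nz; exists z; split.
pose nxt s := sval (cid (ex s)).
have nxtP s := svalP (cid (ex s)).
pose fix zl k : seq (C R) := if k is k'.+1 then rcons (zl k') (nxt (zl k')) else [::].
pose z_ k := nxt (zl k).
have zE i : E (z_ i) by case: (nxtP (zl i)).
have zlE k : zl k = [seq z_ i | i <- index_iota 0 k].
  rewrite /index_iota subn0; by elim: k => // k IH; rewrite -[k.+1]addn1 iotaD map_cat/= cats1 -IH addn1.
have zk k : (k0 <= k)%N -> (forall i : 'I_k, 0 < cabs (z_ k - z_ i)) /\
    - c * k%:R <= \sum_(i < k) ln (cabs (z_ k - z_ i)).
  move=> kk; have sz : size (zl k) = k by rewrite zlE size_map /index_iota size_iota subn0.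
  have H : (k0 <= size (zl k))%N -> (forall w, w \in zl k -> E w) ->
      expR (- c * (size (zl k))%:R) < \prod_(w <- zl k) cabs (z_ k - w) := (nxtP (zl k)).2.
  rewrite sz in H; have {H} : expR (- c * k%:R) < \prod_(w <- zl k) cabs (z_ k - w).
    by apply: (H kk) => w; rewrite zlE => /mapP[i _ ->].
  rewrite zlE big_map big_mkord => H.
  have p0 (i : 'I_k) : 0 < cabs (z_ k - z_ i).
    rewrite lt_neqAle cabs_ge0 andbT; apply/negP => /eqP ci.
    by move: H; rewrite (bigD1 i)//= -ci mul0r ltNge expR_ge0.
  split => //; rewrite -ln_prod//.
  by rewrite -ler_expR lnK ?posrE ?prodr_gt0// ltW.
apply: (@edl_le_weak z_) => // d e N0 d0 e0.
pose T i j := lnt d (cabs (z_ i - z_ j)).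
pose S N := \sum_(i < N) \sum_(j < N) T i j.
have SS N : (k0 <= N)%N -> S N + 2 * (- c * N%:R) + ln d <= S N.+1.
  move=> kN; rewrite /S (@sum_sym_ordS T); last by move=> i j; rewrite /T cabsBC.
  apply: lerD; last by rewrite /T subrr cabs0 /lnt max_r// ltW.
  have [p0 sN] := zk _ kN.
  by rewrite lerD2l ler_wpM2l// (le_trans sN)//; apply: ler_sum => i _; exact: lnt_ge_ln.
(* The off-diagonal lower bounds sum to -c N (N - 1) and the diagonal to N ln d; after correcting
   for both, the sequence is nondecreasing. *)
pose g N := S N + c * (N%:R * (N%:R - 1)) - N%:R * ln d.
have gm N : (k0 <= N)%N -> g k0 <= g N.
  elim: N => [|N IH]; first by rewrite leqn0 => /eqP ->.
  rewrite leq_eqVlt => /predU1P[->//|]; rewrite ltnS => kN; apply: le_trans (IH kN) _.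
  by have := SS _ kN; rewrite /g -natr1; lra.
have [N1 HN1] : exists N1, (`|g k0| + `|c + ln d|) / e < N1%:R.
  by exists (Num.bound ((`|g k0| + `|c + ln d|) / e)); apply: archi_boundP;
    rewrite divr_ge0 ?addr_ge0// ltW.
exists (maxn N0 (maxn k0 N1)); first exact: leq_maxl.
move=> N; rewrite !geq_max => /and3P[_ kN NN1].
rewrite -/(S N.+1); set n : R := N.+1%:R.
have n1 : 1 <= n by rewrite ler1n.
have n0 : 0 < n by rewrite ltr0n.
rewrite !ler_pdivlMr//; have := gm N.+1 (leqW kN); rewrite /g -/n => h1.
have h2 : `|g k0| + `|c + ln d| < e * n.
  rewrite mulrC -ltr_pdivrMr//; apply: lt_le_trans HN1 _.
  by rewrite ler_nat (leq_trans NN1).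
have h3 := ler_norm (- g k0); rewrite normrN in h3.
have h4 := ler_norm (- (c + ln d)); rewrite normrN in h4.
have h5 : 0 <= `|g k0| by [].
have h6 : 0 <= `|c + ln d| by [].
have h7 : - (c + ln d) * n <= `|c + ln d| * n by rewrite ler_wpM2r// ltW.
have h8 : `|g k0| <= `|g k0| * n by rewrite ler_peMr.
have h9 : (`|g k0| + `|c + ln d|) * n <= e * n * n by rewrite ler_wpM2r ?(ltW n0)// ltW.
rewrite /g in h3 h5 h8; lra.
Qed.

End FeketeSzego.

(** * The equilibrium measure *)

Section Reweight.
Variable R : realType.
Implicit Types (z w : C R) (c d e t : R).
Variables (mu : probability (R * R)%type R) (E : set (C R)).
Hypotheses (cE : compact E) (muE : carried mu E).

Lemma tame_indicM (B : set (C R)) f : measurable (@p2c R @^-1` B) -> tame E f ->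
  tame E (fun z => \1_B z * f z).
Proof. by move=> mB tf; apply: tameM => //; exact: tame_indic. Qed.


Lemma integral_mrestr (D : set (R * R)) (mD : measurable D) (f : R * R -> \bar R) :
  measurable_fun setT f -> (forall p, (0 <= f p)%E) ->
  (\int[mrestr mu mD]_p f p = \int[mu]_(p in D) f p)%E.
Proof.
move=> mf f0; rewrite (@ge0_negligible_integral _ _ _ (mrestr mu mD) setT (~` D))//.
- rewrite setDE setCK setTI; apply: eq_measure_integral => A mA AD /=.
  by rewrite /mrestr setIidl.
- exact: measurableC.
- by rewrite /= /mrestr setICl measure0.
Qed.

(** The new measure has density (1 - t 1_B) / (1 - t b), written as a nonnegative combination of
    [mu] and its restriction to the complement of [B]. It is the competitor used to vary the
    equilibrium measure. *)
Lemma reweight (B : set (C R)) t : measurable (@p2c R @^-1` B) -> 0 < t -> t < 1 ->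
  let b := fine (mu (@p2c R @^-1` B)) in
  exists nu : probability (R * R)%type R, carried nu E /\
    forall f, tame E f ->
      (1 - t * b) * pint nu f = pint mu f - t * pint mu (fun z => \1_B z * f z).
Proof.
move=> mB t0 t1 b.
have b0 : 0 <= b by exact: fine_ge0.
have b1 : b <= 1.
  rewrite -lee_fin /b fineK; first exact: probability_le1.
  by rewrite ge0_fin_numE// (le_lt_trans (probability_le1 _ _))// ltry.
have bE : mu (@p2c R @^-1` B) = b%:E.
  by rewrite /b fineK// ge0_fin_numE// (le_lt_trans (probability_le1 _ _))// ltry.
have tb : 0 < 1 - t * b by rewrite subr_gt0 (le_lt_trans _ t1)// ler_piMr// ltW.
have a0 : 0 <= (1 - t) / (1 - t * b) by apply: divr_ge0 (ltW tb); rewrite subr_ge0 ltW.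
have be0 : 0 <= t / (1 - t * b) by exact: divr_ge0 (ltW t0) (ltW tb).
pose al := NngNum a0; pose be := NngNum be0.
have mBc : measurable (~` (@p2c R @^-1` B)) by exact: measurableC.
pose m : {measure set (R * R)%type -> \bar R} :=
  measure_add (mscale al mu) (mscale be (mrestr mu mBc)).
have mE A : m A = (al%:num%:E * mu A + be%:num%:E * mu (A `&` ~` (@p2c R @^-1` B)))%E.
  by rewrite [LHS]measure_addE.
have m1 : m setT = 1%E.
  rewrite mE setTI probability_setC// probability_setT bE /al /be/=.
  rewrite -EFinB -!EFinM -EFinD; congr EFin; field; exact: lt0r_neq0.
pose nu : probability (R * R)%type R := mnormalize m mu.
have nuE A : nu A = m A.
  by rewrite /nu/= /mnormalize m1 onee_eq0/= invr1 mule1.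
have nuc : carried nu E.
  split; first exact: muE.1.
  have mE' : measurable (@p2c R @^-1` (~` E)) by apply: measurable_open; apply: closed_openC; exact: muE.1.
  rewrite nuE mE muE.2 mule0 add0e (_ : mu _ = 0%E) ?mule0//.
  apply/eqP; rewrite eq_le measure_ge0 andbT -muE.2 le_measure// inE//.
  exact: measurableI.
have pos f : tame E f -> (forall z, 0 <= f z) ->
    (1 - t * b) * pint nu f = pint mu f - t * pint mu (fun z => \1_B z * f z).
  move=> tf f0; have mf : measurable_fun setT (fun p => (f (p2c p))%:E).
    by apply/measurable_EFinP; exact: tf.1.
  have ff p : (0 <= (f (p2c p))%:E)%E by rewrite lee_fin.
  have -> : pint nu f = (1 - t) / (1 - t * b) * pint mu f +
      t / (1 - t * b) * pint mu (fun z => \1_(~` B) z * f z).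
    apply: EFin_inj; rewrite -(EFin_pint nuc)// EFinD.
    rewrite (EFinM _ (pint mu f)) (EFinM _ (pint mu _)) -!(EFin_pint muE)//; last first.
      by apply: tame_indicM => //; rewrite preimage_setC.
    transitivity (\int[m]_p (f (p2c p))%:E)%E; first by apply: eq_measure_integral => A _ _; exact: nuE.
    rewrite /m ge0_integral_measure_add// !ge0_integral_mscale//; congr (_ + _ * _)%E.
    rewrite integral_mrestr// integral_mkcond; apply: eq_integral => p _.
    rewrite patchE indicE; rewrite (_ : p \in _ = (p2c p \in ~` B)).
      by case: ifP; rewrite ?mul1r ?mul0r.
    by apply/idP/idP; rewrite !inE.
  have -> : pint mu (fun z => \1_(~` B) z * f z) = pint mu f - pint mu (fun z => \1_B z * f z).
    rewrite -(pintB muE)//; last exact: tame_indicM.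
    congr pint; apply/funext => z; rewrite !indicE in_setC.
    by case: (z \in B); rewrite /= ?mul0r ?mul1r ?subrr ?subr0.
  by field; exact: lt0r_neq0.
exists nu; split=> // f tf; have [M fM] := tf.2.
(* A shift reduces the formula to nonnegative functions; the maximum with 0 takes care of the points
   off [E]. *)
pose f1 z := Num.max 0 (f z + M).
have tf1 : tame E f1.
  split; first by apply: measurable_maxr => //; apply: measurable_funD => //; exact: tf.1.
  exists (`|M| + `|M|) => z Ez; rewrite ger0_norm /f1 ?le_max ?lexx// ge_max addr_ge0//=.
  by rewrite lerD// (le_trans (ler_norm _))// ?(le_trans (fM _ Ez))// ler_norm.
have fE z : E z -> f z = f1 z - M.
  move=> Ez; rewrite /f1 max_r ?addrK//.
  by have := fM _ Ez; rewrite ler_norml -subr_ge0 opprK => /andP[].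
have tfM : tame E (fun z => f1 z - M) by apply: tameB => //; exact: tame_cst.
have tBM : tame E (fun z => \1_B z * f1 z - \1_B z * M).
  apply: tameB; first exact: tame_indicM.
  by apply: tame_indicM => //; exact: tame_cst.
rewrite (eq_pint nuc tf tfM)// (eq_pint muE tf tfM)//.
rewrite (eq_pint muE (tame_indicM mB tf) tBM); last first.
  by move=> z Ez; rewrite -mulrBr fE.
rewrite (pintB nuc)//; last exact: tame_cst.
rewrite !(pintB muE)//; [|exact: tame_indicM|by apply: tame_indicM => //; exact: tame_cst|exact: tame_cst].
rewrite !pint_cst mulrBr pos//; last by move=> z; rewrite /f1 le_max lexx.
rewrite (_ : (fun z => \1_B z * M) = (fun z => M * \1_B z)); last by apply/funext => z; rewrite mulrC.
rewrite (pintZ muE)//; last exact: tame_indic.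
by rewrite pint_indic// -/b; ring.
Qed.

(** Symmetry of the truncated kernel; it identifies the two cross terms in the energy of a
    reweighted measure. *)
Lemma pint_swap_indic (B : set (C R)) d : measurable (@p2c R @^-1` B) -> 0 < d ->
  pint mu (fun z => pint mu (fun w => \1_B w * lnt d (cabs (z - w)))) =
  pint mu (fun w => \1_B w * potd mu d w).
Proof.
move=> mB d0.
(* The truncated logarithm is at least ln d, so subtracting ln d allows Tonelli's theorem. *)
pose k z w := lnt d (cabs (z - w)) - ln d.
have k0 z w : 0 <= k z w.
  by rewrite subr_ge0 /lnt ler_ln_pos// le_max lexx orbT.
have tl z : tame E (fun w => lnt d (cabs (z - w))) by exact: tame_lnt.
have tk z : tame E (k z) by apply: tameB; [exact: tl|exact: tame_cst].
have tBk z : tame E (fun w => \1_B w * k z w) by exact: tame_indicM.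
have kC z w : k z w = k w z by rewrite /k cabsBC.
pose b := pint mu (fun z => \1_B z).
have t1 : tame E (fun z => \1_B z) by exact: tame_indic.
have pk z : pint mu (k z) = potd mu d z - ln d.
  by rewrite /k (pintB muE (tl z) (tame_cst _ _)) pint_cst.
have tp : tame E (potd mu d) by exact: tame_potd.
have pBk z : pint mu (fun w => \1_B w * k z w) =
    pint mu (fun w => \1_B w * lnt d (cabs (z - w))) - ln d * b.
  rewrite -(pintZ muE)// -(pintB muE)//.
  - by congr pint; apply/funext => w; rewrite mulrBr [in RHS](mulrC (ln d)).
  - exact: tame_indicM.
  - by apply: tameM => //; exact: tame_cst.
pose f (x : (R * R) * (R * R)) : \bar R := (\1_B (p2c x.2) * k (p2c x.1) (p2c x.2))%:E.
have mf : measurable_fun setT f.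
  apply/measurable_EFinP; apply: measurable_funM.
    have h1 := t1.1; exact: (measurableT_comp h1 measurable_snd).
  rewrite /k /lnt; apply: measurable_funB; last exact: measurable_cst.
  apply: measurableT_comp; first exact: measurable_ln.
  apply: measurable_maxr; last exact: measurable_cst.
  apply: measurable_cabs_fun => /=.
    apply: measurable_funB; first exact: (measurableT_comp measurable_fst measurable_fst).
    exact: (measurableT_comp measurable_fst measurable_snd).
  apply: measurable_funB; first exact: (measurableT_comp measurable_snd measurable_fst).
  exact: (measurableT_comp measurable_snd measurable_snd).
have f0 x : (0 <= f x)%E by rewrite lee_fin mulr_ge0// indicE.
have := fubini_tonelli (m1 := mu) (m2 := mu) f mf f0; rewrite /f/=.
under eq_integral do rewrite (EFin_pint muE (tBk _)).
under [RHS]eq_integral => y _.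
  rewrite (_ : (fun x => _) = (fun x => (\1_B (p2c y) * k (p2c y) (p2c x))%:E)); last first.
    by apply/funext => x; rewrite kC.
  rewrite (EFin_pint muE (f := fun z => \1_B (p2c y) * k (p2c y) z)); last first.
    by apply: tameM => //; exact: tame_cst.
  rewrite (pintZ muE)// pk.
  over.
move=> /(congr1 fine); rewrite -[LHS]/(pint mu (fun z => pint mu (fun w => \1_B w * k z w))).
rewrite -[RHS]/(pint mu (fun w => \1_B w * (potd mu d w - ln d))).
rewrite (_ : (fun w => \1_B w * (potd mu d w - ln d)) =
    (fun w => \1_B w * potd mu d w - ln d * \1_B w)); last first.
  by apply/funext => w; rewrite mulrBr (mulrC (ln d)).
rewrite (pintB muE); [|exact: tame_indicM|by apply: tameM => //; exact: tame_cst].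
rewrite (pintZ muE)// -/b.
rewrite (_ : (fun z => pint mu (fun w => \1_B w * k z w)) =
  (fun z => pint mu (fun w => \1_B w * lnt d (cabs (z - w))) - ln d * b)); last exact/funext.
rewrite (pintB muE); last exact: tame_cst.
  by rewrite pint_cst => /addIr.
apply: tame_continuous => //.
apply: (@lipschitz_continuousC _ _ d^-1) => z w.
rewrite -(pintB muE); [|exact: tame_indicM|exact: tame_indicM].
apply: (norm_pint muE) => [|v Ev]; first by apply: tameB; exact: tame_indicM.
rewrite -mulrBr normrM indicE.
case: (v \in B); rewrite ?mul0r ?normr0 ?mul0r ?normr1 ?mul1r; last first.
  by rewrite mulr_ge0 ?cabs_ge0// invr_ge0 ltW.
by have := lntB_lipschitz z w v v d0; rewrite subrr cabs0 addr0.
Qed.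

End Reweight.

(** * Bernstein-Walsh inequality and positivity of the capacity *)

Section Equilibrium.
Variable R : realType.
Implicit Types (z w : C R) (r c d e M : R) (s : seq (C R)).
Variables (E : set (C R)) (g : C R -> R).
Hypotheses (cE : compact E) (E0 : E !=set0) (gE : continuous_green E g).
Local Notation Om := (Omega E).

Lemma prod_cabs_continuous s : continuous (fun z => \prod_(w <- s) cabs (z - w)).
Proof.
elim: s => [|w s IH].
  by under eq_fun do rewrite big_nil; move=> z; exact: cst_continuous.
under eq_fun do rewrite big_cons.
have cw : continuous (fun z => cabs (z - w)); last first.
  by move=> z; exact: (continuousM (cw z) (IH z)).
apply: (@lipschitz_continuousC _ _ 1) => x y; rewrite mul1r.
by rewrite (le_trans (cabs_dist _ _))// (_ : x - w - (y - w) = x - y)//; ring.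
Qed.

Lemma ln_prod_cabs s z : (forall w, w \in s -> z != w) ->
  ln (\prod_(w <- s) cabs (z - w)) = \sum_(w <- s) ln (cabs (z - w)) /\
  0 < \prod_(w <- s) cabs (z - w).
Proof.
elim: s => [|w s IH] sz; first by rewrite !big_nil ln1.
have zw : 0 < cabs (z - w) by rewrite cabs_gt0// subr_eq0 sz ?mem_head.
have [|IH1 IH2] := IH; first by move=> x xs; rewrite sz// inE xs orbT.
by rewrite !big_cons lnM_pos// IH1 mulr_gt0.
Qed.

Lemma circle_cont_ln w r : cabs w < r -> circle_cont (fun x => ln (cabs (x - w))) 0 r.
Proof.
move=> wr x; rewrite subr0 => xr; apply/hm_cont/hm_ln; apply: contraTneq wr => <-.
by rewrite xr ltxx.
Qed.

(** The difference of the two sides is harmonic on Omega because the roots lie in [E]. Its boundary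
    values are at most 0, as boundary points belong to [E] and g >= 0, and at infinity the terms k
    ln |z| cancel. *)
Lemma bernstein_walsh s c : (forall w, w \in s -> E w) ->
  (forall z, E z -> \prod_(w <- s) cabs (z - w) <= expR (- c * (size s)%:R)) ->
  forall z, Om z -> \sum_(w <- s) ln (cabs (z - w)) + c * (size s)%:R <= (size s)%:R * g z.
Proof.
move=> sE sc; set k := size s in sc *.
have sO z w : Om z -> w \in s -> z != w.
  by move=> /Omega_notin Oz /sE Ew; apply: contra_notN Oz => /eqP ->.
pose h z := \sum_(w <- s) ln (cabs (z - w)) + c * k%:R + - (k%:R * g z).
suff H z : Om z -> h z <= 0 by move=> z /H; rewrite /h; lra.
move: z; apply: (Omega_max_principle gE).
- move=> z Oz; apply: hm_shm; apply: hmD; last by apply/hmN/hmZ; exact: green_hm Oz.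
  apply: hmD; last exact: hm_cst.
  rewrite (_ : (fun w => _) =
      (fun z => \sum_(i < size s) ln (cabs (z - (s`_i : C R))))).
    apply: hm_sum => i; apply: hm_ln; apply: sO => //; exact: mem_nth.
  by apply/funext => x; rewrite (big_nth 0) big_mkord.
- move=> z clz Oz e e0; have Ez := Omega_boundary (compactC_closed cE) clz Oz.
  have /continuousCP := @prod_cabs_continuous s z.
  have ee : 0 < expR (- c * k%:R + e) - expR (- c * k%:R).
    by rewrite subr_gt0 ltr_expR ltrDl.
  move=> /(_ _ ee)[d d0 Hd]; exists d => // w Ow /Hd.
  have [w1 w0] := @ln_prod_cabs s w (fun x => @sO w x Ow).
  move=> /ltr_normlW h1; have : \prod_(x <- s) cabs (w - x) < expR (- c * k%:R + e).
    by have := sc _ Ez; lra.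
  rewrite -[X in X < _]lnK ?posrE// ltr_expR w1 /h => h2.
  have : 0 <= k%:R * g w by rewrite mulr_ge0// (green_ge0 gE Ow).
  lra.
have [M EM] := compactC_bounded cE; have [B [r0 gB]] := green_growth gE.
exists (k%:R * (ln 2 + c + B)), (Num.max (Num.max r0 1) M) => z Oz.
rewrite !gt_max => /andP[/andP[zr z1] zM].
have z0 : 0 < cabs z := lt_trans ltr01 z1.
have h1 : \sum_(w <- s) ln (cabs (z - w)) <= \sum_(w <- s) (ln 2 + ln (cabs z)).
  rewrite !big_seq; apply: ler_sum => w ws; rewrite -lnM_pos// ler_ln_pos//.
    by rewrite cabs_gt0// subr_eq0 sO.
  by rewrite (le_trans (cabsD _ _))// cabsN; have := EM _ (sE _ ws); lra.
move: h1; rewrite big_const_seq count_predT iter_addr_0 -mulr_natr -/k => h1.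
have := gB _ zr; rewrite ler_norml => /andP[h2 _].
have : 0 <= k%:R * (g z - ln (cabs z) + B) by rewrite mulr_ge0//; lra.
by rewrite /h; lra.
Qed.

Lemma far_point : exists2 z, Om z & forall w, E w -> 1 <= cabs (z - w).
Proof.
have [M EM] := compactC_bounded cE.
have M0 : 0 <= M by case: E0 => w /EM; exact/le_trans/cabs_ge0.
exists (Complex (M + 1) 0 : C R).
  apply: (Omega_far EM); rewrite cabs_real ger0_norm; lra.
move=> w /EM wM; have := cabsB_ge (Complex (M + 1) 0 : C R) w.
by rewrite cabs_real ger0_norm; lra.
Qed.

(** A regular set is not polar: with infinite minimal energy, polynomials of arbitrarily fast decay
    on [E] would violate Bernstein-Walsh at a point at distance at least 1 from [E]. *)
Lemma min_energy_lty : (min_energy E < +oo)%E.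
Proof.
rewrite ltNge leye_eq; apply/eqP => Eoo.
have [z Oz zE] := far_point.
have [k k1 [s [sk sE sc]]] := @fekete_szego _ _ cE E0 (g z + 1) ltac:(by rewrite Eoo ltry) 1%N.
rewrite -sk in k1 sc; have := bernstein_walsh sE sc Oz.
have : 0 <= \sum_(w <- s) ln (cabs (z - w)).
  by rewrite big_seq; apply: sumr_ge0 => w /sE /zE; exact: ln_ge0.
have : 1 <= (size s)%:R :> R by rewrite ler1n.
by rewrite mulrDl mul1r mulrC; lra.
Qed.

Lemma carriedP mu : carried mu E <-> supported_on E mu.
Proof. by split=> [[]//|]; split=> //; exact: compactC_closed. Qed.

Lemma lnt_bounded : exists2 L, 0 <= L & forall d z w, 0 < d -> d <= 1 -> E z -> E w ->
  lnt d (cabs (z - w)) <= L.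
Proof.
have [M EM] := compactC_bounded cE.
exists (ln (Num.max 1 (2 * M))); first by rewrite ln_ge0// le_max lexx.
move=> d z w d0 d1 /EM zM /EM wM; rewrite /lnt ler_ln_pos ?lnt_max_gt0//.
rewrite ge_max !le_max d1 andbT; apply/orP; right.
by rewrite (le_trans (cabsD _ _))// cabsN; lra.
Qed.

Lemma min_energy_gtNy : (-oo < min_energy E)%E.
Proof.
have [L L0 HL] := lnt_bounded.
apply: (@lt_le_trans _ _ (- L)%:E); first exact: ltNyr.
apply: le_ereal_inf_tmp => _ [nu /carriedP nuE <-].
apply: le_trans (energy_ge cE nuE (ltr01)); rewrite lee_fin lerN2.
rewrite -[leRHS](pint_cst nu); apply: (le_pint nuE).
- exact: tame_potd.
- exact: tame_cst.
move=> z Ez; rewrite -[leRHS](pint_cst nu); apply: (le_pint nuE).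
- exact: tame_lnt.
- exact: tame_cst.
by move=> w Ew; exact: HL.
Qed.

(** Finiteness on both sides rules out the default value 0 of [cap]. *)
Lemma cap_energy : exists2 e, cap E = expR e & min_energy E = (- e)%:E.
Proof.
have := min_energy_lty; have := min_energy_gtNy; rewrite /cap.
case: min_energy => // v _ _; exists (- v) => //; by rewrite opprK.
Qed.

Lemma cap_gt0 : 0 < cap E.
Proof. by have [e -> _] := cap_energy; exact: expR_gt0. Qed.

Lemma min_energy_ln_cap : min_energy E = (- ln (cap E))%:E.
Proof. by have [e -> ->] := cap_energy; rewrite expRK. Qed.

Lemma energy_lower_bound nu c : carried nu E -> (forall d, 0 < d -> c <= edl nu d) ->
  c <= ln (cap E).
Proof.
move=> nuE Hc; rewrite -lerN2 -lee_fin -min_energy_ln_cap.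
apply: (@le_trans _ _ (energy nu)).
  by apply: ereal_inf_lbound; exists nu => //; exact: nuE.2.
by apply: (energy_le cE nuE) => d d0; rewrite lerN2 Hc.
Qed.

End Equilibrium.

Section OpenSets.
Variable R : realType.
Implicit Types (z w : C R) (r : R).

Lemma open_sublevel (u : C R -> R) r : continuous u -> open [set z | u z < r].
Proof.
move=> cu; apply/openCP => z /= uz; have /continuousCP := cu z.
move=> /(_ (r - u z)); rewrite subr_gt0 => /(_ uz)[d d0 Hd]; exists d => // w /Hd.
by move=> /ltr_normlW; rewrite ltrD2r.
Qed.

Lemma open_cball z r : open [set w : C R | cabs (w - z) < r].
Proof.
apply/openCP => w /= wz; exists (r - cabs (w - z)); first by rewrite subr_gt0.
by move=> v; exact: ball_shift.
Qed.

Lemma measurable_cball z r : measurable (@p2c R @^-1` [set w : C R | cabs (w - z) < r]).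
Proof. by apply: measurable_open; exact: open_cball. Qed.

End OpenSets.

(** * Variation of the equilibrium measure *)

Section Frostman.
Variable R : realType.
Implicit Types (z w : C R) (r c d : R) (s : seq (C R)).
Variables (E : set (C R)) (g : C R -> R) (mu : probability (R * R)%type R).
Hypotheses (cE : compact E) (gE : continuous_green E g) (muq : is_equilibrium E mu).
Local Notation Om := (Omega E).
Local Notation e := (ln (cap E)).

Lemma equilibrium_carried : carried mu E.
Proof. by split; [exact: compactC_closed|exact: muq.1]. Qed.
Local Notation muE := equilibrium_carried.

Lemma equilibrium_neq0 : E !=set0.
Proof. exact: carried_neq0 muE. Qed.
Local Notation E0 := equilibrium_neq0.

Lemma edl_equilibrium d : 0 < d -> e <= edl mu d.
Proof.
move=> d0; have := energy_ge cE muE d0.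
by rewrite muq.2 (min_energy_ln_cap cE E0 gE) lee_fin lerN2.
Qed.

Lemma le_edl nu d d' : carried nu E -> 0 < d -> d <= d' -> edl nu d <= edl nu d'.
Proof.
move=> nuE d0 dd'; have d'0 := lt_le_trans d0 dd'.
apply: (le_pint nuE); [exact: tame_potd|exact: tame_potd|].
by move=> z _; exact: (le_potd cE nuE).
Qed.

(** If the set [B] had mass b > 0, moving a little mass away from it would raise the truncated
    energies by about 2 t b eta, which beats the terms of order t^2 and contradicts the maximality
    of e. *)
Lemma frostman_null d eta : 0 < d -> 0 < eta ->
  mu (@p2c R @^-1` [set z | potd mu d z < e - eta]) = 0%E.
Proof.
move=> d0 eta0; set B := [set z | _].
have mB : measurable (@p2c R @^-1` B).
  by apply: measurable_open; apply: open_sublevel; have cp := continuous_potd cE muE d0; exact: cp.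
have muB1 : (mu (@p2c R @^-1` B) < +oo)%E.
  by rewrite (le_lt_trans (probability_le1 _ _))// ltry.
pose b := fine (mu (@p2c R @^-1` B)).
have b0 : 0 <= b by exact: fine_ge0.
suff : b = 0 by rewrite /b => b0'; rewrite -(fineK (x := mu _)) ?b0'// ge0_fin_numE.
apply/eqP; rewrite eq_le b0 andbT leNgt; apply/negP => bgt0.
have [L L0 HL] := lnt_bounded cE.
(* After expansion, X <= e (1 - t b)^2 means 2 b eta <= t (b^2 e + L - e), which t <= b eta / k
   excludes. *)
pose k := `|b ^+ 2 * e + (L - e)| + 1; have k0 : 0 < k by rewrite ltr_wpDl.
pose t := Num.min (1 / 2) (b * eta / k).
have t0 : 0 < t by rewrite lt_min !divr_gt0 ?mulr_gt0.
have t1 : t < 1 by rewrite (@le_lt_trans _ _ (1 / 2)) ?ge_min ?lexx//; lra.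
have [nu [nuE Hnu]] := reweight muE mB t0 t1; rewrite -/b in Hnu.
have b1 : b <= 1.
  by rewrite -lee_fin /b fineK ?ge0_fin_numE//; exact: probability_le1.
have tb : 0 < 1 - t * b by rewrite subr_gt0 (le_lt_trans _ t1)// ler_piMr// ltW.
pose X := e - 2 * t * (e - eta) * b - t ^+ 2 * (L - e).
have main d' : 0 < d' -> d' <= d -> d' <= 1 -> X <= (1 - t * b) ^+ 2 * edl nu d'.
  move=> d'0 d'd d'1.
  pose A z := pint mu (fun w => \1_B w * lnt d' (cabs (z - w))).
  have tl z : tame E (fun w => lnt d' (cabs (z - w))) by exact: tame_lnt.
  have tBl z : tame E (fun w => \1_B w * lnt d' (cabs (z - w))) by exact: tame_indicM.
  have tp : tame E (potd mu d') by exact: (tame_potd cE muE).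
  have pnu z : (1 - t * b) * potd nu d' z = potd mu d' z - t * A z by exact: Hnu.
  have tA : tame E A.
    have -> : A = (fun z => t^-1 * (potd mu d' z - (1 - t * b) * potd nu d' z)).
      by apply/funext => z; rewrite pnu; field; exact: lt0r_neq0.
    apply: tameM; first exact: tame_cst.
    by apply: tameB => //; apply: tameM; [exact: tame_cst|exact: tame_potd].
  have tq : tame E (potd nu d') by exact: (tame_potd cE nuE).
  have tBA : tame E (fun z => \1_B z * A z) by exact: tame_indicM.
  have tBp : tame E (fun z => \1_B z * potd mu d' z) by exact: tame_indicM.
  have ttA : tame E (fun z => t * A z) by apply: tameM => //; exact: tame_cst.
  have ttBA : tame E (fun z => t * (\1_B z * A z)) by apply: tameM => //; exact: tame_cst.
  have h1 : (1 - t * b) ^+ 2 * edl nu d' = edl mu d' -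
      2 * t * pint mu (fun z => \1_B z * potd mu d' z) +
      t ^+ 2 * pint mu (fun z => \1_B z * A z).
    rewrite expr2 -mulrA Hnu// mulrBr mulrCA -(pintZ muE _ tq) -(pintZ muE _ (tame_indicM mB tq)).
    rewrite (_ : (fun z => _ * potd nu d' z) = (fun z => potd mu d' z - t * A z)); last exact/funext.
    rewrite (_ : (fun z => (1 - t * b) * (_ * _)) =
      (fun z => \1_B z * potd mu d' z - t * (\1_B z * A z))); last first.
      by apply/funext => z; rewrite mulrCA pnu; ring.
    rewrite (pintB muE tp ttA) (pintB muE tBp ttBA) (pintZ muE _ tA) (pintZ muE _ tBA).
    by rewrite /A (pint_swap_indic cE muE mB d'0) /edl; ring.
  have h2 : pint mu (fun z => \1_B z * potd mu d' z) <= (e - eta) * b.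
    rewrite /b -pint_indic// -(pintZ muE); last exact: tame_indic.
    apply: (le_pint muE) => //.
      by apply: tameM; [exact: tame_cst|exact: tame_indic].
    move=> z _; rewrite indicE; case: (boolP (z \in B)); rewrite ?mul0r ?mulr0//.
    rewrite inE mul1r mulr1 => /ltW; apply: le_trans; exact: (le_potd cE muE).
  (* Off B x B the kernel is at most L, and 0 <= L, so that part of the energy integral is at most
     L. *)
  have h3 : e - L <= pint mu (fun z => \1_B z * A z).
    rewrite lerBlDr -lerBlDl; apply: (@le_trans _ _ (edl mu d' - pint mu (fun z => \1_B z * A z))).
      by rewrite lerD2r edl_equilibrium.
    rewrite /edl -(pintB muE)// -[leRHS](pint_cst mu); apply: (le_pint muE).
    - exact: tameB.
    - exact: tame_cst.
    move=> z Ez; rewrite -[leRHS](pint_cst mu) -(pintZ muE)// -(pintB muE)//; last first.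
      by apply: tameM => //; exact: tame_cst.
    apply: (le_pint muE).
    - by apply: tameB => //; apply: tameM => //; exact: tame_cst.
    - exact: tame_cst.
    move=> w Ew; rewrite !indicE; case: (z \in B); case: (w \in B);
      rewrite ?mul1r ?mul0r ?subr0 ?subrr// HL//.
  rewrite h1 /X; have := edl_equilibrium d'0.
  have h4 : 2 * t * pint mu (fun z => \1_B z * potd mu d' z) <= 2 * t * ((e - eta) * b).
    by rewrite ler_wpM2l// mulr_ge0// ltW.
  have h5 : t ^+ 2 * (e - L) <= t ^+ 2 * pint mu (fun z => \1_B z * A z).
    by rewrite ler_wpM2l// sqr_ge0.
  have fin (x y p q : R) : x <= y -> 2 * t * p <= 2 * t * ((x - eta) * b) ->
      t ^+ 2 * (x - L) <= t ^+ 2 * q ->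
      x - 2 * t * (x - eta) * b - t ^+ 2 * (L - x) <= y - 2 * t * p + t ^+ 2 * q.
    by clear; move=> ? ? ?; lra.
  by move=> h6; exact: fin.
have tb2 : 0 < (1 - t * b) ^+ 2 by rewrite exprn_gt0.
have : X / (1 - t * b) ^+ 2 <= e.
  apply: (energy_lower_bound cE E0 gE nuE) => d' d'0.
  pose d2 := Num.min d' (Num.min d 1).
  have d20 : 0 < d2 by rewrite !lt_min d'0 d0 ltr01.
  apply: (@le_trans _ _ (edl nu d2)); last by apply: le_edl => //; rewrite ge_min lexx.
  by rewrite ler_pdivrMr// mulrC; apply: main => //; rewrite !ge_min lexx ?orbT.
rewrite ler_pdivrMr// => HX.
have : t * k <= b * eta by rewrite -ler_pdivlMr// ge_min lexx orbT.
have : b ^+ 2 * e + (L - e) <= k by rewrite (le_trans (ler_norm _))// lerDl.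
have be : 0 < b * eta by rewrite mulr_gt0.
move=> h1 h2; have h3 : t * (b ^+ 2 * e + (L - e)) <= b * eta.
  by apply: le_trans h2; rewrite ler_pM2l.
have h4 : 0 < t * (2 * (b * eta) - t * (b ^+ 2 * e + (L - e))).
  by rewrite mulr_gt0// subr_gt0 (le_lt_trans h3)// ltr_pMl// ltr1n.
have fin (x : R) : 0 < t * (2 * (b * eta) - t * (b ^+ 2 * x + (L - x))) ->
    x - 2 * t * (x - eta) * b - t ^+ 2 * (L - x) <= x * (1 - t * b) ^+ 2 -> False.
  by clear; move=> ? ?; lra.
exact: fin h4 HX.
Qed.

Definition mu_support : set (C R) :=
  [set z | forall r, 0 < r -> mu (@p2c R @^-1` [set w | cabs (w - z) < r]) != 0%E].
Local Notation S := mu_support.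

Lemma support_notin z : ~ S z ->
  exists2 r, 0 < r & mu (@p2c R @^-1` [set w | cabs (w - z) < r]) = 0%E.
Proof.
move=> Sz; apply: contrapT => H; apply: Sz => r r0; apply: contra_notN H => /eqP ?.
by exists r.
Qed.

Lemma null_subball z r w r' : mu (@p2c R @^-1` [set w | cabs (w - z) < r]) = 0%E ->
  (forall v, cabs (v - w) < r' -> cabs (v - z) < r) ->
  mu (@p2c R @^-1` [set v | cabs (v - w) < r']) = 0%E.
Proof.
move=> m0 sub; apply/eqP; rewrite eq_le measure_ge0 andbT -m0.
by apply: le_measure; rewrite ?inE; [exact: measurable_cball|exact: measurable_cball|move=> p; exact: sub].
Qed.

Lemma support_closed : closed S.
Proof.
rewrite -(setCK S); apply: open_closedC; apply/openCP => z /support_notin[r r0 m0].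
exists r => // w wz Sw; have := Sw (r - cabs (w - z)); rewrite subr_gt0 => /(_ wz)/eqP; apply.
by apply: null_subball m0 _ => v; exact: ball_shift.
Qed.

Lemma support_carried : carried mu S.
Proof.
split; first exact: support_closed.
apply: open_null; first by apply: closed_openC; exact: support_closed.
by move=> z /support_notin.
Qed.

Lemma support_sub : S `<=` E.
Proof.
move=> z Sz; apply: contrapT => Ez.
have [r r0 Hr] := notin_closedC (compactC_closed cE) Ez.
have /eqP := Sz r r0; apply; apply/eqP; rewrite eq_le measure_ge0 andbT -muE.2.
apply: le_measure; rewrite ?inE.
- exact: measurable_cball.
- by apply: measurable_open; apply: closed_openC; exact: muE.1.
- by move=> p; exact: Hr.
Qed.

Lemma support_compact : compact S.
Proof.
by apply: subclosed_compact support_sub => //; exact: support_closed.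
Qed.

(** By continuity, a smaller value would persist on a disc, which has positive mass, against
    [frostman_null]. *)
Lemma frostman_support d z : 0 < d -> S z -> e <= potd mu d z.
Proof.
move=> d0 Sz; rewrite leNgt; apply/negP => h.
pose eta := (e - potd mu d z) / 2.
have eta0 : 0 < eta by rewrite divr_gt0// subr_gt0.
have cp := continuous_potd cE muE d0.
have /continuousCP/(_ _ eta0)[r r0 Hr] := cp z.
have /eqP := Sz r r0; apply; apply/eqP; rewrite eq_le measure_ge0 andbT.
rewrite -(frostman_null d0 eta0); apply: le_measure; rewrite ?inE.
- exact: measurable_cball.
- by apply: measurable_open; apply: open_sublevel; exact: cp.
- by move=> p /= /Hr /ltr_normlW; rewrite /eta; lra.
Qed.

End Frostman.

(** * The equilibrium potential equals g + e on Omega *)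

Section EquilibriumPotential.
Variable R : realType.
Implicit Types (z w : C R) (r c d : R) (s : seq (C R)).
Variables (E : set (C R)) (g : C R -> R) (mu : probability (R * R)%type R).
Hypotheses (cE : compact E) (gE : continuous_green E g) (muq : is_equilibrium E mu).
Local Notation Om := (Omega E).
Local Notation e := (ln (cap E)).
Local Notation S := (mu_support mu).
Let muE : carried mu E := equilibrium_carried cE muq.
Let E0 : E !=set0 := equilibrium_neq0 cE muq.
Let muS : carried mu S := support_carried mu.
Let cS : compact S := support_compact cE muq.
Let SE : S `<=` E := support_sub cE muq.

Lemma support_neq0 : S !=set0. Proof. exact: carried_neq0 muS. Qed.

(** The kernel estimate of the continuity principle. Here a = |w - v| and x = |w' - v| with w' a
    point of the support nearest to w, so that x <= 2 a: removing the truncation at w costs no more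
    than removing it at w'. *)
Lemma lnt_continuity_principle d d' r x : 0 < d -> 0 < d' -> d' <= d -> d' <= r ->
  forall a, r <= a -> x <= 2 * a -> 0 <= x ->
  lnt d a - ln a <= lnt (2 * d) x - lnt d' x.
Proof.
move=> d0 d'0 d'd d'r a ra xa x0.
have a0 : 0 < a := lt_le_trans d'0 (le_trans d'r ra).
have m0 : 0 < Num.max x d' by rewrite lnt_max_gt0.
have M0 : 0 < Num.max x (2 * d) by rewrite lnt_max_gt0// mulr_gt0.
have A0 : 0 < Num.max a d by rewrite lnt_max_gt0.
rewrite /lnt -!ln_div_pos//; apply: ler_ln_pos; first by rewrite divr_gt0.
rewrite ler_pdivrMr// mulrAC ler_pdivlMr//.
have [ad|ad] := leP d a.
  by rewrite [leRHS]mulrC ler_pM2l// ge_max !le_max lexx/=; apply/orP; right; lra.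
have [xd|xd] := leP (2 * d) x.
  have : d <= a by lra.
  by rewrite leNgt ad.
have h : Num.max x d' <= 2 * a by rewrite ge_max xa/=; lra.
by apply: le_trans (ler_wpM2l (ltW d0) h) _; rewrite mulrCA mulrA.
Qed.

Lemma support_nearest z : exists2 w, S w & forall x, S x -> cabs (z - w) <= cabs (z - x).
Proof.
have [|w Sw Hw] := @compactC_max _ (fun w => - cabs (z - w)) S cS support_neq0.
  move=> w _; apply: (@lipschitz_continuousC _ _ 1) => x y; rewrite mul1r -opprD normrN.
  rewrite (le_trans (cabs_dist _ _))// cabsBC.
  by rewrite (_ : z - y - (z - x) = x - y)//; ring.
by exists w => // x /Hw; rewrite lerN2.
Qed.

(** If each halving of d lowered the truncated potential by more than eps, it would fall below e,
    which is impossible on the support. *)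
Lemma potd_support_small z eps : S z -> 0 < eps ->
  exists2 d, 0 < d & potd mu (2 * d) z - potd mu d z <= eps.
Proof.
move=> Sz eps0; apply: contrapT => H.
have step d : 0 < d -> potd mu d z < potd mu (2 * d) z - eps.
  move=> d0; rewrite ltNge; apply/negP => h; apply: H; exists d => //; lra.
have pw k : potd mu (2 ^- k) z <= potd mu 1 z - k%:R * eps.
  elim: k => [|k IH]; first by rewrite expr0 invr1 mul0r subr0.
  have := step (2 ^- k.+1) ltac:(by rewrite invr_gt0 exprn_gt0).
  rewrite {2}exprS invfM mulVKf// => h; rewrite -natr1; lra.
have [k] := @ltr_add_invr R 0 (eps / (`|potd mu 1 z - e| + 1))
  ltac:(by rewrite divr_gt0// ltr_wpDl).
rewrite add0r ltr_pdivlMr ?ltr_wpDl// mulrC ltr_pdivrMr// mulrC => hk.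
have := frostman_support cE gE muq (d := 2 ^- k.+1) ltac:(by rewrite invr_gt0 exprn_gt0) Sz.
have := pw k.+1; have := ler_norm (potd mu 1 z - e); lra.
Qed.

(** Off the support p may differ from its truncations; the loss is transferred to a nearest point of
    the support, where Frostman's bound holds for every truncation. *)
Lemma pot_near_support z eps : S z -> 0 < eps ->
  exists2 r, 0 < r & forall w, ~ S w -> cabs (w - z) < r -> e - eps <= pot mu w.
Proof.
move=> Sz eps0; have [d d0 Hd] := potd_support_small Sz (divr_gt0 eps0 (ltr0Sn _ 1)).
(* The Lipschitz constants are 1/d at w and 1/(2 d) at w', and |w' - z| <= 2 |w - z|: each variation
   is at most eps / 4. *)
exists (eps * d / 4); first by rewrite divr_gt0// mulr_gt0.
move=> w Sw wz; have [w' Sw' Hw'] := support_nearest w.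
pose r := cabs (w - w'); have r0 : 0 < r.
  rewrite cabs_gt0// subr_eq0; apply: contra_notN Sw => /eqP ->; exact: Sw'.
pose d' := Num.min d r; have d'0 : 0 < d' by rewrite lt_min d0.
have tl x q : 0 < q -> tame S (fun v => lnt q (cabs (x - v))) by move=> ?; exact: tame_lnt.
have tp : tame S (fun v => ln (cabs (w - v))) by exact: (tame_ln cS r0).
have h1 : potd mu d w - pot mu w <= potd mu (2 * d) w' - potd mu d' w'.
  rewrite /potd /pot -!(pintB muS)//; try by apply: tl; rewrite ?mulr_gt0.
  apply: (le_pint muS).
  - by apply: tameB => //; exact: tl.
  - by apply: tameB; apply: tl; rewrite ?mulr_gt0.
  move=> v Sv; apply: (@lnt_continuity_principle d d' r) => //.
  - by rewrite ge_min lexx.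
  - by rewrite ge_min lexx orbT.
  - exact: Hw'.
  - rewrite (le_trans (cabs_tri _ _ w))// cabsBC; have := Hw' _ Sv; lra.
  - exact: cabs_ge0.
have h2 := frostman_support cE gE muq d'0 Sw'.
have dz : `|potd mu d w - potd mu d z| <= eps / 4.
  rewrite (le_trans (potd_lipschitz cE muE _ _ d0))// mulrC ler_pdivrMr//.
  by rewrite (le_trans (ltW wz))//; lra.
have dw' : `|potd mu (2 * d) w' - potd mu (2 * d) z| <= eps / 4.
  have d20 : 0 < 2 * d by rewrite mulr_gt0.
  rewrite (le_trans (potd_lipschitz cE muE _ _ d20))// mulrC ler_pdivrMr//.
  have := cabs_tri w' z w; rewrite (cabsBC w' w); have := Hw' _ Sz; lra.
move: h1 h2 dz dw' Hd; rewrite !ler_norml.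
move: (potd mu d w) (pot mu w) (potd mu (2 * d) w') (potd mu d' w') (potd mu d z)
  (potd mu (2 * d) z) => a b p q x y; move: e => ee; clear.
by move=> ? ? /andP[? ?] /andP[? ?] ?; lra.
Qed.

Lemma pot_lnt_far M z : 0 <= M -> (forall w, S w -> cabs w <= M) -> M < cabs z ->
  ln (cabs z - M) <= pot mu z.
Proof.
move=> M0 SM zM; have d0 : 0 < cabs z - M by rewrite subr_gt0.
have H w : S w -> cabs z - M <= cabs (z - w).
  by move=> /SM wM; have := cabsB_ge z w; lra.
rewrite -(pint_cst mu (ln (cabs z - M))); apply: (le_pint muS).
- exact: tame_cst.
- exact: tame_ln H.
- by move=> w /H; exact: ler_ln_pos.
Qed.

Lemma support_bounded : exists2 M, 0 <= M & forall w, S w -> cabs w <= M.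
Proof.
have [M SM] := compactC_bounded cS; exists M => //.
by case: support_neq0 => w /SM; exact/le_trans/cabs_ge0.
Qed.

(** Minimum principle off the support: p is harmonic there, tends to infinity, and is nearly at
    least e close to the support. *)
Lemma pot_ge z : ~ S z -> e <= pot mu z.
Proof.
move=> Sz; rewrite leNgt; apply/negP => pe.
pose c := (e - pot mu z) / 2 - e.
have c0 : - e < c by rewrite ltrBrDr addNr divr_gt0// subr_gt0.
(* c is the midpoint of -e and -p(z), and the default c - 1 keeps the support out of the superlevel
   set. *)
pose u w := if `[< S w >] then c - 1 else - pot mu w.
have uE w : ~ S w -> u w = - pot mu w by move=> Sw; rewrite /u asboolF.
have Lu w : c <= u w -> ~ S w.
  by move=> + Sw; rewrite /u asboolT// lerBrDr -subr_ge0 opprD addrA subrr sub0r oppr_ge0 ler10.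
have shu w : c <= u w -> shm u w.
  move=> /Lu Sw; have [d d0 Hd] := notin_closedC (@support_closed _ mu) Sw.
  apply: (@shm_local _ (fun w => - pot mu w) _ _ d) => //.
    by move=> v /Hd Sv; rewrite uE.
  by apply: hm_shm; apply: hmN; exact: hm_pot Sw.
have := @max_principle _ u c; apply/not_implyP; split; last first.
  by move=> /(_ shu z); rewrite uE// /c; lra.
have [M M0 SM] := support_bounded.
apply: bounded_closed_compactC.
  exists (M + expR (- c)) => w /= cw; rewrite leNgt; apply/negP => Mw.
  have wM : M < cabs w by rewrite (lt_trans _ Mw)// ltrDl expR_gt0.
  have := pot_lnt_far M0 SM wM; have := Lu _ cw; move: cw => /[swap] /uE -> h1 h2.
  have : - c < ln (cabs w - M).
    by rewrite -ltr_expR lnK ?posrE ?subr_gt0// ltrBrDl.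
  lra.
apply: closedCP => w Hw /=; have [Sw|Sw] := pselect (S w).
  have [r r0 Hr] := pot_near_support Sw (divr_gt0 (etrans (subr_gt0 _ _) c0) (ltr0Sn _ 1)).
  have [v /= cv vw] := Hw _ r0; have := Hr _ (Lu _ cv) vw.
  by move: (cv); rewrite (uE _ (Lu _ cv)) => ? ?; exfalso; lra.
rewrite uE// leNgt; apply/negP => uc.
have /continuousCP := hm_cont (hm_pot cS muS Sw).
move=> /(_ (c + pot mu w)) [|d /Hw[v /= cv vw] /(_ _ vw)]; first lra.
by move: (cv); rewrite uE; [|exact: Lu cv]; rewrite ltr_norml => ? /andP[? _]; lra.
Qed.

Lemma potd_ge d z : 0 < d -> e <= potd mu d z.
Proof.
move=> d0; have [|Sz] := pselect (S z); first by move=> Sz; exact: (frostman_support cE gE muq).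
apply: le_trans (pot_ge Sz) _.
have [w Sw Hw] := support_nearest z.
have r0 : 0 < cabs (z - w) by rewrite cabs_gt0// subr_eq0; apply: contra_notN Sz => /eqP ->.
rewrite (pot_potd cS muS r0 Hw) /potd; apply: (le_pint muS); try exact: tame_lnt.
by move=> x /Hw h; rewrite lntE// lnt_ge_ln// (lt_le_trans r0).
Qed.

Lemma Omega_notin_support z : Om z -> ~ S z.
Proof. by move=> /Omega_notin Ez /SE. Qed.

Lemma green_le_pot z : Om z -> g z + e <= pot mu z.
Proof.
suff H : Om z -> g z + - pot mu z + e <= 0 by move=> /H; lra.
move: z; apply: (Omega_max_principle gE).
- move=> z Oz; apply: hm_shm; apply: hmD; last exact: hm_cst.
  by apply: hmD; [exact: green_hm Oz|apply: hmN; exact: hm_pot (Omega_notin_support Oz)].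
- move=> z clz Oz eps eps0; have cg := green_cont gE.
  have /continuousCP/(_ _ eps0)[d d0 Hd] := cg z.
  exists d => // w Ow /Hd; rewrite (green_off gE Oz) subr0 => /ltr_normlW.
  have := pot_ge (Omega_notin_support Ow); lra.
have [B [r0 gB]] := green_growth gE; have [M M0 SM] := support_bounded.
exists (B + ln 2 + e), (Num.max (Num.max r0 1) (2 * M)) => z Oz.
rewrite !gt_max => /andP[/andP[zr z1] zM].
have z0 : 0 < cabs z := lt_trans ltr01 z1.
have := gB _ zr; rewrite ler_norml => /andP[_ h1].
have := @pot_lnt_far M z M0 SM ltac:(lra).
have : ln (cabs z / 2) <= ln (cabs z - M) by apply: ler_ln_pos; lra.
by rewrite ln_div_pos//; lra.
Qed.

(** Bernstein-Walsh averaged over the circle: all roots are within r/2 of its centre, so each factor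
    contributes ln r whatever the polynomial, and c may tend to -e. *)
Lemma green_mean_ge M r : 0 < r -> (forall w, E w -> cabs w <= M) -> M < r -> 2 * M <= r ->
  2 * pi * (ln r - e) <= circ g 0 r.
Proof.
move=> r0 EM Mr M2r.
have cg : circle_cont g 0 r by move=> w _; exact: (green_cont gE).
have pi2 : 0 < 2 * pi :> R by rewrite mulr_gt0// pi_gt0.
suff H c : c < - e -> 2 * pi * (ln r + c) <= circ g 0 r.
  rewrite -ler_pdivlMl//; apply/ler_addgt0Pl => eps eps0.
  have := H (- e - eps) ltac:(lra); rewrite -ler_pdivlMl//; lra.
move=> ce; have ce' : (c%:E < min_energy E)%E by rewrite (min_energy_ln_cap cE E0 gE) lte_fin.
have [k k1 [s [sk sE sc]]] := fekete_szego cE E0 ce' 1%N.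
rewrite -sk in k1 sc; have k0 : 0 < (size s)%:R :> R by rewrite ltr0n.
have sM (i : 'I_(size s)) : cabs (s`_i : C R) <= M by apply/EM/sE/mem_nth.
have cf (i : 'I_(size s)) : circle_cont (fun x => ln (cabs (x - (s`_i : C R)))) 0 r.
  by apply: circle_cont_ln; exact: le_lt_trans (sM i) Mr.
pose f := fun x : C R => \sum_(i < size s) ln (cabs (x - (s`_i : C R))).
have : circ (fun x => f x + c * (size s)%:R) 0 r <= circ (fun x => (size s)%:R * g x) 0 r.
  apply: circle_mean_le; first exact: ltW.
  - apply: circle_contD; first exact: circle_cont_sum.
    by move=> w _; exact: cst_continuous.
  - exact: circle_contZ.
  move=> w; rewrite subr0 => wr; rewrite /f.
  have := bernstein_walsh cE gE sE sc (z := w).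
  rewrite (big_nth 0) big_mkord; apply; apply: (Omega_far EM).
  by rewrite wr.
rewrite circle_meanZ ?(ltW r0)// circle_meanD ?(ltW r0)//; last 2 first.
- exact: circle_cont_sum.
- by move=> w _; exact: cst_continuous.
rewrite circ_cst circle_mean_sum ?(ltW r0)//.
rewrite (eq_bigr (fun=> 2 * pi * ln r)); last first.
  move=> i _; apply: circ_ln_far => //; have := sM i; lra.
rewrite sumr_const card_ord -(mulr_natr (2 * pi * ln r)) => h.
rewrite -(ler_pM2l k0); apply: le_trans h.
by rewrite le_eqVlt; apply/orP; left; apply/eqP; ring.
Qed.

Lemma pot_green z : Om z -> pot mu z = g z + e.
Proof.
move=> Oz; have [M EM] := compactC_bounded cE.
have M0 : 0 <= M by case: E0 => w /EM; exact/le_trans/cabs_ge0.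
have big w : M < cabs w -> 2 * M <= cabs w -> 0 < cabs w -> pot mu w = g w + e.
  move=> wM w2M w0; set r := cabs w in wM w2M w0.
  pose h x := - pot mu x + (g x + e).
  have cp : circle_cont (pot mu) 0 r.
    move=> x; rewrite subr0 => xr; apply/hm_cont/(hm_pot cS muS) => /SE /EM; rewrite xr; lra.
  have cg : circle_cont g 0 r by move=> x _; exact: (green_cont gE).
  have cc : circle_cont (fun=> e) 0 r by move=> x _; exact: cst_continuous.
  have ch : circle_cont h 0 r.
    move=> x xr; apply: continuousD; first by apply: continuousN; exact: cp.
    by apply: (circle_contD cg cc).
  have [t tr wt] := polar_cpt 0 w; rewrite subr0 -/r in wt.
  have := @ltr_itv_mean _ (fun t => h (cpt 0 r t)) 0 t.
  move=> /(_ (circle_continuous (ltW w0) ch)).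
  have hle a : h (cpt 0 r a) <= 0.
    rewrite /h addrC subr_le0; apply/green_le_pot/(Omega_far EM).
    by have := cabs_cpt 0 a (ltW w0); rewrite subr0 => ->.
  move=> /(_ hle tr); rewrite mulr0 -wt => H.
  suff : h w = 0 by rewrite /h => ?; lra.
  apply: H; rewrite -/(circ h 0 r).
  have -> : h = (fun x => (-1) * pot mu x + (g x + e)) by apply/funext => x; rewrite mulN1r.
  rewrite circle_meanD ?(ltW w0)//; [|exact: circle_contZ|exact: circle_contD].
  rewrite circle_meanZ ?(ltW w0)// circle_meanD ?(ltW w0)// circ_cst.
  rewrite (circ_pot_far cE muE w0 EM w2M).
  have := green_mean_ge w0 EM wM w2M.
  by rewrite [X in X <= _ -> _]mulrBr; lra.
have [A [cA AO Az bA]] := Omega_comp Oz.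
have [z0 Az0 [z01 z02 z03]] : exists2 z0, A z0 & [/\ M < cabs z0, 2 * M <= cabs z0 & 0 < cabs z0].
  apply: contrapT => H; apply: bA; exists (2 * M + 1) => w Aw; rewrite leNgt; apply/negP => wM.
  by apply: H; exists w => //; split; lra.
have := @strong_max_principle _ Om A (fun w => g w + - pot mu w) (- e) z0.
move=> /(_ (open_Omega gE) AO cA) H.
suff : g z + - pot mu z = - e by lra.
apply: H => //.
- move=> w Ow; apply: hm_shm; apply: hmD; first exact: green_hm Ow.
  by apply: hmN; exact: hm_pot (Omega_notin_support Ow).
- by move=> w /green_le_pot; lra.
- by rewrite big//; lra.
Qed.

(** Off the support p would be harmonic near z with minimal value e at z, hence constant nearby; but
    p = g + e > e at the nearby points of Omega. *)
Lemma boundary_support z : closure Om z -> ~ Om z -> S z.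
Proof.
move=> clz Oz; apply: contrapT => Sz.
have hp := hm_pot cS muS Sz; have cg := green_cont gE.
have near x : 0 < x -> exists2 w, Om w & `|pot mu w - pot mu z| < x /\ `|g w - g z| < x.
  move=> x0; have /continuousCP/(_ _ x0)[d1 d10 H1] := hm_cont hp.
  have /continuousCP/(_ _ x0)[d2 d20 H2] := cg z.
  have [w Ow] := (closureCP _ _).1 clz (Num.min d1 d2) ltac:(by rewrite lt_min d10).
  by rewrite lt_min => /andP[w1 w2]; exists w => //; split; [exact: H1|exact: H2].
have pz : pot mu z = e.
  apply/eqP; rewrite eq_le pot_ge// andbT; apply/ler_addgt0Pl => x x0.
  have [w Ow []] := near _ (divr_gt0 x0 (ltr0Sn _ 1)).
  rewrite (pot_green Ow) (green_off gE Oz) subr0 !ltr_norml => /andP[? ?] /andP[? ?]; lra.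
have [d d0 Hd] := notin_closedC (@support_closed _ mu) Sz.
have [d' d'0 Hd'] := @shm_max_const _ (fun w => - pot mu w) z d d0 (hm_shm (hmN hp))
  ltac:(by move=> w /Hd Sw; rewrite lerN2 pz pot_ge).
have [w Ow /Hd' /oppr_inj] := (closureCP _ _).1 clz _ d'0.
by rewrite pz (pot_green Ow); have := green_gt0 gE Ow; lra.
Qed.

End EquilibriumPotential.

(** * Polynomials in one variable *)

Section RootProduct.
Variable R : realType.
Implicit Types (z w : C R) (r c d : R) (s : seq (C R)).

Definition rprod s z : R := \prod_(w <- s) cabs (z - w).

Lemma rprod_ge0 s z : 0 <= rprod s z.
Proof. by apply: prodr_ge0 => w _; exact: cabs_ge0. Qed.

Lemma rprod_continuous s : continuous (rprod s).
Proof. exact: prod_cabs_continuous. Qed.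

Lemma rprod_root s w : w \in s -> rprod s w = 0.
Proof.
elim: s => // x s IH; rewrite inE => /orP[/eqP <-|/IH h]; rewrite /rprod big_cons.
  by rewrite subrr cabs0 mul0r.
by rewrite -/(rprod s w) h mulr0.
Qed.

Lemma rprod_neq0 s z : rprod s z != 0 -> forall w, w \in s -> z != w.
Proof. by move=> h w ws; apply: contraNneq h => ->; rewrite rprod_root. Qed.

(** Indexed by positions rather than by points, so that every term of the sum involves an actual
    root and is harmonic away from the roots. *)
Definition lnprod s z : R := \sum_(i < size s) ln (cabs (z - (s`_i : C R))).

Lemma ln_rprod s z : (forall w, w \in s -> z != w) ->
  ln (rprod s z) = lnprod s z /\ 0 < rprod s z.
Proof. by move=> /ln_prod_cabs[h1 h2]; split=> //; rewrite h1 /lnprod (big_nth 0) big_mkord. Qed.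

Lemma hm_lnprod s z : (forall w, w \in s -> z != w) -> hm (lnprod s) z.
Proof. by move=> sz; apply: hm_sum => i; apply: hm_ln; apply: sz; exact: mem_nth. Qed.

Lemma hm_lnprod_pos s z : 0 < rprod s z -> hm (lnprod s) z.
Proof. by move=> h; apply/hm_lnprod/rprod_neq0; rewrite gt_eqF. Qed.

Lemma ln_rprod_pos s z : 0 < rprod s z -> ln (rprod s z) = lnprod s z.
Proof. by move=> h; apply: (ln_rprod _).1; apply: rprod_neq0; rewrite gt_eqF. Qed.

Lemma seq_bounded s : exists2 M, 0 <= M & forall w, w \in s -> cabs w <= M.
Proof.
elim: s => [|x s [M M0 IH]]; first by exists 0.
exists (M + cabs x); first by rewrite addr_ge0 ?cabs_ge0.
by move=> w; rewrite inE => /orP[/eqP ->|/IH]; [rewrite lerDr|have := cabs_ge0 x; lra].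
Qed.

Lemma rprod_far s c : (0 < size s)%N -> exists r0, forall z, r0 < cabs z -> c < rprod s z.
Proof.
move=> s0; have [M M0 sM] := seq_bounded s.
exists (M + 1 + `|c|) => z zr; apply: (@lt_le_trans _ _ (\prod_(w <- s) (1 + `|c|))).
  case: s s0 {sM} => // x s _; rewrite big_cons.
  apply: (@lt_le_trans _ _ (1 + `|c|)); first by have := ler_norm c; lra.
  rewrite ler_peMr ?addr_ge0// big_const_seq iter_mulr_1.
  by rewrite exprn_ege1// lerDl.
rewrite /rprod !big_seq; apply: ler_prod => w ws; rewrite addr_ge0//=.
by have := cabsB_ge z w; have := sM _ ws; lra.
Qed.

(* Along a real line, the square of [rprod s] is a real polynomial; if it is
   constant near 0 then it is constant, and it vanishes at a root. *)
Lemma rprod_not_locally_constant s z c d : (0 < size s)%N -> c != 0 -> 0 < d ->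
  ~ (forall w, cabs (w - z) < d -> rprod s w = c).
Proof.
move=> s0 c0 d0 Hc; pose w0 := (s`_0 : C R); have w0s : w0 \in s by exact: mem_nth.
pose v := w0 - z.
pose q : {poly R} := \prod_(w <- s) (((Re (z - w))%:P + (Re v)%:P * 'X) ^+ 2 +
                                   ((Im (z - w))%:P + (Im v)%:P * 'X) ^+ 2).
have qE t : q.[t] = rprod s (z + Complex t 0 * v) ^+ 2.
  rewrite /q /rprod horner_prod -prodrXl; apply: eq_bigr => w _.
  rewrite !hornerE /cabs (_ : z + _ - w = (z - w) + Complex t 0 * v); last by ring.
  case: (z - w) => a b; move: (v) => [x y] /=.
  rewrite sqr_sqrtr ?addr_ge0 ?sqr_ge0// !mul0r subr0 addr0.
  by congr (_ ^+ 2 + _ ^+ 2); rewrite mulrC.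
have q0 : q.[0] = c ^+ 2.
  by rewrite qE Hc// [Complex 0 0](_ : _ = 0)// mul0r addr0 subrr cabs0.
pose eps := d / (cabs v + 1).
have v1 : 0 < cabs v + 1 by rewrite ltr_wpDl ?cabs_ge0.
have eps0 : 0 < eps by rewrite divr_gt0.
have qr t : 0 <= t -> t <= eps -> root (q - (c ^+ 2)%:P) t.
  move=> t0 te; rewrite /root !hornerE qE Hc ?subrr//.
  rewrite addrAC subrr add0r cabsM cabs_real ger0_norm//.
  apply: (@le_lt_trans _ _ (eps * cabs v)); first by rewrite ler_wpM2r ?cabs_ge0.
  by rewrite /eps mulrAC ltr_pdivrMr// ltr_pM2l// ltrDl.
have qc : q - (c ^+ 2)%:P = 0.
  apply/eqP; apply: contraT => qn0.
  pose rs := [seq eps / k.+1%:R | k <- iota 0 (size (q - (c ^+ 2)%:P))].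
  have := @max_poly_roots _ _ rs qn0; rewrite size_map size_iota ltnn; apply.
    apply/allP => _ /mapP[k _ ->]; apply: qr; first by rewrite divr_ge0// ltW.
    by rewrite ler_pdivrMr// ler_peMr ?(ltW eps0)// ler1n.
  rewrite map_inj_uniq ?iota_uniq// => i j /(mulfI (lt0r_neq0 eps0))/invr_inj/eqP.
  by rewrite eqr_nat => /eqP[].
have : q.[1] = 0.
  by rewrite qE (_ : z + _ = w0) ?rprod_root ?expr0n// [Complex 1 0](_ : _ = 1)// mul1r /v addrC subrK.
have -> : q = (c ^+ 2)%:P by apply/eqP; rewrite -subr_eq0 qc.
by rewrite hornerC => /eqP; rewrite expf_eq0/= (negbTE c0).
Qed.

Lemma poly_rprod (P : {poly C R}) : P != 0 -> exists s, size s = (size P).-1 /\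
  forall z, P.[z] = lead_coef P * \prod_(w <- s) (z - w).
Proof.
move=> P0; have [s sE] := closed_field_poly_normal (P : {poly R[i]}).
exists s; split.
  rewrite [in RHS]sE size_scale ?lead_coef_eq0// size_prod_XsubC//.
move=> z; rewrite [in LHS]sE hornerZ horner_prod; congr (_ * _).
by apply: eq_bigr => w _; rewrite hornerXsubC.
Qed.

End RootProduct.

(** * Extremal monic polynomials on one regular compact set *)

Section RegularCompact.
Variable R : realType.
Implicit Types (z w : C R) (r c d : R) (s : seq (C R)).
Variables (E : set (C R)) (g : C R -> R) (mu : probability (R * R)%type R).
Hypotheses (cE : compact E) (gE : continuous_green E g) (muq : is_equilibrium E mu).
Local Notation Om := (Omega E).
Local Notation e := (ln (cap E)).
Local Notation S := (mu_support mu).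
Let muE : carried mu E := equilibrium_carried cE muq.
Let E0 : E !=set0 := equilibrium_neq0 cE muq.
Let muS : carried mu S := support_carried mu.
Let cS : compact S := support_compact cE muq.
Let SE : S `<=` E := support_sub cE muq.
Let capE : 0 < cap E := cap_gt0 cE E0 gE.

Lemma lnX_pos x k : 0 < x -> ln (x ^+ k) = k%:R * ln x :> R.
Proof. by move=> x0; rewrite lnXn// mulr_natl. Qed.

(** Its logarithm integrates to the sum of [potd mu d w] over the roots w, which is at least m e
    wherever the roots lie. *)
Definition trunc d s z : R := \prod_(w <- s) Num.max (cabs (w - z)) d.

Lemma trunc_gt0 d s z : 0 < d -> 0 < trunc d s z.
Proof. by move=> d0; apply: prodr_gt0 => w _; exact: lnt_max_gt0. Qed.

Lemma trunc_tame d s : 0 < d -> tame E (trunc d s).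
Proof.
move=> d0; apply: tame_continuous => //; elim: s => [|w s IH].
  by rewrite /trunc; under eq_fun do rewrite big_nil; move=> z; exact: cst_continuous.
rewrite /trunc; under eq_fun do rewrite big_cons.
have cw : continuous (fun z => Num.max (cabs (w - z)) d); last first.
  by move=> z; exact: (continuousM (cw z) (IH z)).
apply: (@lipschitz_continuousC _ _ 1) => x y; rewrite mul1r.
apply: (@le_trans _ _ `|cabs (w - x) - cabs (w - y)|).
  have := ler_norm (cabs (w - x) - cabs (w - y)).
  have := ler_norm (- (cabs (w - x) - cabs (w - y))); rewrite normrN.
  by rewrite ler_norml !maxEle; do 2 case: ifP; move=> ? ? ? ?; apply/andP; split; lra.
rewrite (le_trans (cabs_dist _ _))// cabsBC.
by rewrite (_ : w - y - (w - x) = x - y)//; ring.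
Qed.

Lemma trunc_approx s : exists2 K, 0 <= K & forall d z, 0 < d -> d <= 1 -> E z ->
  trunc d s z <= rprod s z + K * d.
Proof.
have [M EM] := compactC_bounded cE.
have M0 : 0 <= M by case: E0 => w /EM; exact/le_trans/cabs_ge0.
elim: s => [|w s [K K0 IH]].
  by exists 0 => // d z _ _ _; rewrite /trunc /rprod !big_nil mul0r addr0.
have [B B0 HB] : exists2 B, 0 <= B & forall z, E z -> rprod s z <= B.
  have [B HB] := compact_image_bounded cE (@rprod_continuous _ s).
  exists `|B| => // z /HB; rewrite ger0_norm ?rprod_ge0// => h.
  by rewrite (le_trans h)// ler_norm.
exists ((cabs w + M + 1) * K + B); first by rewrite addr_ge0// mulr_ge0// !addr_ge0// cabs_ge0.
move=> d z d0 d1 Ez; rewrite /trunc /rprod !big_cons -/(trunc d s z) -/(rprod s z).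
have h1 := IH _ _ d0 d1 Ez; have h2 := HB _ Ez; have h3 := rprod_ge0 s z.
rewrite (cabsBC z); have a0 := cabs_ge0 (w - z).
have a1 : cabs (w - z) <= cabs w + M.
  by rewrite (le_trans (cabsD _ _))// cabsN lerD2l EM.
have m1 : Num.max (cabs (w - z)) d <= cabs (w - z) + d by rewrite ge_max lerDl lerDr (ltW d0) a0.
apply: (@le_trans _ _ ((cabs (w - z) + d) * (rprod s z + K * d))).
  apply: ler_pM => //; first by rewrite le_max a0.
  exact/ltW/trunc_gt0.
have h4 : cabs (w - z) * (K * d) <= (cabs w + M) * (K * d).
  by rewrite ler_wpM2r// mulr_ge0// ltW.
have h5 : d * rprod s z <= d * B by rewrite ler_wpM2l// ltW.
have h6 : d * (K * d) <= 1 * (K * d) by rewrite ler_wpM2r// mulr_ge0// ltW.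
lra.
Qed.

Lemma ln_pint_trunc d s : 0 < d -> (size s)%:R * e <= ln (pint mu (trunc d s)).
Proof.
move=> d0; set a := pint _ _.
have tt : tame E (trunc d s) by exact: trunc_tame.
have tl w : tame E (fun z => lnt d (cabs (w - z))) by exact: tame_lnt.
have a0 : 0 < a.
  rewrite lt_neqAle; apply/andP; split; last first.
    rewrite -(pint_cst mu 0); apply: (le_pint muE) => //; first exact: tame_cst.
    by move=> z _; exact/ltW/trunc_gt0.
  rewrite eq_sym gt_eqF//; apply: (@lt_le_trans _ _ (pint mu (fun=> d ^+ size s))).
    by rewrite pint_cst exprn_gt0.
  apply: (le_pint muE) => //; first exact: tame_cst.
  move=> z _; rewrite /trunc -iter_mulr_1 -(count_predT s) -big_const_seq.
  by apply: ler_prod => w _; rewrite (ltW d0) le_max lexx orbT.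
(* The logarithm lies below its tangent at the mean [a]; integration then gives Jensen's
   inequality. *)
have h z : \sum_(w <- s) lnt d (cabs (w - z)) <= (ln a - 1) + a^-1 * trunc d s z.
  rewrite -ln_prod; last by move=> w; exact: lnt_max_gt0.
  rewrite -/(trunc d s z); have := ln_leB1 (divr_gt0 (trunc_gt0 s z d0) a0).
  by rewrite ln_div_pos ?trunc_gt0// mulrC; lra.
have h1 : pint mu (fun z => \sum_(w <- s) lnt d (cabs (w - z))) <=
    pint mu (fun z => (ln a - 1) + a^-1 * trunc d s z).
  apply: (le_pint muE) => //; first exact: tame_sum.
  by apply: tameD; [exact: tame_cst|apply: tameM => //; exact: tame_cst].
move: h1; rewrite (pint_sum muE)// (pintD muE) ?pint_cst//; last 2 first.
- exact: tame_cst.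
- by apply: tameM => //; exact: tame_cst.
rewrite (pintZ muE)// -/a mulVf ?gt_eqF// subrK; apply: le_trans.
rewrite mulrC mulr_natr -(count_predT s) -iter_addr_0 -big_const_seq.
by apply: ler_sum => w _; exact: (potd_ge cE gE muq).
Qed.

Lemma rprod_tame s : tame E (rprod s).
Proof. by apply: tame_continuous => //; exact: rprod_continuous. Qed.

Lemma pint_rprod_ge s : cap E ^+ size s <= pint mu (rprod s).
Proof.
have [K K0 HK] := trunc_approx s.
apply/ler_addgt0Pr => eps eps0.
pose d := Num.min 1 (eps / (K + 1)).
have K1 : 0 < K + 1 by rewrite ltr_wpDl.
have d0 : 0 < d by rewrite lt_min ltr01 divr_gt0.
have d1 : d <= 1 by rewrite ge_min lexx.
have h1 : pint mu (trunc d s) <= pint mu (fun z => rprod s z + K * d).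
  apply: (le_pint muE).
  - exact: trunc_tame.
  - by apply: tameD; [exact: rprod_tame|exact: tame_cst].
  - by move=> z; exact: HK.
rewrite (pintD muE) ?pint_cst in h1; [|exact: rprod_tame|exact: tame_cst].
have h2 : K * d <= eps.
  apply: (@le_trans _ _ ((K + 1) * d)); first by rewrite ler_wpM2r ?(ltW d0)// lerDl.
  by rewrite mulrC -ler_pdivlMr// ge_min lexx orbT.
have h3 : cap E ^+ size s <= pint mu (trunc d s); last by lra.
have a0 : 0 < pint mu (trunc d s).
  apply: (@lt_le_trans _ _ (pint mu (fun=> d ^+ size s))).
    by rewrite pint_cst exprn_gt0.
  apply: (le_pint muE); [exact: tame_cst|exact: trunc_tame|].
  move=> z _; rewrite /trunc -iter_mulr_1 -(count_predT s) -big_const_seq.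
  by apply: ler_prod => w _; rewrite (ltW d0) le_max lexx orbT.
rewrite -ler_ln ?posrE ?exprn_gt0// lnX_pos//; exact: ln_pint_trunc.
Qed.

Lemma rprod2_tame s : tame E (fun z => rprod s z ^+ 2).
Proof. by under eq_fun do rewrite expr2; apply: tameM; exact: rprod_tame. Qed.

Lemma pint_rprod_dev s : let c := cap E ^+ size s in
  pint mu (fun z => (rprod s z - c) ^+ 2) =
  pint mu (fun z => rprod s z ^+ 2) - 2 * c * pint mu (rprod s) + c ^+ 2.
Proof.
move=> c; rewrite (_ : (fun z => _) = (fun z => rprod s z ^+ 2 + ((- 2 * c) * rprod s z + c ^+ 2))).
  have t1 := rprod_tame s; have t2 := rprod2_tame s.
  have t3 : tame E (fun z => (- 2 * c) * rprod s z) by apply: tameM => //; exact: tame_cst.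
  rewrite (pintD muE t2 (tameD t3 (tame_cst _ _))) (pintD muE t3 (tame_cst _ _)).
  by rewrite (pintZ muE _ t1) pint_cst; ring.
by apply/funext => z; ring.
Qed.

Theorem pint_rprod2_ge s : (cap E ^+ size s) ^+ 2 <= pint mu (fun z => rprod s z ^+ 2).
Proof.
have := pint_rprod_dev s => /=; set c := cap E ^+ size s => h.
have c0 : 0 < c by rewrite exprn_gt0.
have : 0 <= pint mu (fun z => (rprod s z - c) ^+ 2).
  by apply: Rintegral_ge0 => p _; exact: sqr_ge0.
rewrite h; have : c * c <= c * pint mu (rprod s) by rewrite ler_pM2l// pint_rprod_ge.
by rewrite -expr2; lra.
Qed.

Lemma pint0_support (h : C R -> R) : continuous h -> (forall z, 0 <= h z) ->
  pint mu h <= 0 -> forall z, S z -> h z = 0.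
Proof.
move=> ch h0 ph z Sz; apply/eqP; rewrite eq_le h0 andbT leNgt; apply/negP => hz.
have hz2 : 0 < h z / 2 by rewrite divr_gt0.
have /continuousCP/(_ _ hz2)[r r0 Hr] := ch z.
have := Sz r r0; set B := [set w | _] => muB.
have mB : measurable (@p2c R @^-1` B) by exact: measurable_cball.
have fB : 0 < fine (mu (@p2c R @^-1` B)).
  rewrite fine_gt0// lt0e muB measure_ge0/= (le_lt_trans (probability_le1 _ _))// ltry//.
have tB : tame E (fun z => \1_B z) by exact: tame_indic.
have : pint mu (fun w => h z / 2 * \1_B w) <= pint mu h.
  apply: (le_pint muE).
  - by apply: tameM => //; exact: tame_cst.
  - exact: tame_continuous.
  - move=> w _; rewrite indicE; case: (boolP (w \in B)); rewrite ?mulr0// mulr1 inE => /Hr.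
    by rewrite ltr_norml => /andP[+ _]; lra.
rewrite (pintZ muE)// pint_indic// => h1.
have : 0 < h z / 2 * fine (mu (@p2c R @^-1` B)) by rewrite mulr_gt0.
lra.
Qed.

Lemma rprod_support s : pint mu (fun z => rprod s z ^+ 2) <= (cap E ^+ size s) ^+ 2 ->
  forall z, S z -> rprod s z = cap E ^+ size s.
Proof.
move=> hs z Sz; have := pint_rprod_dev s => /=; set c := cap E ^+ size s in hs * => h.
have c0 : 0 < c by rewrite exprn_gt0.
have : (rprod s z - c) ^+ 2 = 0.
  apply: (@pint0_support (fun z => (rprod s z - c) ^+ 2)) => //.
  - have cr : continuous (fun z => rprod s z - c).
      by move=> w; apply: continuousB; [exact: rprod_continuous|exact: cst_continuous].
    by move=> w; exact: (continuousM (cr w) (cr w)).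
  - by move=> w; exact: sqr_ge0.
  - rewrite h; have : c * c <= c * pint mu (rprod s) by rewrite ler_pM2l// pint_rprod_ge.
    by rewrite -expr2; lra.
by move=> /eqP; rewrite sqrf_eq0 subr_eq0 => /eqP.
Qed.

Lemma cboundary_Omega : cboundary Om = closure Om `\` Om.
Proof. by rewrite /cboundary ((interior_id _).1 (open_Omega gE)). Qed.

Lemma compact_compl_Omega : compact (~` Om).
Proof.
apply: bounded_closed_compactC; last by apply: open_closedC; exact: (open_Omega gE).
have [M EM] := compactC_bounded cE; exists M => z Oz; rewrite leNgt; apply/negP => zM.
exact/Oz/(Omega_far EM).
Qed.

(** A point off Omega with |P| > c is not on the boundary, hence is interior to the complement, and
    ln |P| is harmonic near it. The maximum principle applies since the complement is compact. *)
Lemma rprod_le_off_Omega s c : 0 < c ->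
  (forall z, closure Om z -> ~ Om z -> rprod s z = c) ->
  forall z, ~ Om z -> rprod s z <= c.
Proof.
move=> c0 bc z Oz; rewrite leNgt; apply/negP => cz.
pose u w := if `[< ~ Om w >] then ln (Num.max (rprod s w) c) else ln c - 1.
pose c1 := ln (rprod s z).
have c1c : ln c < c1 by rewrite ltr_ln_pos.
have uE w : ~ Om w -> u w = ln (Num.max (rprod s w) c) by move=> Ow; rewrite /u asboolT.
have Lu w : c1 <= u w -> ~ Om w /\ rprod s z <= rprod s w.
  rewrite /u; case: asboolP => [Ow|_]; last by lra.
  rewrite /c1 ler_ln ?posrE ?(lt_trans c0 cz)// ?lnt_max_gt0// le_max.
  by rewrite [X in _ || X]leNgt cz orbF.
have := @max_principle _ u c1; apply/not_implyP; split; last first.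
  move=> H; have shu w : c1 <= u w -> shm u w; last first.
    by have := H shu z; rewrite uE// max_l ?(ltW cz)// ltxx.
  move=> /Lu[Ow zw]; have cw := lt_le_trans cz zw.
  have clw : ~ closure Om w by move=> /bc/(_ Ow) wc; rewrite wc ltxx in cw.
  have [d1 d10 H1] := notin_closedC (@closed_closure _ Om) clw.
  have cp := @rprod_continuous _ s.
  have /continuousCP := cp w; move=> /(_ (rprod s w - c)) []; first by rewrite subr_gt0.
  move=> d2 d20 H2.
  apply: (@shm_local _ (lnprod s) _ _ (Num.min d1 d2)); first by rewrite lt_min d10.
    move=> v; rewrite lt_min => /andP[/H1 v1 /H2]; rewrite ltr_norml => /andP[v2 _].
    have cv : c < rprod s v by lra.
    rewrite uE; last by move=> /subset_closure.
    by rewrite max_l ?(ltW cv)// ln_rprod_pos// (lt_trans c0).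
  by apply: hm_shm; apply: hm_lnprod_pos; exact: lt_trans cw.
have -> : [set w | c1 <= u w] = ~` Om `&` [set w | rprod s z <= rprod s w].
  apply/seteqP; split=> w /=; first exact: Lu.
  move=> [Ow zw]; rewrite uE// /c1 ler_ln ?posrE ?(lt_trans c0 cz)// ?lnt_max_gt0//.
  by rewrite le_max zw.
apply: compact_closedI; first exact: compact_compl_Omega.
rewrite -(setCK [set w | _]); apply: open_closedC.
rewrite (_ : ~` _ = [set w | rprod s w < rprod s z]); last first.
  by apply/seteqP; split=> w /=; rewrite ltNge => /negP.
by apply: open_sublevel; exact: rprod_continuous.
Qed.

(** Minimum principle for ln |P|, which is harmonic on Omega without roots there. Strictness holds
    because |P| is not constant on an unbounded connected set. *)
Lemma rprod_gt_on_Omega s c : (0 < size s)%N -> 0 < c ->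
  (forall z, Om z -> 0 < rprod s z) ->
  (forall z, closure Om z -> ~ Om z -> rprod s z = c) ->
  forall z, Om z -> c < rprod s z.
Proof.
move=> s0 c0 pO bc.
pose h z := - lnprod s z + ln c.
have hE z : Om z -> h z = - ln (rprod s z) + ln c by move=> /pO h0; rewrite /h ln_rprod_pos.
have shh z : Om z -> shm h z.
  move=> Oz; apply: hm_shm; apply: hmD; last exact: hm_cst.
  by apply: hmN; apply: hm_lnprod_pos; exact: pO.
have hle z : Om z -> h z <= 0.
  move: z; apply: (Omega_max_principle gE) => //.
    move=> z clz Oz eps eps0; have cp := @rprod_continuous _ s.
    have cc : 0 < c - c * expR (- eps).
      by rewrite subr_gt0 gtr_pMr// -expR0 ltr_expR oppr_lt0.
    have /continuousCP/(_ _ cc)[d d0 Hd] := cp z; exists d => // w Ow /Hd.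
    rewrite (bc z clz Oz) ltr_norml => /andP[h1 _]; rewrite hE//.
    have : c * expR (- eps) < rprod s w by lra.
    move=> /(@ltr_ln_pos _ _ _ (mulr_gt0 c0 (expR_gt0 _))).
    by rewrite lnM_pos ?expR_gt0// expRK; lra.
  have [r0 Hr] := rprod_far c s0; exists 0, r0 => z Oz /Hr cz; rewrite hE//.
  by have := ltr_ln_pos c0 cz; lra.
move=> z Oz; rewrite ltNge; apply/negP => zc.
have hz : h z = 0.
  apply/eqP; rewrite eq_le hle//= hE// addrC subr_ge0; apply: ler_ln_pos => //; exact: pO.
have [A [cA AO Az bA]] := Omega_comp Oz.
have H := @strong_max_principle _ Om A h 0 z (open_Omega gE) AO cA shh hle Az hz.
have [r0 Hr] := rprod_far c s0.
apply: bA; exists r0 => w Aw; rewrite leNgt; apply/negP => /Hr cw.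
have := H _ Aw; rewrite (hE _ (AO _ Aw)) => h1; have h2 := ltr_ln_pos c0 cw; lra.
Qed.

(** Integrating ln |P| = ln c over the support and exchanging sum and integral yields the potentials
    at the roots. *)
Lemma sum_pot_rprod s c : 0 < c -> (forall z, S z -> rprod s z = c) ->
  \sum_(i < size s) pot mu (s`_i : C R) = ln c.
Proof.
move=> c0 Sc; have wS w : w \in s -> ~ S w.
  by move=> ws /Sc; rewrite rprod_root// => /eqP; rewrite lt_eqF.
have tl (i : 'I_(size s)) : tame S (fun z => ln (cabs ((s`_i : C R) - z))).
  have Sw := wS _ (mem_nth 0 (ltn_ord i)).
  have [d d0 Hd] := notin_closedC (compactC_closed cS) Sw.
  by apply: (tame_ln cS d0) => w Swi; rewrite leNgt cabsBC; apply/negP => /Hd.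
rewrite /pot -(pint_sum muS)// -(pint_cst mu (ln c)); apply: (eq_pint muS).
- exact: tame_sum.
- exact: tame_cst.
move=> z Sz; rewrite -(Sc _ Sz) ln_rprod_pos ?Sc//.
by apply: eq_bigr => i _; rewrite cabsBC.
Qed.

Theorem equality_boundary s : (0 < size s)%N ->
  pint mu (fun z => rprod s z ^+ 2) <= (cap E ^+ size s) ^+ 2 ->
  cboundary Om = [set z | rprod s z = cap E ^+ size s].
Proof.
move=> s0 /rprod_support; set c := cap E ^+ size s => Sc.
have c0 : 0 < c by rewrite exprn_gt0.
(* The potentials at the roots sum to m e and none is below e, whereas a root in Omega would have
   potential g + e > e. *)
have pO z : Om z -> 0 < rprod s z.
  move=> Oz; rewrite lt_neqAle rprod_ge0 andbT; apply/eqP => z0.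
  have zs : z \in s.
    apply: contraT => zs; have [|_] := @ln_rprod _ s z; last by rewrite -z0 ltxx.
    by move=> w ws; apply: contraNneq zs => ->.
  have := sum_pot_rprod c0 Sc; rewrite /c lnX_pos//.
  have wS w : w \in s -> ~ S w.
    by move=> ws /Sc; rewrite rprod_root// => /eqP; rewrite lt_eqF.
  have iz : (index z s < size s)%N by rewrite index_mem.
  rewrite (bigD1 (Ordinal iz))//= nth_index// (pot_green cE gE muq Oz).
  have h1 : \sum_(i < size s | i != Ordinal iz) e <=
      \sum_(i < size s | i != Ordinal iz) pot mu (s`_i : C R).
    by apply: ler_sum => i _; apply: (pot_ge cE gE muq); apply: wS; exact: mem_nth.
  have h2 : \sum_(i < size s) e = (size s)%:R * e.
    by rewrite sumr_const card_ord mulr_natl.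
  rewrite (bigD1 (Ordinal iz))//= in h2.
  by have := green_gt0 gE Oz; lra.
have bc z : closure Om z -> ~ Om z -> rprod s z = c.
  by move=> clz Oz; apply/Sc/(boundary_support cE gE muq).
have gtO := rprod_gt_on_Omega s0 c0 pO bc.
have leO := rprod_le_off_Omega c0 bc.
rewrite cboundary_Omega; apply/seteqP; split=> z /=; first by move=> [/bc].
move=> zc; have Oz : ~ Om z by move=> /gtO; rewrite zc ltxx.
(* Otherwise z is interior to the complement of Omega and ln |P| has a local maximum there, so |P|
   is locally constant, which is impossible. *)
split=> //; apply: contrapT => clz.
have [d d0 Hd] := notin_closedC (@closed_closure _ Om) clz.
have cp := @rprod_continuous _ s.
have /continuousCP/(_ _ c0)[d1 d10 Hd1] := cp z.
have pos w : cabs (w - z) < d1 -> 0 < rprod s w.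
  by move=> /Hd1; rewrite zc ltr_norml => /andP[+ _]; lra.
have d20 : 0 < Num.min d d1 by rewrite lt_min d0.
have [||d3 d30 Hd3] := @shm_max_const _ (lnprod s) z _ d20.
- by apply: hm_shm; apply: hm_lnprod_pos; rewrite zc.
- move=> w; rewrite lt_min => /andP[/Hd wO /pos w0].
  rewrite -!ln_rprod_pos ?zc//; apply: ler_ln_pos => //; apply: leO.
  by move=> /subset_closure.
apply: (@rprod_not_locally_constant _ s z c (Num.min d1 d3)) => //; first by rewrite gt_eqF.
  by rewrite lt_min d10.
move=> w; rewrite lt_min => /andP[/pos w0 /Hd3].
by rewrite -!ln_rprod_pos ?zc// => /ln_inj_pos; apply.
Qed.

Theorem boundary_equality s c : (0 < size s)%N -> 0 < c ->
  cboundary Om = [set z | rprod s z = c] ->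
  forall z, E z -> rprod s z <= cap E ^+ size s.
Proof.
move=> s0 c0; rewrite cboundary_Omega => bE.
have bc z : closure Om z -> ~ Om z -> rprod s z = c.
  by move=> clz Oz; have : (closure Om `\` Om) z by []; rewrite bE.
have cO z : Om z -> rprod s z <> c.
  move=> Oz zc; have : [set z | rprod s z = c] z by [].
  by rewrite -bE => -[].
(* On a connected unbounded subset of Omega, |P| avoids the value c and takes large values. *)
have gtO z : Om z -> c < rprod s z.
  move=> Oz; rewrite ltNge; apply/negP => zc.
  have [A [cA AO Az bA]] := Omega_comp Oz.
  have [r0 Hr] := rprod_far c s0.
  apply: bA; exists r0 => w Aw; rewrite leNgt; apply/negP => /Hr cw.
  have cp := @rprod_continuous _ s.
  have EA : A `&` [set x | rprod s x < c] = A.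
    apply: cA.
    - exists z; split => //=; rewrite lt_neqAle zc andbT; apply/eqP; exact: cO.
    - by exists [set x | rprod s x < c] => //; exact: open_sublevel.
    - exists (~` [set x | - rprod s x < - c]).
        apply: open_closedC; apply: open_sublevel => x; apply: continuousN; exact: cp.
      apply/seteqP; split=> x /= [Ax xc]; split => //.
        by rewrite ltrN2; apply/negP; rewrite -leNgt ltW.
      move: xc => /negP; rewrite ltrN2 -leNgt lt_neqAle => ->; rewrite andbT; apply/eqP.
      exact/cO/AO.
  by move: Aw; rewrite -EA => -[_ /=]; rewrite ltNge (ltW cw).
have leO := rprod_le_off_Omega c0 bc.
(* With |P| <= c on [E], the constant c remains to be bounded: m g <= ln |P| - ln c on Omega,
   averaged over a large circle. *)
suff cc : c <= cap E ^+ size s.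
  by move=> z Ez; apply: le_trans cc; apply: leO => /Omega_notin.
have k0 : 0 < (size s)%:R :> R by rewrite ltr0n.
have pO z : Om z -> 0 < rprod s z by move=> /gtO; exact: lt_trans.
have gle z : Om z -> (size s)%:R * g z + - lnprod s z + ln c <= 0.
  move: z; apply: (Omega_max_principle gE).
  - move=> z Oz; apply: hm_shm; apply: hmD; last exact: hm_cst.
    apply: hmD; first by apply: hmZ; exact: green_hm Oz.
    by apply: hmN; apply: hm_lnprod_pos; exact: pO.
  - move=> z clz Oz eps eps0; have cg := green_cont gE.
    have /continuousCP := cg z; move=> /(_ (eps / (size s)%:R) (divr_gt0 eps0 k0))[d d0 Hd].
    exists d => // w Ow /Hd; rewrite (green_off gE Oz) subr0 => /ltr_normlW.
    rewrite ltr_pdivlMr// mulrC => h; rewrite -ln_rprod_pos ?pO//.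
    by have := ltr_ln_pos c0 (gtO _ Ow); lra.
  have [B [r0 gB]] := green_growth gE; have [M M0 sM] := seq_bounded s.
  exists ((size s)%:R * (B + ln 2) + ln c), (Num.max (Num.max r0 1) (2 * M)) => z Oz.
  rewrite !gt_max => /andP[/andP[zr z1] zM].
  have z0 : 0 < cabs z := lt_trans ltr01 z1.
  have := gB _ zr; rewrite ler_norml => /andP[_ h1].
  have : \sum_(i < size s) (ln (cabs z) - ln 2) <= lnprod s z.
    apply: ler_sum => i _; rewrite -ln_div_pos//; apply: ler_ln_pos.
      by rewrite divr_gt0.
    have := cabsB_ge z (s`_i : C R); have := sM _ (mem_nth 0 (ltn_ord i)); lra.
  rewrite sumr_const card_ord -mulr_natl => h2.
  have : 0 <= (size s)%:R * (B - (g z - ln (cabs z))) by rewrite mulr_ge0//; lra.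
  by lra.
have [M EM] := compactC_bounded cE; have [M' M'0 sM] := seq_bounded s.
have M0 : 0 <= M by case: E0 => w /EM; exact/le_trans/cabs_ge0.
pose r := 2 * (M + M') + 1; have r0 : 0 < r by rewrite /r; lra.
have Mr : M < r by rewrite /r; lra.
have M2r : 2 * M <= r by rewrite /r; lra.
have cg : circle_cont g 0 r by move=> w _; exact: (green_cont gE).
have cf (i : 'I_(size s)) : circle_cont (fun x => ln (cabs (x - (s`_i : C R)))) 0 r.
  by apply: circle_cont_ln; have := sM _ (mem_nth 0 (ltn_ord i)); rewrite /r; lra.
have cl : circle_cont (lnprod s) 0 r by exact: circle_cont_sum.
have h1 : circ (fun w => (size s)%:R * g w + ln c) 0 r <= circ (lnprod s) 0 r.
  apply: circle_mean_le; [exact: ltW| |exact: cl|].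
    by apply: circle_contD; [exact: circle_contZ|move=> w _; exact: cst_continuous].
  move=> w; rewrite subr0 => wr; have := gle w; rewrite -subr_ge0.
  by move=> /(_ (Omega_far EM _)); rewrite wr => /(_ Mr); lra.
have h2 : circ (lnprod s) 0 r = (size s)%:R * (2 * pi * ln r).
  rewrite /lnprod circle_mean_sum ?(ltW r0)//.
  rewrite (eq_bigr (fun=> 2 * pi * ln r)); first by rewrite sumr_const card_ord [RHS]mulr_natl.
  by move=> i _; apply: circ_ln_far => //; have := sM _ (mem_nth 0 (ltn_ord i)); rewrite /r; lra.
move: h1; rewrite h2 circle_meanD ?(ltW r0)//; last 2 first.
- exact: circle_contZ.
- by move=> w _; exact: cst_continuous.
rewrite circle_meanZ ?(ltW r0)// circ_cst => h1.
have h3 := green_mean_ge cE gE muq r0 EM Mr M2r.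
have pi2 : 0 < 2 * pi :> R by rewrite mulr_gt0// pi_gt0.
have h4 := le_trans (lerD (ler_wpM2l (ltW k0) h3) (lexx (2 * pi * ln c))) h1.
have : 2 * pi * ln c <= 2 * pi * ((size s)%:R * e).
  have fin (p k x y q : R) : k * (p * (x - y)) + q <= k * (p * x) -> q <= p * (k * y).
    by move=> h; lra.
  exact: fin h4.
by rewrite ler_pM2l// -lnX_pos// ler_ln ?posrE ?exprn_gt0.
Qed.

End RegularCompact.

(** * Orthogonal polynomials and product measures *)

Section ComplexIntegral.
Variable R : realType.
Implicit Types (z w a : C R) (r c : R) (f h : C R -> C R) (P p q : {poly C R}).

Definition cj z : C R := Complex (Re z) (- Im z).

Lemma cjD z w : cj (z + w) = cj z + cj w.
Proof. by case: z => a b; case: w => c d; rewrite /cj /GRing.add /= opprD. Qed.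

Lemma cjM z w : cj (z * w) = cj z * cj w.
Proof.
by case: z => a b; case: w => c d; rewrite /cj /GRing.mul /=; congr Complex; ring.
Qed.

Lemma cjK : involutive cj.
Proof. by case=> a b; rewrite /cj /= opprK. Qed.

Lemma cj1 : cj 1 = 1.
Proof. by rewrite /cj /= oppr0. Qed.

Lemma cj_prod (I : Type) (s : seq I) (F : I -> C R) :
  cj (\prod_(i <- s) F i) = \prod_(i <- s) cj (F i).
Proof. by rewrite (big_morph cj cjM cj1). Qed.

Lemma mul_cj z : z * cj z = Complex (cabs z ^+ 2) 0.
Proof.
case: z => a b; rewrite /cj /cabs /GRing.mul /=; congr Complex; last by ring.
by rewrite sqr_sqrtr ?addr_ge0 ?sqr_ge0//; ring.
Qed.

Lemma ReD z w : Re (z + w) = Re z + Re w.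
Proof. by case: z => a b; case: w. Qed.

Lemma ImD z w : Im (z + w) = Im z + Im w.
Proof. by case: z => a b; case: w. Qed.

Lemma ReM z w : Re (z * w) = Re z * Re w - Im z * Im w.
Proof. by case: z => a b; case: w. Qed.

Lemma ImM z w : Im (z * w) = Re z * Im w + Im z * Re w.
Proof. by case: z => a b; case: w. Qed.

Lemma complexP z w : Re z = Re w -> Im z = Im w -> z = w.
Proof. by case: z => a b; case: w => c d /= -> ->. Qed.

Lemma real_prod (I : Type) (s : seq I) (F : I -> R) :
  \prod_(i <- s) (Complex (F i) 0 : C R) = Complex (\prod_(i <- s) F i) 0.
Proof.
by elim: s => [|i s IH]; rewrite ?big_nil// !big_cons IH; apply: complexP; rewrite ?ReM ?ImM/=; ring.
Qed.

Definition ctame (E : set (C R)) f := tame E (fun w => Re (f w)) /\ tame E (fun w => Im (f w)).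

Section Integral.
Variables (mu : probability (R * R)%type R) (E : set (C R)).
Hypotheses (cE : compact E) (muE : carried mu E).

Lemma ctame_cst a : ctame E (fun=> a).
Proof. by split; exact: tame_cst. Qed.

Lemma ctame_id : ctame E (fun w => w).
Proof.
split; apply: tame_continuous => //; [exact: continuous_Re|exact: continuous_Im].
Qed.

Lemma ctameD f h : ctame E f -> ctame E h -> ctame E (fun w => f w + h w).
Proof.
move=> [f1 f2] [h1 h2]; split.
  by under eq_fun do rewrite ReD; exact: tameD.
by under eq_fun do rewrite ImD; exact: tameD.
Qed.

Lemma ctameM f h : ctame E f -> ctame E h -> ctame E (fun w => f w * h w).
Proof.
move=> [f1 f2] [h1 h2]; split.
  by under eq_fun do rewrite ReM; apply: tameB; exact: tameM.
by under eq_fun do rewrite ImM; apply: tameD; exact: tameM.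
Qed.

Lemma ctame_cj f : ctame E f -> ctame E (fun w => cj (f w)).
Proof. by move=> [f1 f2]; split=> //=; exact: tameN. Qed.

Lemma ctame_sum (I : Type) (s : seq I) (F : I -> C R -> C R) :
  (forall i, ctame E (F i)) -> ctame E (fun w => \sum_(i <- s) F i w).
Proof.
move=> tF; elim: s => [|i s IH].
  by under eq_fun do rewrite big_nil; exact: ctame_cst.
by under eq_fun do rewrite big_cons; exact: ctameD.
Qed.

Lemma ctame_horner P : ctame E (fun w => P.[w]).
Proof.
elim/poly_ind: P => [|P a IH].
  by under eq_fun do rewrite horner0; exact: ctame_cst.
under eq_fun do rewrite hornerMXaddC.
by apply: ctameD; [apply: ctameM => //; exact: ctame_id|exact: ctame_cst].
Qed.

Definition cpint f : C R :=
  Complex (pint mu (fun w => Re (f w))) (pint mu (fun w => Im (f w))).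

Lemma cpintD f h : ctame E f -> ctame E h ->
  cpint (fun w => f w + h w) = cpint f + cpint h.
Proof.
move=> [f1 f2] [h1 h2]; apply: complexP; rewrite ?ReD ?ImD /=.
  by under eq_fun do rewrite ReD; exact: (pintD muE).
by under eq_fun do rewrite ImD; exact: (pintD muE).
Qed.

Lemma cpintZ a f : ctame E f -> cpint (fun w => a * f w) = a * cpint f.
Proof.
have tc c (u : C R -> R) : tame E u -> tame E (fun w => c * u w).
  by move=> tu; apply: tameM => //; exact: tame_cst.
move=> [f1 f2]; apply: complexP; rewrite ?ReM ?ImM /=.
  under eq_fun do rewrite ReM.
  by rewrite (pintB muE (tc _ _ f1) (tc _ _ f2)) (pintZ muE _ f1) (pintZ muE _ f2).
under eq_fun do rewrite ImM.
by rewrite (pintD muE (tc _ _ f2) (tc _ _ f1)) (pintZ muE _ f1) (pintZ muE _ f2).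
Qed.

Lemma cpint_cj f : ctame E f -> cpint (fun w => cj (f w)) = cj (cpint f).
Proof.
move=> [f1 f2]; apply: complexP => //=; rewrite -[RHS]mulN1r -(pintZ muE _ f2).
by congr pint; apply/funext => w; rewrite mulN1r.
Qed.

Lemma cpint_sum (I : Type) (s : seq I) (F : I -> C R -> C R) :
  (forall i, ctame E (F i)) ->
  cpint (fun w => \sum_(i <- s) F i w) = \sum_(i <- s) cpint (F i).
Proof.
move=> tF; elim: s => [|i s IH].
  under eq_fun do rewrite big_nil.
  by rewrite big_nil /cpint /=; apply: complexP; rewrite /= pint_cst.
under eq_fun do rewrite big_cons.
by rewrite cpintD ?IH ?big_cons//; exact: ctame_sum.
Qed.

Definition ip p q : C R := cpint (fun w => p.[w] * cj q.[w]).

Lemma ip_tame p q : ctame E (fun w => p.[w] * cj q.[w]).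
Proof. by apply: ctameM; [exact: ctame_horner|apply: ctame_cj; exact: ctame_horner]. Qed.

Lemma ipDl p q P : ip (p + q) P = ip p P + ip q P.
Proof.
rewrite /ip -cpintD; try exact: ip_tame.
by congr cpint; apply/funext => w; rewrite hornerD mulrDl.
Qed.

Lemma ipZl a p P : ip (a *: p) P = a * ip p P.
Proof.
rewrite /ip -cpintZ; last exact: ip_tame.
by congr cpint; apply/funext => w; rewrite hornerZ mulrA.
Qed.

Lemma ip_sym p q : ip p q = cj (ip q p).
Proof.
rewrite /ip -cpint_cj; last exact: ip_tame.
by congr cpint; apply/funext => w; rewrite cjM cjK mulrC.
Qed.

Lemma ip0l P : ip 0 P = 0.
Proof. by rewrite -(scale0r 0) ipZl mul0r. Qed.

Lemma cj0 : cj 0 = 0. Proof. by rewrite /cj /= oppr0. Qed.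

Lemma ip_suml (I : Type) (s : seq I) (F : I -> {poly C R}) P :
  ip (\sum_(i <- s) F i) P = \sum_(i <- s) ip (F i) P.
Proof. by rewrite (big_morph (ip ^~ P) (fun p q => ipDl p q P) (ip0l P)). Qed.

Definition sqnorm p : R := pint mu (fun w => cabs p.[w] ^+ 2).

Lemma sqnorm_tame p : tame E (fun w => cabs p.[w] ^+ 2).
Proof.
have [h _] := ip_tame p p.
rewrite (_ : (fun w => _) = (fun w => Re (p.[w] * cj p.[w])))//.
by apply/funext => w; rewrite mul_cj.
Qed.

Lemma ip_sqnorm p : ip p p = Complex (sqnorm p) 0.
Proof.
apply: complexP => /=; first by congr pint; apply/funext => w; rewrite mul_cj.
by rewrite -[RHS](pint_cst mu); congr pint; apply/funext => w; rewrite mul_cj.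
Qed.

Definition orthopoly m p :=
  [/\ p \is monic, size p = m.+1 & forall q, (size q <= m)%N -> ip q p = 0].

(** Pythagoras: q - p has degree below m, hence is orthogonal to p. *)
Lemma orthopoly_min m p q : orthopoly m p -> q \is monic -> size q = m.+1 ->
  sqnorm p <= sqnorm q.
Proof.
move=> [pm sp op] qm sq; have s : (size (q - p)%R <= m)%N.
  rewrite -ltnS -sq; apply: (leq_trans (n := m.+1)); last by rewrite sq.
  rewrite ltnS; apply/leq_sizeP => k; rewrite leq_eqVlt => /orP[/eqP <-|mk].
    move: qm pm; rewrite !monicE /lead_coef sp sq /= coefB => /eqP -> /eqP ->.
    by rewrite subrr.
  by rewrite coefB !nth_default ?subrr// ?sp ?sq.
have e1 : ip q p = ip p p by rewrite -[q in LHS](subrK p) ipDl op// add0r.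
have : ip (q - p) (q - p) = ip q q - ip p p.
  have ipB (P Q T : {poly C R}) : ip (P - Q) T = ip P T - ip Q T.
    by rewrite -[- Q]scaleN1r ipDl ipZl mulN1r.
  have cjB z w : cj (z - w) = cj z - cj w.
    by case: z => ? ?; case: w => ? ?; rewrite /cj /= opprD.
  by rewrite ipB [ip p (q - p)]ip_sym op// cj0 subr0 [LHS]ip_sym ipB cjB -!ip_sym e1.
rewrite !ip_sqnorm => /(congr1 (@Re R)) /= h.
have : 0 <= sqnorm (q - p) by apply: Rintegral_ge0 => w _; exact: sqr_ge0.
by rewrite h subr_ge0.
Qed.

(** Gram-Schmidt applied to X^m; strict positivity on monic polynomials allows the divisions. *)
Lemma orthopoly_exists : (forall p, p \is monic -> 0 < sqnorm p) ->
  forall m, exists p, orthopoly m p.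
Proof.
move=> pos m; elim/ltn_ind: m => m IH.
have [P HP] : exists P : nat -> {poly C R}, forall k, (k < m)%N -> orthopoly k (P k).
  have H k : exists p, (k < m)%N -> orthopoly k p.
    have [km|km] := ltnP k m; first by have [p] := IH _ km; exists p.
    by exists 0.
  by have [P HP] := choice H; exists P.
have pp k : (k < m)%N -> ip (P k) (P k) != 0.
  move=> /HP[Pm _ _]; rewrite ip_sqnorm; apply/eqP => /(congr1 (@Re R)) /= /eqP.
  by rewrite gt_eqF// pos.
pose r := \sum_(k < m) (ip 'X^m (P k) / ip (P k) (P k)) *: P k.
have sr : (size r <= m)%N.
  apply: (leq_trans (size_sum _ _ _)); apply/bigmax_leqP => k _.
  rewrite (leq_trans (size_scale_leq _ _))//; have [_ -> _] := HP _ (ltn_ord k); exact: ltn_ord.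
pose p := 'X^m - r.
have sp : size p = m.+1 by rewrite size_polyDl ?size_polyXn// size_polyN ltnS.
have pm : p \is monic.
  by rewrite monicE /p lead_coefDl ?lead_coefXn// size_polyN size_polyXn ltnS.
exists p; split=> //.
have orth l : (l < m)%N -> ip (P l) p = 0.
  move=> lm; rewrite ip_sym /p -scaleN1r ipDl ipZl ip_suml (bigD1 (Ordinal lm))//= big1 ?addr0.
    by rewrite ipZl divfK ?pp// mulN1r subrr cj0.
  move=> k /eqP kl; rewrite ipZl; suff -> : ip (P k) (P l) = 0 by rewrite mulr0.
  have kl' : (k : nat) != l by apply/eqP => h; apply: kl; exact: val_inj.
  move: kl'; rewrite neq_ltn => /orP[h|h].
    by have [_ _ ->] := HP _ lm => //; have [_ -> _] := HP _ (ltn_ord k).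
  rewrite ip_sym; have [_ _ ->] := HP _ (ltn_ord k); first exact: cj0.
  by have [_ -> _] := HP _ lm.
(* The monic P_k span the polynomials of lower degree: subtracting q_k P_k removes the top
   coefficient. *)
suff H k q : (size q <= k)%N -> (k <= m)%N -> ip q p = 0 by move=> q qm; exact: (H m).
elim: k q => [|k IHk] q; first by rewrite size_poly_leq0 => /eqP -> _; exact: ip0l.
move=> sq km; have [Pm sP _] := HP _ km.
rewrite -(subrK (q`_k *: P k) q) ipDl ipZl orth// mulr0 addr0; apply: IHk; last exact: ltnW.
apply/leq_sizeP => j; rewrite leq_eqVlt => /orP[/eqP <-|kj].
  rewrite coefB coefZ; have : (P k)`_k = 1 by move: Pm; rewrite monicE /lead_coef sP => /eqP.
  by move=> ->; rewrite mulr1 subrr.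
have hP : (P k)`_j = 0 by apply: nth_default; rewrite sP.
by rewrite coefB coefZ (nth_default _ (leq_trans sq kj)) hP mulr0 subrr.
Qed.

End Integral.

End ComplexIntegral.

(** * Integration of sums of product functions *)

Section ProductIntegral.
Variables (R : realType) (n : nat).
Variables (K : 'I_n -> set (C R)) (mu : 'I_n -> probability (R * R)%type R).
Hypotheses (cK : forall j, compact (K j)) (muK : forall j, carried (mu j) (K j)).


(* The list of pairs (c, p) stands for the sum of the functions
   c * \prod_j p_j(z_j). *)
Definition product_term := (C R * ('I_n -> {poly C R}))%type.
Implicit Types (A B D : seq product_term) (z : 'I_n -> C R) (l : seq 'I_n).

Definition pev A z : C R := \sum_(a <- A) a.1 * \prod_j (a.2 j).[z j].

(* The sesquilinear form attached to the variables in [l], the others being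
   evaluated at [z]. *)
Definition hform l A B z : C R :=
  \sum_(a <- A) \sum_(b <- B) a.1 * cj b.1 *
    \prod_j (if j \in l then ip (mu j) (a.2 j) (b.2 j) else (a.2 j).[z j] * cj (b.2 j).[z j]).

Lemma cjsum (I : Type) (s : seq I) (F : I -> C R) :
  cj (\sum_(i <- s) F i) = \sum_(i <- s) cj (F i).
Proof. by rewrite (big_morph (@cj R) (@cjD R) (@cj0 R)). Qed.

Lemma hform_nil A B z : hform [::] A B z = pev A z * cj (pev B z).
Proof.
rewrite /hform /pev cjsum big_distrl/=; apply: eq_bigr => a _.
rewrite big_distrr/=; apply: eq_bigr => b _.
by rewrite cjM cj_prod mulrACA -big_split.
Qed.

Lemma hform_upd l j A B z w : j \notin l ->
  hform l A B (upd z j w) = \sum_(a <- A) \sum_(b <- B) (a.1 * cj b.1 *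
    \prod_(k | k != j) (if k \in l then ip (mu k) (a.2 k) (b.2 k)
                        else (a.2 k).[z k] * cj (b.2 k).[z k])) *
    ((a.2 j).[w] * cj (b.2 j).[w]).
Proof.
move=> jl; apply: eq_bigr => a _; apply: eq_bigr => b _.
rewrite -[RHS]mulrA; congr (_ * _); rewrite (bigD1 j)//= (negbTE jl) /upd eqxx mulrC.
by congr (_ * _); apply: eq_bigr => k /negbTE ->.
Qed.

Lemma hform_ctame l j A B z : j \notin l ->
  ctame (K j) (fun w => hform l A B (upd z j w)).
Proof.
move=> jl; rewrite (funext (fun w => hform_upd A B z w jl)).
apply: ctame_sum => a; apply: ctame_sum => b; apply: ctameM; first exact: ctame_cst.
exact: ip_tame.
Qed.

Lemma hform_step l j A B z : j \notin l ->
  cpint (mu j) (fun w => hform l A B (upd z j w)) = hform (j :: l) A B z.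
Proof.
move=> jl; rewrite (funext (fun w => hform_upd A B z w jl)).
have tj p q := @ip_tame R (K j) (@cK j) p q.
have tab (a b : product_term) (d : C R) :
    ctame (K j) (fun w => d * ((a.2 j).[w] * cj (b.2 j).[w])).
  by apply: ctameM; [exact: ctame_cst|exact: tj].
rewrite (cpint_sum (muK j)); last by move=> a; exact: ctame_sum.
apply: eq_bigr => a _; rewrite (cpint_sum (muK j))//; apply: eq_bigr => b _.
rewrite (cpintZ (muK j))// -mulrA; congr (_ * _).
rewrite [RHS](bigD1 j)//= inE eqxx/= mulrC; congr (_ * _).
by apply: eq_bigr => k kj; rewrite inE (negbTE kj).
Qed.

(** Each integration moves one variable into the list, so the iterated integral is evaluated
    algebraically, one variable at a time. *)
Lemma iter_int_hform l A z : uniq l ->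
  iter_int mu l (fun z => (cabs (pev A z) ^+ 2)%:E) z = (Re (hform l A A z))%:E.
Proof.
elim: l z => [|j l IH] z /=; first by rewrite hform_nil mul_cj.
move=> /andP[jl ul]; under eq_integral do rewrite IH//.
by rewrite (EFin_pint (muK j) (hform_ctame A A z jl).1) -hform_step.
Qed.

(** The measures are probabilities, so partial L^2 norms are bounded by sup norms; this links
    [L2norm] to the Chebyshev constants. *)
Lemma hform_le l A M z : uniq l ->
  (forall x, prodset K x -> cabs (pev A x) ^+ 2 <= M) -> prodset K z ->
  Re (hform l A A z) <= M.
Proof.
move=> + AM; elim: l z => [|j l IH] z /=; first by move=> _ /AM; rewrite hform_nil mul_cj.
move=> /andP[jl ul] Kz; rewrite -hform_step//= -[leRHS](pint_cst (mu j)).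
apply: (le_pint (muK j)); [exact: (hform_ctame A A z jl).1|exact: tame_cst|].
by move=> w Kw; apply: IH => // k; rewrite /upd; case: eqP => // ->.
Qed.

Lemma hform_ge0 l A z : uniq l -> 0 <= Re (hform l A A z).
Proof.
elim: l z => [|j l IH] z /=; first by rewrite hform_nil mul_cj sqr_ge0.
by move=> /andP[jl ul]; rewrite -hform_step//=; apply: Rintegral_ge0 => p _; exact: IH.
Qed.

Definition herm A B : C R := \sum_(a <- A) \sum_(b <- B) a.1 * cj b.1 *
  \prod_j ip (mu j) (a.2 j) (b.2 j).

Lemma hform_enum A B z : hform (enum 'I_n) A B z = herm A B.
Proof.
apply: eq_bigr => a _; apply: eq_bigr => b _; congr (_ * _).
by apply: eq_bigr => j _; rewrite mem_enum.
Qed.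

Lemma nu_int_herm A : nu_int mu (fun z => (cabs (pev A z) ^+ 2)%:E) = (Re (herm A A))%:E.
Proof. by rewrite /nu_int iter_int_hform ?enum_uniq// hform_enum. Qed.

Lemma L2norm_herm A : L2norm mu (pev A) = Num.sqrt (Re (herm A A)).
Proof. by rewrite /L2norm nu_int_herm. Qed.

Lemma herm_ge0 A : 0 <= Re (herm A A).
Proof. by rewrite -(hform_enum _ _ (fun=> 0)) hform_ge0// enum_uniq. Qed.

Lemma prodset_neq0 : exists z, prodset K z.
Proof.
have H j : exists w, K j w by have [w Kw] := carried_neq0 (muK j); exists w.
by have [z Hz] := choice H; exists z.
Qed.

Lemma herm_le A M : (forall x, prodset K x -> cabs (pev A x) ^+ 2 <= M) ->
  Re (herm A A) <= M.
Proof.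
by move=> AM; have [z Kz] := prodset_neq0; rewrite -(hform_enum _ _ z) hform_le ?enum_uniq.
Qed.

Lemma herm_catl A B D : herm (A ++ B) D = herm A D + herm B D.
Proof. by rewrite /herm big_cat. Qed.

Lemma herm_sym A B : herm A B = cj (herm B A).
Proof.
rewrite /herm exchange_big cjsum; apply: eq_bigr => b _; rewrite cjsum.
apply: eq_bigr => a _; rewrite !cjM cjK cj_prod [cj b.1 * _]mulrC; congr (_ * _).
by apply: eq_bigr => j _; rewrite [LHS](ip_sym (@cK j) (muK j)).
Qed.

Lemma herm1 (c d : C R) (p q : 'I_n -> {poly C R}) :
  herm [:: (c, p)] [:: (d, q)] = c * cj d * \prod_j ip (mu j) (p j) (q j).
Proof. by rewrite /herm !big_seq1. Qed.

Variable p : 'I_n -> {poly C R}.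
Local Notation m2 := (\prod_j sqnorm (mu j) (p j)).

(** Expansion of the squared norm of A - p, where the hypothesis says that the cross terms equal the
    squared norm of p. *)
Lemma herm_orthogonal_ge A : herm A [:: (1, p)] = Complex m2 0 -> m2 <= Re (herm A A).
Proof.
move=> hA; have h1 : herm A [:: (-1, p)] = - Complex m2 0.
  rewrite -hA /herm -sumrN; apply: eq_bigr => a _; rewrite !big_seq1 -mulNr.
  congr (_ * _); case: (a.1) => x y; rewrite /cj /=.
  by apply: complexP; rewrite ?ReM ?ImM/= ?ReM ?ImM /=; ring.
have h2 : herm [:: (-1, p)] [:: (-1, p)] = Complex m2 0.
  rewrite herm1 (eq_bigr (fun j => Complex (sqnorm (mu j) (p j)) 0)) => [|j _].
    by rewrite real_prod (_ : _ * cj _ = 1) ?mul1r//; apply: complexP; rewrite ?ReM ?ImM /=; ring.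
  exact: ip_sqnorm.
have := herm_ge0 (A ++ [:: (-1, p)]).
rewrite herm_catl ReD [herm A _]herm_sym [herm _ (A ++ _)]herm_sym !herm_catl h2.
rewrite [herm [:: _] A]herm_sym h1; case: (herm A A) => x y; rewrite /cj /=; lra.
Qed.

End ProductIntegral.

(** * The monomial order *)

Section Enumeration.
Variables (n : nat) (alpha : nat -> 'I_n -> nat).
Hypothesis halpha : is_monomial_enum alpha.
Implicit Types (a b : 'I_n -> nat) (i j : nat).

Lemma mdeg_le a b : (forall k, a k <= b k)%N -> (mdeg a <= mdeg b)%N.
Proof. by move=> ab; apply: leq_sum => k _. Qed.

Lemma mdeg_eq a b : (forall k, a k <= b k)%N -> (mdeg b <= mdeg a)%N -> a =1 b.
Proof.
move=> ab ba; have ab' k : true -> (a k <= b k ?= iff (a k == b k))%N by move=> _; split.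
have [le eq] := leqif_sum ab'.
have /eqP : mdeg a == mdeg b by rewrite eqn_leq ba mdeg_le.
by move=> /eqP; rewrite /mdeg eq => /forallP/= H k; apply/eqP; exact: H.
Qed.

(** The order extends the componentwise one: b <= a componentwise gives |b| <= |a|, and equal
    degrees force b = a. *)
Lemma enum_before_nle a b : enum_before a b -> ~ (forall k, b k <= a k)%N.
Proof.
move=> [h|[h [l [hl _]]]] ba; first by have := mdeg_le ba; rewrite leqNgt h.
by have := mdeg_eq ba; rewrite h leqnn => /(_ isT) /(_ l) e; rewrite e ltnn in hl.
Qed.

Lemma enum_inj i j : alpha i =1 alpha j -> i = j.
Proof.
move=> ij; case: (ltngtP i j) => [h|h|//]; exfalso.
  by apply: (enum_before_nle (halpha.1 _ _ h)) => k; rewrite ij.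
by apply: (enum_before_nle (halpha.1 _ _ h)) => k; rewrite ij.
Qed.

Lemma enum_lt_exists i j : (j < i)%N -> exists k, (alpha j k < alpha i k)%N.
Proof.
move=> ji; apply: contrapT => H; apply: (enum_before_nle (halpha.1 _ _ ji)) => k.
by rewrite leqNgt; apply/negP => h; apply: H; exists k.
Qed.

Lemma enum_le_index i j : (forall k, alpha j k <= alpha i k)%N -> (j <= i)%N.
Proof. by move=> ji; rewrite leqNgt; apply/negP => /(halpha.1 _ _)/enum_before_nle; apply. Qed.

Lemma enum_mdeg i j : (j <= i)%N -> (mdeg (alpha j) <= mdeg (alpha i))%N.
Proof.
rewrite leq_eqVlt => /orP[/eqP -> //|/(halpha.1 _ _) [/ltnW//|[-> _]//]].
Qed.

Variable R : realType.

(** In the expanded product only exponents componentwise below [alpha i] survive, and their indices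
    are at most i. *)
Lemma tensor_monom (p : 'I_n -> {poly C R}) i :
  (forall k, p k \is monic) -> (forall k, size (p k) = (alpha i k).+1) ->
  forall z : 'I_n -> C R, \prod_k (p k).[z k] =
    \sum_(j < i.+1) (\prod_k (p k)`_(alpha j k)) * monom (alpha j) z.
Proof.
move=> pm sp z; set M := mdeg (alpha i).
have le_mdeg a k : (a k <= mdeg a)%N by rewrite /mdeg (bigD1 k)//= leq_addr.
have pE k : (p k).[z k] = \sum_(d < M.+1) (p k)`_d * z k ^+ d.
  by apply: horner_coef_wide; rewrite sp ltnS.
rewrite (eq_bigr _ (fun k _ => pE k)) bigA_distr_bigA/=.
(* Multi-indices are re-encoded as finite functions bounded by |alpha i|, the index type produced by
   distributing the product over the sums. *)
pose h (j : 'I_i.+1) : {ffun 'I_n -> 'I_M.+1} := [ffun k => inord (alpha j k)].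
have hE (j : 'I_i.+1) k : h j k = alpha j k :> nat.
  rewrite ffunE inordK// ltnS (leq_trans (le_mdeg _ _))// enum_mdeg//.
  by rewrite -ltnS.
have hinj : injective h.
  move=> j j' jj; apply: val_inj; apply: enum_inj => k.
  by rewrite -!hE jj.
rewrite (bigID (mem [set h x | x : 'I_i.+1]%SET))/= [X in _ + X]big1 ?addr0; last first.
  move=> f fh; apply/eqP; apply: contraT => fn0; exfalso.
  have fle k : (f k <= alpha i k)%N.
    rewrite leqNgt; apply/negP => fk; move/negP: fn0; apply.
    by rewrite (bigD1 k)//= nth_default ?mul0r ?mul0r// sp.
  have [j jE] := halpha.2 (fun k => f k).
  have ji : (j < i.+1)%N by rewrite ltnS; apply: enum_le_index => k; rewrite jE.
  move/negP: fh; apply; apply/imsetP; exists (Ordinal ji) => //.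
  by apply/ffunP => k; apply: val_inj; rewrite /= hE /= jE.
rewrite big_imset/=; last by move=> ? ? _ _ /hinj.
rewrite (eq_bigl xpredT); last by move=> j; rewrite inE.
apply: eq_bigr => j _; rewrite /monom -big_split/=.
by apply: eq_bigr => k _; rewrite hE.
Qed.

Lemma tensor_inP (p : 'I_n -> {poly C R}) i :
  (forall k, p k \is monic) -> (forall k, size (p k) = (alpha i k).+1) ->
  inP alpha i (fun z => \prod_k (p k).[z k]).
Proof.
move=> pm sp; exists (fun j => \prod_k (p k)`_(alpha j k)) => z.
rewrite (tensor_monom pm sp) big_ord_recr/= addrC; congr (_ + _).
rewrite big1 ?mul1r// => k _.
by have := pm k; rewrite monicE /lead_coef sp => /eqP.
Qed.

End Enumeration.

(** * One-variable orthogonal polynomials and the equality case *)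

Section OneVariable.
Variable R : realType.
Implicit Types (p q : {poly C R}).
Variables (E : set (C R)) (g : C R -> R) (mu : probability (R * R)%type R).
Hypotheses (cE : compact E) (gE : continuous_green E g) (muq : is_equilibrium E mu).
Let muE : carried mu E := equilibrium_carried cE muq.
Let E0 : E !=set0 := equilibrium_neq0 cE muq.
Let capE : 0 < cap E := cap_gt0 cE E0 gE.

Lemma monic_rprod m p : p \is monic -> size p = m.+1 ->
  exists2 s, size s = m & forall w, cabs p.[w] = rprod s w.
Proof.
move=> pm sp; have [s [ss ps]] := poly_rprod (monic_neq0 pm).
exists s; first by rewrite ss sp.
by move=> w; rewrite ps (monicP pm) mul1r cabs_prod.
Qed.

Lemma sqnorm_ge m p : p \is monic -> size p = m.+1 ->
  (cap E ^+ m) ^+ 2 <= sqnorm mu p.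
Proof.
move=> pm sp; have [s <- ps] := monic_rprod pm sp.
rewrite /sqnorm (_ : (fun w => _) = (fun w => rprod s w ^+ 2)).
  exact: (pint_rprod2_ge cE gE muq).
by apply/funext => w; rewrite ps.
Qed.

Lemma monic_sqnorm_gt0 p : p \is monic -> 0 < sqnorm mu p.
Proof.
move=> pm; apply: (lt_le_trans _ (@sqnorm_ge (size p).-1 _ pm _)).
  by rewrite !exprn_gt0.
by rewrite prednK// size_poly_gt0 monic_neq0.
Qed.

Lemma orthopoly_equality m p : orthopoly mu m p ->
  sqnorm mu p <= (cap E ^+ m) ^+ 2 <->
  (m = 0%N \/ exists q, size q = m.+1 /\ cboundary (Omega E) = [set z | cabs q.[z] = 1]).
Proof.
move=> om; have [pm sp _] := om; split.
  have [->|m0] := posnP m; first by left.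
  have [s sm ps] := monic_rprod pm sp => h; right.
  have c0 : 0 < cap E ^+ m by rewrite exprn_gt0.
  have z0 : Complex ((cap E ^+ m)^-1) 0 != 0 :> C R.
    by apply/eqP => -[/eqP]; rewrite invr_eq0 gt_eqF.
  (* Rescaling moves the level Cap(E)^m to 1. *)
  exists (Complex ((cap E ^+ m)^-1) 0 *: p); split; first by rewrite size_scale.
  rewrite (equality_boundary cE gE muq (s := s)) ?sm//; last first.
    apply: le_trans h; rewrite /sqnorm le_eqVlt; apply/orP; left; apply/eqP.
    by congr pint; apply/funext => w; rewrite ps.
  apply/seteqP; split=> z /=; rewrite hornerZ cabsM ps cabs_real gtr0_norm ?invr_gt0//.
    by move=> ->; rewrite mulVf// gt_eqF.
  by move=> h1; rewrite -[RHS]mulr1 -h1 mulrA mulfV ?mul1r// gt_eqF.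
have [m0|m0] := posnP m; last first.
  move=> [m0'|[q [sq bq]]]; first by rewrite m0' in m0.
  have q0 : q != 0 by rewrite -size_poly_gt0 sq.
  have [s [ss qs]] := poly_rprod q0; rewrite sq/= in ss.
  have L0 : lead_coef q != 0 by rewrite lead_coef_eq0.
  have l0 : 0 < cabs (lead_coef q) by exact: cabs_gt0.
  have qE z : cabs q.[z] = cabs (lead_coef q) * rprod s z by rewrite qs cabsM cabs_prod.
  have bs : cboundary (Omega E) = [set z | rprod s z = (cabs (lead_coef q))^-1].
    rewrite bq; apply/seteqP; split=> z /=; rewrite qE; last by move=> ->; rewrite mulfV// gt_eqF.
    by move=> h; rewrite -[RHS]mulr1 -h mulKf// gt_eqF.
  have s0 : (0 < size s)%N by rewrite ss.
  have li : 0 < (cabs (lead_coef q))^-1 by rewrite invr_gt0.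
  have HE := boundary_equality cE gE muq s0 li bs.
  have mq : (lead_coef q)^-1 *: q \is monic by rewrite monicE lead_coefZ mulVf.
  (* The monic multiple of q is at most Cap(E)^m in modulus on [E], and p has the least norm. *)
  apply: (le_trans (orthopoly_min cE muE om mq _)).
    by rewrite size_scale ?invr_eq0.
  rewrite -[leRHS](pint_cst mu); apply: (le_pint muE); [exact: sqnorm_tame|exact: tame_cst|].
  move=> z /HE; rewrite ss hornerZ cabsM qE cabsV mulKf ?gt_eqF// => h.
  by rewrite lerXn2r ?nnegrE ?rprod_ge0// exprn_ge0// ltW.
rewrite m0 in sp *; have [s /size0nil -> ps] := monic_rprod pm sp.
rewrite expr0 expr1n /sqnorm (_ : (fun w => _) = (fun=> 1)) ?pint_cst//.
by apply/funext => w; rewrite ps /rprod big_nil expr1n.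
Qed.

End OneVariable.

(** * The product set and its Chebyshev constants *)

Section Product.
Variables (R : realType) (n : nat).
Variables (K : 'I_n -> set (C R)) (mu : 'I_n -> probability (R * R)%type R).
Variable alpha : nat -> 'I_n -> nat.
Hypotheses (cK : forall j, compact (K j)) (rK : forall j, regular (K j)).
Hypotheses (muq : forall j, is_equilibrium (K j) (mu j)).
Hypothesis halpha : is_monomial_enum alpha.
Let muK j : carried (mu j) (K j) := equilibrium_carried (@cK j) (muq j).

Lemma cap_K_gt0 j : 0 < cap (K j).
Proof. by have [g gK] := rK j; exact: (cap_gt0 (@cK j) (carried_neq0 (muK j)) gK). Qed.

Lemma orthopolys i : exists p : 'I_n -> {poly C R}, forall j, orthopoly (mu j) (alpha i j) (p j).
Proof.
have H j : exists p, orthopoly (mu j) (alpha i j) p.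
  have [g gK] := rK j; apply: (orthopoly_exists (@cK j) (muK j)).
  exact: (monic_sqnorm_gt0 (@cK j) gK (muq j)).
by have [p Hp] := choice H; exists p.
Qed.

Definition inP_terms i (c : nat -> C R) : seq (product_term R n) :=
  (1, fun k => 'X^(alpha i k)) :: [seq (c j, fun k => 'X^(alpha j k)) | j <- iota 0 i].

Lemma inP_pev i P : inP alpha i P -> exists c, P = pev (inP_terms i c).
Proof.
move=> [c Pc]; exists c; apply/funext => z; rewrite Pc /pev big_cons mul1r big_map.
congr (_ + _); first by apply: eq_bigr => k _; rewrite hornerXn.
rewrite -[i in iota 0 i]subn0 -/(index_iota 0 i) big_mkord; apply: eq_bigr => j _.
by congr (_ * _); apply: eq_bigr => k _; rewrite hornerXn.
Qed.

(** The inner product of any competitor with the tensor product is the squared norm of the latter: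
    only the leading monomial contributes. *)
Lemma herm_inP_ge i c (p : 'I_n -> {poly C R}) :
  (forall j, orthopoly (mu j) (alpha i j) (p j)) ->
  \prod_j sqnorm (mu j) (p j) <= Re (herm mu (inP_terms i c) (inP_terms i c)).
Proof.
move=> op; apply: (herm_orthogonal_ge cK muK).
rewrite /herm big_cons big_map [X in _ + X]big1_seq ?addr0; last first.
  move=> j /andP[_]; rewrite mem_iota add0n => /andP[_ ji].
  rewrite big_seq1; have [k jk] := enum_lt_exists halpha ji.
  rewrite (bigD1 k)//=; have [_ _ ->] := op k; first by rewrite mul0r mulr0.
  by rewrite size_polyXn.
rewrite big_seq1 cj1 !mul1r -real_prod; apply: eq_bigr => j _ /=.
(* X^a - p has degree below a, so X^a and p have the same inner product with p. *)
rewrite -ip_sqnorm; have [pm sp o0] := op j.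
rewrite -[in LHS](subrK (p j) 'X^(alpha i j)) (ipDl (@cK j) (muK j)) o0 ?add0r//.
apply/leq_sizeP => k; rewrite coefB coefXn leq_eqVlt => /orP[/eqP <-|jk].
  by rewrite eqxx; move: pm; rewrite monicE /lead_coef sp => /eqP ->; rewrite subrr.
by rewrite gtn_eqF// nth_default ?subrr// sp.
Qed.

Lemma L2norm_tensor i (p : 'I_n -> {poly C R}) :
  (forall j, orthopoly (mu j) (alpha i j) (p j)) ->
  L2norm mu (fun z => \prod_k (p k).[z k]) = Num.sqrt (\prod_j sqnorm (mu j) (p j)).
Proof.
move=> op; rewrite (_ : (fun z => _) = pev [:: (1, p)]); last first.
  by apply/funext => z; rewrite /pev big_seq1 mul1r.
rewrite (L2norm_herm cK muK) herm1 cj1 !mul1r.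
rewrite (eq_bigr _ (fun j _ => ip_sqnorm (mu j) (p j))).
by rewrite real_prod.
Qed.

Lemma MOP_norm i V (p : 'I_n -> {poly C R}) :
  (forall j, orthopoly (mu j) (alpha i j) (p j)) -> is_MOP mu alpha i V ->
  L2norm mu V = Num.sqrt (\prod_j sqnorm (mu j) (p j)).
Proof.
move=> op [VP Vmin]; apply/eqP; rewrite eq_le; apply/andP; split.
  rewrite -(L2norm_tensor op); apply: Vmin; apply: (tensor_inP halpha).
    by move=> k; have [] := op k.
  by move=> k; have [] := op k.
have [c ->] := inP_pev VP; rewrite (L2norm_herm cK muK).
by apply: ler_wsqrtr; exact: herm_inP_ge.
Qed.

Lemma sqnorm_cap i (p : 'I_n -> {poly C R}) :
  (forall j, orthopoly (mu j) (alpha i j) (p j)) ->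
  forall j, (cap (K j) ^+ alpha i j) ^+ 2 <= sqnorm (mu j) (p j).
Proof.
move=> op j; have [g gK] := rK j; have [pm sp _] := op j.
exact: (sqnorm_ge (@cK j) gK (muq j)).
Qed.

Lemma prod_cap_gt0 i : 0 < \prod_j cap (K j) ^+ alpha i j.
Proof. by apply: prodr_gt0 => j _; rewrite exprn_gt0// cap_K_gt0. Qed.

Lemma prod_cap_le_sqrt i (p : 'I_n -> {poly C R}) :
  (forall j, orthopoly (mu j) (alpha i j) (p j)) ->
  \prod_j cap (K j) ^+ alpha i j <= Num.sqrt (\prod_j sqnorm (mu j) (p j)).
Proof.
move=> op; rewrite -[leLHS]ger0_norm ?(ltW (prod_cap_gt0 i))// -sqrtr_sqr.
apply: ler_wsqrtr; rewrite -prodrXl; apply: ler_prod => j _.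
by rewrite sqr_ge0 sqnorm_cap.
Qed.

Lemma MOP_norm_ge i V : is_MOP mu alpha i V ->
  \prod_j cap (K j) ^+ alpha i j <= L2norm mu V.
Proof.
by have [p op] := orthopolys i => /(MOP_norm op) ->; exact: prod_cap_le_sqrt.
Qed.

Lemma MOP_norm_eq i V : is_MOP mu alpha i V ->
  L2norm mu V = \prod_j cap (K j) ^+ alpha i j <->
  (forall j, alpha i j = 0%N \/ exists q : {poly C R}, size q = (alpha i j).+1 /\
     cboundary (Omega (K j)) = [set z | cabs q.[z] = 1]).
Proof.
have [p op] := orthopolys i => /(MOP_norm op) ->; have pc := sqnorm_cap op.
have iffj j : sqnorm (mu j) (p j) <= (cap (K j) ^+ alpha i j) ^+ 2 <->
    (alpha i j = 0%N \/ exists q : {poly C R}, size q = (alpha i j).+1 /\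
     cboundary (Omega (K j)) = [set z | cabs q.[z] = 1]).
  by have [g gK] := rK j; exact: (orthopoly_equality (@cK j) gK (muq j) (op j)).
have c0 j : 0 < (cap (K j) ^+ alpha i j) ^+ 2 by rewrite !exprn_gt0// cap_K_gt0.
have s0 j : 0 <= sqnorm (mu j) (p j) by rewrite (le_trans _ (pc j))// ltW.
split=> [h j|h].
  apply/iffj; rewrite leNgt; apply/negP => hj.
  have : \prod_j sqnorm (mu j) (p j) = \prod_j (cap (K j) ^+ alpha i j) ^+ 2.
    by rewrite -[LHS]sqr_sqrtr ?h ?prodrXl// prodr_ge0.
  apply/eqP; rewrite gt_eqF// (bigD1 j)//= [ltRHS](bigD1 j)//=.
  (* No factor is below its bound and all are positive, so one strict factor makes the product
     strict. *)
  apply: (@lt_le_trans _ _ (sqnorm (mu j) (p j) * \prod_(k | k != j) (cap (K k) ^+ alpha i k) ^+ 2)).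
    by rewrite ltr_pM2r// prodr_gt0.
  by rewrite ler_wpM2l// ler_prod// => k _; rewrite (ltW (c0 k)) pc.
have -> : \prod_j sqnorm (mu j) (p j) = (\prod_j cap (K j) ^+ alpha i j) ^+ 2.
  rewrite -prodrXl; apply: eq_bigr => j _; apply/eqP.
  by rewrite eq_le pc andbT; exact/iffj.
by rewrite sqrtr_sqr ger0_norm// ltW// prod_cap_gt0.
Qed.

(** Makes [supnorm] a genuine supremum. *)
Lemma pev_bounded (A : seq (product_term R n)) :
  exists M, forall z, prodset K z -> cabs (pev A z) <= M.
Proof.
have [B HB] : exists B : product_term R n -> 'I_n -> R,
    forall a j w, K j w -> cabs (a.2 j).[w] <= B a j.
  have H (a : product_term R n * 'I_n) : exists M, forall w, K a.2 w -> cabs (a.1.2 a.2).[w] <= M.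
    have [[_ [M1 H1]] [_ [M2 H2]]] := @ctame_horner R (K a.2) (@cK a.2) (a.1.2 a.2).
    exists (M1 + M2) => w Kw; have := H1 _ Kw; have := H2 _ Kw.
    case: (_.[w]) => x y /= h2 h1; rewrite (le_trans (cabs_le_ReIm _ _))// lerD//.
  by have [B HB] := choice H; exists (fun a j => B (a, j)) => a j; exact: (HB (a, j)).
elim: A => [|a A [M IH]]; first by exists 0 => z _; rewrite /pev big_nil cabs0.
exists (cabs a.1 * \prod_j B a j + M) => z Kz; rewrite /pev big_cons.
rewrite (le_trans (cabsD _ _))// lerD ?IH// cabsM cabs_prod ler_wpM2l ?cabs_ge0//.
by apply: ler_prod => j _; rewrite cabs_ge0 HB.
Qed.

Lemma supnorm_ub i P z : inP alpha i P -> prodset K z -> cabs (P z) <= supnorm K P.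
Proof.
move=> /inP_pev[c ->] Kz; apply: ub_le_sup; last by exists z.
by have [M HM] := pev_bounded (inP_terms i c); exists M => _ [w Kw <-]; exact: HM.
Qed.

(** The sup norm dominates the L^2 norm of every competitor, hence the minimal one. *)
Lemma prod_cap_le_tcheb i : \prod_j cap (K j) ^+ alpha i j <= tcheb K alpha i.
Proof.
have [p op] := orthopolys i.
apply: lb_le_inf.
  exists (supnorm K (fun z => \prod_k (p k).[z k])); exists (fun z => \prod_k (p k).[z k]) => //.
  by apply: (tensor_inP halpha) => k; have [] := op k.
move=> _ [P /= PP <-]; apply: (le_trans (prod_cap_le_sqrt op)).
have [z0 Kz0] := prodset_neq0 muK.
have sP : 0 <= supnorm K P by rewrite (le_trans (cabs_ge0 _) (supnorm_ub PP Kz0)).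
have ub z : prodset K z -> cabs (P z) <= supnorm K P by exact: supnorm_ub PP.
have [c Pc] := inP_pev PP; rewrite -[leRHS]ger0_norm// -sqrtr_sqr; apply: ler_wsqrtr.
apply: (le_trans (herm_inP_ge c op)); apply: (herm_le cK muK) => z Kz.
by rewrite -Pc lerXn2r ?nnegrE ?cabs_ge0// ub.
Qed.

Lemma tcheb_le i P M : inP alpha i P -> (forall z, prodset K z -> cabs (P z) <= M) ->
  tcheb K alpha i <= M.
Proof.
move=> PP PM; apply: (@le_trans _ _ (supnorm K P)).
  apply: ge_inf; last by exists P.
  (* 0 bounds the sup norms from below; the default value of [sup] is 0 as well. *)
  exists 0 => _ [Q _ <-]; have [z0 Kz0] := prodset_neq0 muK.
  rewrite /supnorm; have [hs|/sup_out ->//] := pselect (has_sup [set cabs (Q z) | z in prodset K]).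
  by rewrite (le_trans (cabs_ge0 (Q z0)))//; apply: sup_upper_bound => //; exists z0.
apply: ge_sup; first by have [z Kz] := prodset_neq0 muK; exists (cabs (P z)), z.
by move=> _ [z Kz <-]; exact: PM.
Qed.

Lemma le_root (x k : R) m : (0 < m)%N -> 0 <= k -> k ^+ m <= x -> k <= x `^ (m%:R)^-1.
Proof.
move=> m0 k0 kx; have <- : (k ^+ m) `^ (m%:R)^-1 = k.
  by rewrite -powR_mulrn// -powRrM mulfV ?powRr1// pnatr_eq0 -lt0n.
by rewrite ge0_ler_powR// ?nnegrE ?invr_ge0 ?(le_trans _ kx)// exprn_ge0.
Qed.

Lemma root_le (x k : R) m : (0 < m)%N -> 0 <= x -> 0 <= k -> x <= k ^+ m -> x `^ (m%:R)^-1 <= k.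
Proof.
move=> m0 x0 k0 kx; have <- : (k ^+ m) `^ (m%:R)^-1 = k.
  by rewrite -powR_mulrn// -powRrM mulfV ?powRr1// pnatr_eq0 -lt0n.
by rewrite ge0_ler_powR// ?nnegrE ?invr_ge0// exprn_ge0.
Qed.

Local Notation root_tcheb := (fun i => ((tcheb K alpha i) `^ ((mdeg (alpha i))%:R)^-1)%:E).

Lemma limn_einf_ge (u : nat -> \bar R) N c : (forall i, (N <= i)%N -> (c <= u i)%E) ->
  (c <= limn_einf u)%E.
Proof.
move=> cu; rewrite limn_einf_lim (cvg_lim _ (@cvg_einfs_sup _ u))//.
apply: le_trans (ereal_sup_ubound _); last by exists N.
by apply: le_ereal_inf_tmp => _ [i /= Ni <-]; exact: cu.
Qed.

Lemma limn_einf_le (u : nat -> \bar R) c :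
  (forall N, exists2 i, (N <= i)%N & (u i <= c)%E) -> (limn_einf u <= c)%E.
Proof.
move=> uc; rewrite limn_einf_lim (cvg_lim _ (@cvg_einfs_sup _ u))//.
apply: ge_ereal_sup => _ [N _ <-]; have [i Ni ui] := uc N.
by apply: le_trans ui; apply: ereal_inf_lbound; exists i.
Qed.

Lemma mdeg_gt0 i : (0 < i)%N -> (0 < mdeg (alpha i))%N.
Proof.
move=> i0; rewrite lt0n; apply/negP => /eqP a0.
have : (i <= 0)%N; last by rewrite leqNgt i0.
apply: (enum_le_index halpha) => k; suff -> : alpha i k = 0%N by [].
by apply/eqP; rewrite -leqn0 -a0 /mdeg (bigD1 k)//= leq_addr.
Qed.

Lemma root_tcheb_ge c : 0 <= c -> (forall j, c <= cap (K j)) ->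
  (c%:E <= limn_einf root_tcheb)%E.
Proof.
(* Index 0 is left out, its degree being 0. *)
move=> c0 cc; apply: (@limn_einf_ge _ 1) => i i1; rewrite lee_fin.
apply: le_root => //; first exact: mdeg_gt0.
apply: le_trans (prod_cap_le_tcheb i).
rewrite /mdeg expr_sum; apply: ler_prod => j _.
by rewrite exprn_ge0//= lerXn2r// ?nnegrE// (le_trans c0).
Qed.

(** Along multi-indices k e_{j0}, the Fekete polynomials of K_{j0} in the single variable z_{j0}
    have sup norm at most (Cap + eps)^k. *)
Lemma root_tcheb_le j0 : (limn_einf root_tcheb <= (cap (K j0))%:E)%E.
Proof.
have [g gK] := rK j0; have K0 := carried_neq0 (muK j0); have ck := @cK j0.
have me := min_energy_ln_cap ck K0 gK.
apply/lee_addgt0Pr => eps eps0; rewrite -EFinD.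
have ce0 : 0 < cap (K j0) + eps by rewrite addr_gt0// cap_K_gt0.
pose c := - ln (cap (K j0) + eps).
have cme : (c%:E < min_energy (K j0))%E.
  by rewrite me lte_fin ltrN2; apply: ltr_ln_pos; rewrite ?cap_K_gt0// ltrDl.
apply: limn_einf_le => N.
(* A degree above |alpha N| guarantees an index beyond N. *)
have [k kN [s [ss sK sc]]] := fekete_szego ck K0 cme (mdeg (alpha N)).+1.
have k0 : (0 < k)%N by rewrite (leq_trans _ kN).
have [i iE] := halpha.2 (fun j => if j == j0 then k else 0%N).
have di : mdeg (alpha i) = k.
  rewrite /mdeg (bigD1 j0)//= iE eqxx big1 ?addn0// => j jj0.
  by rewrite iE (negbTE jj0).
exists i.
  rewrite leqNgt; apply/negP => iN; have := enum_mdeg halpha (ltnW iN).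
  by rewrite di leqNgt kN.
rewrite lee_fin di; apply: root_le => //.
- by apply: le_trans (prod_cap_le_tcheb i); exact/ltW/prod_cap_gt0.
- exact: ltW.
pose p j : {poly C R} := if j == j0 then \prod_(w <- s) ('X - w%:P) else 1.
have pP : inP alpha i (fun z => \prod_k (p k).[z k]).
  apply: (tensor_inP halpha) => j; rewrite /p ?iE; case: ifP => _.
  - exact: monic_prod_XsubC.
  - exact: monic1.
  - by rewrite size_prod_XsubC ss.
  - by rewrite size_poly1.
apply: (tcheb_le pP) => z Kz.
rewrite (bigD1 j0)//= big1 ?mulr1; last first.
  by move=> j jj0; rewrite /p (negbTE jj0) hornerC.
rewrite /p eqxx horner_prod cabs_prod.
under eq_bigr do rewrite hornerXsubC.
apply: (le_trans (sc _ (Kz j0))).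
by rewrite /c opprK mulrC -lnX_pos// lnK ?posrE// exprn_gt0.
Qed.

(** With no variables there is a single multi-index, while [alpha 0] must strictly precede
    [alpha 1]. *)
Lemma index_exists : exists j : 'I_n, true.
Proof.
case: (pickP (fun _ : 'I_n => true)) => [l _|h]; first by exists l.
have [|[_ [l _]]] := halpha.1 0%N 1%N isT; last by exists l.
by rewrite [X in (_ < X)%N]/mdeg big1// => k; rewrite h.
Qed.

(** The lower limit lies between the positive minimum of the capacities and each capacity, so it is
    finite and [fine] returns its true value. *)
Lemma tau_minus_cap : 0 < tau_minus K alpha /\ forall j, tau_minus K alpha <= cap (K j).
Proof.
have [j0 _] := index_exists.
pose c := \big[Order.min/cap (K j0)]_j cap (K j).
have c0 : 0 < c by apply: lt_bigmin => [|j _]; exact: cap_K_gt0.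
have cc j : c <= cap (K j) by exact: bigmin_le_cond.
have h1 := root_tcheb_ge (ltW c0) cc; have h2 := root_tcheb_le.
rewrite /tau_minus; move: h1 h2; case: limn_einf => [x| |] /=.
- by rewrite lee_fin => cx h2; split; [exact: lt_le_trans cx|move=> j; have := h2 j; rewrite lee_fin].
- by move=> _ /(_ j0); rewrite leye_eq.
- by rewrite leeNy_eq.
Qed.

Lemma tau_minus_prod i : 0 < tau_minus K alpha ^+ mdeg (alpha i) /\
  tau_minus K alpha ^+ mdeg (alpha i) <= \prod_j cap (K j) ^+ alpha i j.
Proof.
have [t0 tc] := tau_minus_cap; split; first by rewrite exprn_gt0.
rewrite /mdeg expr_sum; apply: ler_prod => j _.
by rewrite exprn_ge0 ?(ltW t0)//= lerXn2r// ?nnegrE ?(ltW t0)// (le_trans (ltW t0)).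
Qed.

Lemma W2_ge1 i V : is_MOP mu alpha i V -> 1 <= W2 K mu alpha i V.
Proof.
move=> /MOP_norm_ge h; have [t0 tc] := tau_minus_prod i.
by rewrite /W2 ler_pdivlMr// mul1r (le_trans tc).
Qed.

End Product.

Theorem theorem4p3 (R : realType) (n : nat)
    (K : 'I_n -> set (C R))
    (hKcompact : forall j, compact (K j))
    (hKregular : forall j, regular (K j))
    (mu : 'I_n -> probability (R * R)%type R)
    (hmu : forall j, is_equilibrium (K j) (mu j))
    (alpha : nat -> 'I_n -> nat)
    (halpha : is_monomial_enum alpha)
    (i : nat) (V : ('I_n -> C R) -> C R)
    (hV : is_MOP mu alpha i V) :
  [/\ \prod_(j < n) cap (K j) ^+ alpha i j <= L2norm mu V,
      1 <= W2 K mu alpha i V ^+ 2,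
      L2norm mu V = \prod_(j < n) cap (K j) ^+ alpha i j <->
        (forall j : 'I_n, alpha i j = 0%N \/
           exists Rj : {poly C R}, size Rj = (alpha i j).+1 /\
             cboundary (Omega (K j)) = [set z | cabs Rj.[z] = 1]) &
      (L2norm mu V = \prod_(j < n) cap (K j) ^+ alpha i j ->
        forall c : nat, (0 < c)%N ->
        forall (i' : nat), (forall k, alpha i' k = (c * alpha i k)%N) ->
        forall V' : ('I_n -> C R) -> C R, is_MOP mu alpha i' V' ->
          L2norm mu V' = \prod_(j < n) cap (K j) ^+ (c * alpha i j)%N)].
Proof.
have eqV := MOP_norm_eq hKcompact hKregular hmu halpha hV.
split => //.
- exact: (MOP_norm_ge hKcompact hKregular hmu halpha hV).
- by rewrite exprn_ege1// (W2_ge1 hKcompact hKregular hmu halpha hV).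
move=> /eqV H c c0 i' i'E V' hV'.
under eq_bigr do rewrite -i'E.
apply/(MOP_norm_eq hKcompact hKregular hmu halpha hV') => j; rewrite i'E.
have [->|[q [sq bq]]] := H j; first by left; rewrite muln0.
(* The power has degree c alpha_j and the same level set of modulus 1. *)
right; exists (q ^+ c); have q0 : q != 0 by rewrite -size_poly_gt0 sq.
split; first by rewrite -(prednK (_ : 0 < size (q ^+ c))%N) ?size_exp ?sq 1?mulnC// size_poly_gt0 expf_neq0.
rewrite bq; apply/seteqP; split=> z /=; rewrite horner_exp cabsX.
  by move=> ->; rewrite expr1n.
by move=> /eqP; rewrite pexpr_eq1 ?cabs_ge0// => /eqP.
Qed.
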